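(* Let $p\ge1$ and $r\in[1,\infty]$. Let $X,Y,Z$ be random vectors in $\mathbb{R}^d$ such that $Z\sim N(0,I_d)$ and $Z$ is independent of $(X,Y)$. Let $H:\mathbb{R}^{3d}\to\mathbb{R}^d$ be a measurable function, $H=H(x,y,z)$, that is continuously differentiable in the $z$-argument (with Jacobian $\frac{\partial H}{\partial Z}$), assume that all terms in the estimates below are finite, and define $G_t:=Z+X+tY$, $t\in[0,1]$. Then, writing $H=H(X,Y,Z)$ and $\frac{\partial H}{\partial Z}=\frac{\partial H}{\partial Z}(X,Y,Z)$ inside expectations and norms, $$\begin{aligned}&\bigl\|\mathbb{E}[H\mid Z+X+Y]-\mathbb{E}[H\mid Z+X]\bigr\|_{p,r}\\&\le\int_0^1\Bigl(\bigl\|\mathbb{E}\bigl[\tfrac{\partial H}{\partial Z}\,\big|\,G_t\bigr]Y\bigr\|_{p,r}+\bigl\|\mathbb{E}\bigl[\tfrac{\partial H}{\partial Z}\,Y\,\big|\,G_t\bigr]\bigr\|_{p,r}+\bigl\|\mathbb{E}\bigl(H\langle Z,Y\rangle\mid G_t\bigr)\bigr\|_{p,r}\\&\qquad+\bigl\|\mathbb{E}\bigl(HZ^\top\mid G_t\bigr)Y\bigr\|_{p,r}+\bigl\|\mathbb{E}\bigl(\langle Y,Z\rangle\mid G_t\bigr)\,\mathbb{E}\bigl(H\mid G_t\bigr)\bigr\|_{p,r}+\bigl\|\langle Y,\mathbb{E}[Z\mid G_t]\rangle\,\mathbb{E}\bigl(H\mid G_t\bigr)\bigr\|_{p,r}\Bigr)dt.\end{aligned}$$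 Moreover, for any $\rho,a,c,\alpha_0,\beta_0,\alpha_1,\beta_1,\gamma_1,\alpha_2,\beta_2,\gamma_2\in[1,\infty]$ satisfying $$\frac1p=\frac1a+\frac1c,\qquad\frac1p=\frac1{\alpha_0}+\frac1{\beta_0},\qquad\frac1p=\frac1{\alpha_1}+\frac1{\beta_1}+\frac1{\gamma_1},\qquad\frac1p=\frac1{\alpha_2}+\frac1{\beta_2}+\frac1{\gamma_2},$$ we have $$\begin{aligned}\bigl\|\mathbb{E}[H\mid Z+X+Y]-\mathbb{E}[H\mid Z+X]\bigr\|_{p,r}\le\;&2\Bigl\|\frac{\partial H}{\partial Z}\Bigr\|_{a,\rho\to r}\|Y\|_{c,\rho}+4\|H\|_{\alpha_0,r}\|Y\|_{\beta_0,2}\|g\|_{\beta_0}\\&+4\|H\|_{\alpha_1,r}\|X\|_{\beta_1,2}\|Y\|_{\gamma_1,2}+2\|H\|_{\alpha_2,r}\|Y\|_{\beta_2,2}\|Y\|_{\gamma_2,2},\end{aligned}$$ where $\|g\|_{\beta_0}$ denotes the $L^{\beta_0}$-norm of a one-dimensional standard Gaussian $g$. The same conclusions hold if $H$ also depends on an auxiliary random element $U$ such that $Z$ is independent of $(X,Y,U)$.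
   Context: $|x|_r$ is the $\ell^r$ norm on $\mathbb{R}^d$, $r\in[1,\infty]$; $\langle\cdot,\cdot\rangle$ is the Euclidean inner product. For a random vector $X$, $\|X\|_{p,r}:=(\mathbb{E}|X|_r^p)^{1/p}$ (essential supremum of $|X|_r$ if $p=\infty$; $1/\infty=0$). For a matrix $A$, $\|A\|_{\rho\to r}:=\sup_{|u|_\rho\le1}|Au|_r$, and for a random matrix $A$, $\|A\|_{a,\rho\to r}:=(\mathbb{E}\|A\|_{\rho\to r}^a)^{1/a}$ (essential supremum if $a=\infty$). *)

(* Defs.v *)
From HB Require Import structures.
From mathcomp Require Import all_boot all_order all_algebra.
From mathcomp Require Import all_classical all_reals all_analysis.

Set Implicit Arguments.
Unset Strict Implicit.
Unset Printing Implicit Defensive.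

Import Order.TTheory GRing.Theory Num.Theory.
Import numFieldNormedType.Exports.

Local Open Scope classical_set_scope.
Local Open Scope ring_scope.

(* The product sigma-algebra on matrices, generated by the entries, as the
   library does for tuples. Over the reals it is the Borel sigma-algebra. *)
Definition measure_matrix_display : measure_display -> measure_display.
Proof. exact. Qed.

Section measurable_matrix.
Context {dS} {S : measurableType dS} (m n : nat).

Let mx_measurable : set (set 'M[S]_(m, n)) :=
  <<s \bigcup_(ij in [set: 'I_m * 'I_n])
        preimage_set_system setT (fun A : 'M[S]_(m, n) => A ij.1 ij.2)
          measurable >>.

Let mx_measurable0 : mx_measurable set0.
Proof. exact: sigma_algebra0. Qed.

Let mx_measurableC A : mx_measurable A -> mx_measurable (~` A).
Proof. exact: sigma_algebraC. Qed.

Let mx_measurable_bigcup (F : (set 'M[S]_(m, n))^nat) :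
  (forall i, mx_measurable (F i)) -> mx_measurable (\bigcup_i F i).
Proof. exact: sigma_algebra_bigcup. Qed.

HB.instance Definition _ := @isMeasurable.Build (measure_matrix_display dS)
  'M[S]_(m, n) mx_measurable mx_measurable0 mx_measurableC
  mx_measurable_bigcup.

End measurable_matrix.

Section vectors.
Context {R : realType} {d : nat}.
Implicit Types (x y u : 'cV[R]_d) (A : 'M[R]_d).

Definition lrnorm (r : \bar R) x : R :=
  match r with
  | r'%:E => (\sum_(i < d) `|x i 0| `^ r') `^ r'^-1
  | +oo%E => \big[Num.max/0]_(i < d) `|x i 0|
  | -oo%E => 0
  end.

Definition opnorm (rho r : \bar R) A : R :=
  sup [set lrnorm r (A *m u) | u in [set u | lrnorm rho u <= 1]].

Definition dotv x y : R := \sum_(i < d) x i 0 * y i 0.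

(* The library's [jacobian] acts on row vectors, hence this version. *)
Definition jac (f : 'cV[R]_d -> 'cV[R]_d) (z : 'cV[R]_d) : 'M[R]_d :=
  \matrix_(i, j) ('D_(delta_mx j 0) f z) i 0.

Definition continuously_differentiable (f : 'cV[R]_d -> 'cV[R]_d) : Prop :=
  (forall z, differentiable f z) /\ continuous (jac f).

End vectors.

Section probability_notions.
Context {dT} {T : measurableType dT} {R : realType} (P : probability T R).

Definition independent_RV {d1 d2} {T1 : measurableType d1}
    {T2 : measurableType d2} (V : T -> T1) (W : T -> T2) : Prop :=
  forall A B, measurable A -> measurable B ->
    P (V @^-1` A `&` W @^-1` B) = (P (V @^-1` A) * P (W @^-1` B))%E.

(* V ~ N(0, I_d): the law of V is the d-fold product of N(0, 1). *)
Definition standard_gaussian {d : nat} (V : T -> 'cV[R]_d) : Prop :=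
  forall A : 'I_d -> set R, (forall i, measurable (A i)) ->
    P [set w | forall i, A i (V w i 0)] =
    (\prod_(i < d) normal_prob (0 : R) 1 (A i))%E.

(* E is a version of E[F | W] *)
Definition is_cond_exp {d'} {T' : measurableType d'} (F : T -> R)
    (W : T -> T') (E : T -> R) : Prop :=
  [/\ measurable_fun [set: g_sigma_algebra_preimageType W] E,
      P.-integrable setT (EFin \o E) &
      forall A, g_sigma_algebra_preimage W A ->
        (\int[P]_(w in A) (E w)%:E = \int[P]_(w in A) (F w)%:E)%E].

(* A chosen version of E[F | W]; it is the null function when there is none,
   i.e., when F is not integrable. *)
Definition cond_exp {d'} {T' : measurableType d'} (F : T -> R)
    (W : T -> T') : T -> R :=
  xget (cst 0) [set E | is_cond_exp F W E].

Definition cond_expM {d'} {T' : measurableType d'} {m n : nat}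
    (F : T -> 'M[R]_(m, n)) (W : T -> T') (w : T) : 'M[R]_(m, n) :=
  \matrix_(i, j) cond_exp (fun w' => F w' i j) W w.

Definition integrableM {m n : nat} (F : T -> 'M[R]_(m, n)) : Prop :=
  forall i j, P.-integrable setT (fun w => (F w i j)%:E).

Definition norm_pr (p r : \bar R) {d : nat} (V : T -> 'cV[R]_d) : \bar R :=
  Lnorm P p (fun w => (lrnorm r (V w))%:E).

Definition norm_op (a rho r : \bar R) {d : nat} (A : T -> 'M[R]_d) : \bar R :=
  Lnorm P a (fun w => (opnorm rho r (A w))%:E).

End probability_notions.

Definition gauss_norm {R : realType} (b : \bar R) : \bar R :=
  Lnorm (normal_prob (0 : R) 1) b (fun x => x%:E).

(* Below, H and J stand for the random vector H(X, Y, Z) (or H(X, Y, Z, U))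
   and for the random matrix given by its Jacobian in the z-argument. *)
Section estimates.
Context {dT} {T : measurableType dT} {R : realType} (P : probability T R).
Context {d : nat} (p r : \bar R).
Variables (X Y Z H : T -> 'cV[R]_d) (J : T -> 'M[R]_d).

Definition interp (t : R) (w : T) : 'cV[R]_d := Z w + X w + t *: Y w.

Definition cond_exp_gap : \bar R :=
  norm_pr P p r (fun w => cond_expM P H (fun w' => Z w' + X w' + Y w') w
                          - cond_expM P H (fun w' => Z w' + X w') w).

Local Open Scope ereal_scope.

Definition six_terms (t : R) : \bar R :=
  let G := interp t in
    norm_pr P p r (fun w => cond_expM P J G w *m Y w)
  + norm_pr P p r (cond_expM P (fun w => J w *m Y w) G)
  + norm_pr P p r (cond_expM P (fun w => dotv (Z w) (Y w) *: H w) G)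
  + norm_pr P p r (fun w => cond_expM P (fun w' => H w' *m (Z w')^T) G w *m Y w)
  + norm_pr P p r (fun w => cond_exp P (fun w' => dotv (Y w') (Z w')) G w
                            *: cond_expM P H G w)
  + norm_pr P p r (fun w => dotv (Y w) (cond_expM P Z G w)
                            *: cond_expM P H G w).

(* Finiteness of the terms presupposes that the conditional expectations
   exist, which is what the integrability hypotheses express. *)
Definition integral_estimate : Prop :=
  integrableM P H -> integrableM P J ->
  integrableM P (fun w => J w *m Y w) ->
  integrableM P (fun w => dotv (Z w) (Y w) *: H w) ->
  integrableM P (fun w => H w *m (Z w)^T) ->
  P.-integrable setT (fun w => (dotv (Y w) (Z w))%:E) ->
  \int[lebesgue_measure]_(t in `[0%R, 1%R]) six_terms t < +oo ->
  cond_exp_gap <= \int[lebesgue_measure]_(t in `[0%R, 1%R]) six_terms t.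

Definition moment_estimate : Prop :=
  forall rho a c alpha0 beta0 alpha1 beta1 gamma1 alpha2 beta2 gamma2 : \bar R,
  1 <= rho -> 1 <= a -> 1 <= c -> 1 <= alpha0 -> 1 <= beta0 ->
  1 <= alpha1 -> 1 <= beta1 -> 1 <= gamma1 ->
  1 <= alpha2 -> 1 <= beta2 -> 1 <= gamma2 ->
  p^-1 = a^-1 + c^-1 ->
  p^-1 = alpha0^-1 + beta0^-1 ->
  p^-1 = alpha1^-1 + beta1^-1 + gamma1^-1 ->
  p^-1 = alpha2^-1 + beta2^-1 + gamma2^-1 ->
  let term_J := norm_op P a rho r J * norm_pr P c rho Y in
  let term_g := norm_pr P alpha0 r H * norm_pr P beta0 2%:E Y
                * gauss_norm beta0 in
  let term_X := norm_pr P alpha1 r H * norm_pr P beta1 2%:E X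
                * norm_pr P gamma1 2%:E Y in
  let term_Y := norm_pr P alpha2 r H * norm_pr P beta2 2%:E Y
                * norm_pr P gamma2 2%:E Y in
  integrableM P H ->
  term_J < +oo -> term_g < +oo -> term_X < +oo -> term_Y < +oo ->
  cond_exp_gap <=
    2%:E * term_J + 4%:E * term_g + 4%:E * term_X + 2%:E * term_Y.

End estimates.

(* Main.v *)
Require Import Defs.
From HB Require Import structures.
From mathcomp Require Import all_boot all_order all_algebra.
From mathcomp Require Import all_classical all_reals all_analysis.
From mathcomp Require Import measurable_realfun ess_sup_inf.
From mathcomp Require Import ring lra.

Set Implicit Arguments.
Unset Strict Implicit.
Unset Printing Implicit Defensive.

Import Order.TTheory GRing.Theory Num.Theory.
Import numFieldNormedType.Exports.

Local Open Scope classical_set_scope.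
Local Open Scope ring_scope.

(* Write V = (X, Y) (or (X, Y, U)), G_t = Z + X + tY and let gamma be the Gaussian
   kernel. By Bayes' formula E[F(V, Z) | G_t] = K_t F(G_t), where
     K_t F(g) = E'[F(V', g - X' - tY') gamma(g - X' - tY')] / E'[gamma(g - X' - tY')]
   and the expectations bear on an independent copy of V. For fixed g0 and y,
   t |-> K_t H(g0 + ty) is absolutely continuous, and its derivative is a sum of
   six terms, built from K_t applied to dH/dZ, (dH/dZ)Y, H<Z, Y>, HZ^T, <Y, Z>,
   Z and H. Taking g0 = Z + X and y = Y turns these into the six conditional
   expectations of the integral estimate, so that this estimate follows from
   Minkowski's integral inequality.
   For the moment estimate, inside K_t( . )(G_t) the argument Z equals
   G_t - X' - tY', so <Z, y> = <G_t, y> - <X', y> - t<Y', y>; hence the terms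
   with Z against the outer Y reduce to products of conditional expectations of
   |H|, |X|, |Y|, |X||H| and |Y||H| with <Z, Y>, |X| and |Y|, which are bounded
   by Hoelder's and Jensen's inequalities. Given V, <Z, Y> is distributed as
   |Y|_2 g, and the factor 4t of the last term integrates to 2. *)

(** * Matrices, vectors and their norms *)

(** A conditional expectation given [G_t] is defined up to a null set depending on t, so
    [E[H | G_t]] cannot be differentiated in t as it stands; the kernel supplies versions that are
    jointly measurable in t and in the point. Its numerator is not differentiated under the
    expectation: integrability of [F(V, Z)] only makes [K_t |F|] integrable over t along almost
    every path. Instead, the integrand is C^1 in t for each value of the copy V'; the fundamental
    theorem of calculus is applied there, and Fubini's theorem concludes. The denominator is
    differentiated under the integral, which takes [E|Y| < oo]; this follows from the integrability
    of [<Y, Z>], as [E|<Z, Y>| = E|Y|_2 E|g|]. The majorant of the integral estimate involves chosen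
    versions and has unknown measurability in t, so Minkowski's inequality is proved for such
    majorants. The constants of the moment estimate count occurrences: two terms contain the
    Jacobian, four contain Z and give one Gaussian norm each, and the two with Z against the outer Y
    also give two terms in X and two in tY each. *)

Section matrix_measurability.
Context {dS} {S : measurableType dS} {dT} {T : measurableType dT} {m n : nat}.

Lemma measurable_coord i j :
  measurable_fun [set: 'M[S]_(m, n)] (fun A : 'M[S]_(m, n) => A i j).
Proof.
move=> _ B mB; apply: sub_sigma_algebra.
by exists (i, j) => //; exists B.
Qed.

Lemma measurable_mx (D : set T) (F : T -> 'M[S]_(m, n)) : measurable D ->
  (forall i j, measurable_fun D (fun w => F w i j)) -> measurable_fun D F.
Proof.
move=> mD mF.
apply: (measurability (\bigcup_(ij in [set: 'I_m * 'I_n])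
        preimage_set_system setT (fun A : 'M[S]_(m, n) => A ij.1 ij.2)
          measurable)) => //.
move=> _ [_ [[i j] _ [B mB <-]] <-].
rewrite setTI -comp_preimage.
exact: (mF i j).
Qed.

Lemma measurable_mx_coord (D : set T) (F : T -> 'M[S]_(m, n)) i j :
  measurable_fun D F -> measurable_fun D (fun w => F w i j).
Proof. by move=> mF; apply: (measurableT_comp (measurable_coord i j)). Qed.

End matrix_measurability.

Section real_matrix_measurability.
Context {R : realType} {dT} {T : measurableType dT}.

Lemma measurable_mxD m n (F G : T -> 'M[R]_(m, n)) : measurable_fun setT F ->
  measurable_fun setT G -> measurable_fun setT (fun w => F w + G w).
Proof.
move=> mF mG; apply: measurable_mx => // i j.
under eq_fun do rewrite mxE.
by apply: measurable_funD; exact: measurable_mx_coord.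
Qed.

Lemma measurable_mxB m n (F G : T -> 'M[R]_(m, n)) : measurable_fun setT F ->
  measurable_fun setT G -> measurable_fun setT (fun w => F w - G w).
Proof.
move=> mF mG; apply: measurable_mx => // i j.
under eq_fun do rewrite !mxE.
by apply: measurable_funB; exact: measurable_mx_coord.
Qed.

Lemma measurable_mxZ m n (k : T -> R) (F : T -> 'M[R]_(m, n)) :
  measurable_fun setT k ->
  measurable_fun setT F -> measurable_fun setT (fun w => k w *: F w).
Proof.
move=> mk mF; apply: measurable_mx => // i j.
under eq_fun do rewrite mxE.
by apply: measurable_funM => //; exact: measurable_mx_coord.
Qed.

Lemma measurable_mulmx m n q (F : T -> 'M[R]_(m, n)) (G : T -> 'M[R]_(n, q)) :
  measurable_fun setT F -> measurable_fun setT G ->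
  measurable_fun setT (fun w => F w *m G w).
Proof.
move=> mF mG; apply: measurable_mx => // i j.
under eq_fun do rewrite mxE.
apply: measurable_sum => k.
by apply: measurable_funM; exact: measurable_mx_coord.
Qed.

Lemma measurable_dotv d (F G : T -> 'cV[R]_d) :
  measurable_fun setT F -> measurable_fun setT G ->
  measurable_fun setT (fun w => dotv (F w) (G w)).
Proof.
move=> mF mG; apply: measurable_sum => k.
by apply: measurable_funM; exact: measurable_mx_coord.
Qed.

Lemma measurable_lrnorm d r (F : T -> 'cV[R]_d) :
  measurable_fun setT F -> measurable_fun setT (fun w => lrnorm r (F w)).
Proof.
move=> mF; case: r => [r| |] //=.
- apply: (measurableT_comp (measurable_powR _)).
  apply: measurable_sum => k.
  apply: (measurableT_comp (measurable_powR _)).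
  by apply: measurableT_comp => //; exact: measurable_mx_coord.
- move: (index_enum _) => s; elim: s => [|i s ih].
    under eq_fun do rewrite big_nil.
    exact: measurable_cst.
  under eq_fun do rewrite big_cons.
  apply: measurable_maxr => //.
  by apply: measurableT_comp => //; exact: measurable_mx_coord.
Qed.

End real_matrix_measurability.

(** * Duality of the l^r norms, and operator norms *)

Section lrnorm_theory.
Context {R : realType} {d : nat}.
Implicit Types (x y u v : 'cV[R]_d) (A : 'M[R]_d) (r : \bar R).

Lemma dotvC x y : dotv x y = dotv y x.
Proof. by apply: eq_bigr => i _; rewrite mulrC. Qed.

Lemma dotvDl x y u : dotv (x + y) u = dotv x u + dotv y u.
Proof.
by rewrite /dotv -big_split; apply: eq_bigr => i _; rewrite mxE mulrDl.
Qed.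

Lemma dotvZl (k : R) x u : dotv (k *: x) u = k * dotv x u.
Proof.
by rewrite /dotv mulr_sumr; apply: eq_bigr => i _; rewrite mxE mulrA.
Qed.

Lemma dotvNl x u : dotv (- x) u = - dotv x u.
Proof. by rewrite -scaleN1r dotvZl mulN1r. Qed.

Lemma dotvBl x y u : dotv (x - y) u = dotv x u - dotv y u.
Proof. by rewrite dotvDl dotvNl. Qed.

Lemma dotvDr x y u : dotv u (x + y) = dotv u x + dotv u y.
Proof. by rewrite dotvC dotvDl !(dotvC u). Qed.

Lemma dotvZr (k : R) x u : dotv u (k *: x) = k * dotv u x.
Proof. by rewrite dotvC dotvZl dotvC. Qed.

Lemma dotvNr x u : dotv u (- x) = - dotv u x.
Proof. by rewrite dotvC dotvNl dotvC. Qed.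

Lemma dotvBr x y u : dotv u (x - y) = dotv u x - dotv u y.
Proof. by rewrite dotvDr dotvNr. Qed.

Lemma dotv_ge0 x : 0 <= dotv x x.
Proof. by apply: sumr_ge0 => i _; rewrite -expr2 sqr_ge0. Qed.

Lemma lrnorm_ge0 r x : 0 <= lrnorm r x.
Proof.
case: r => [r| |] //=; first exact: powR_ge0.
by elim/big_ind : _ => // a b a0 b0; rewrite le_max a0.
Qed.

Lemma lrnormZ r (k : R) x : (1 <= r)%E -> lrnorm r (k *: x) = `|k| * lrnorm r x.
Proof.
case: r => [r| |] //= r1.
- rewrite lee_fin in r1.
  have r0 : r != 0 by rewrite gt_eqF// (lt_le_trans _ r1).
  under eq_bigr do rewrite mxE normrM powRM//.
  rewrite -mulr_sumr powRM ?powR_ge0//; last first.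
    by apply: sumr_ge0 => i _; exact: powR_ge0.
  by rewrite -powRrM mulfV// powRr1.
- under eq_bigr do rewrite mxE normrM.
  elim/big_rec2 : _ => [|i a b _ ->]; first by rewrite mulr0.
  by rewrite maxr_pMr.
Qed.

Lemma lrnorm_coord r x i : (1 <= r)%E -> `|x i 0| <= lrnorm r x.
Proof.
case: r => [r| |] //= r1; last by rewrite (bigD1 i)//= le_max lexx.
rewrite lee_fin in r1.
have r0 : 0 < r by rewrite (lt_le_trans _ r1).
rewrite -[leLHS](@powRr1 _)// -(@mulfV _ r) ?gt_eqF// powRrM.
apply: ge0_ler_powR; rewrite ?nnegrE ?invr_ge0 ?(ltW r0)// ?powR_ge0//.
  by apply: sumr_ge0 => j _; exact: powR_ge0.
by rewrite (bigD1 i)//= lerDl sumr_ge0// => j _; exact: powR_ge0.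
Qed.

Lemma lrnorm0 r : (1 <= r)%E -> lrnorm r (0 : 'cV[R]_d) = 0.
Proof. by move=> r1; rewrite -(scale0r 0) lrnormZ// normr0 mul0r. Qed.

Lemma lrnorm_eq0 r x : (1 <= r)%E -> lrnorm r x = 0 -> x = 0.
Proof.
move=> r1 x0; apply/matrixP => i j; rewrite ord1 mxE.
by apply/eqP; rewrite -normr_le0 -x0 lrnorm_coord.
Qed.

Lemma lrnormE (r : R) x :
  lrnorm r%:E x = (\sum_(i < d) `|x i 0| `^ r) `^ r^-1.
Proof. by []. Qed.

Lemma lrnormyE x : lrnorm +oo%E x = \big[Num.max/0]_(i < d) `|x i 0|.
Proof. by []. Qed.

Local Opaque lrnorm.

(** The vector is y_i = sg(x_i) |x_i|^(r-1). Young's inequality with the exponents r and q = r/(r-1)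
    bounds <v, y> by 1/r + 1/q = 1 when x and v have norm 1. *)
Lemma lrnorm_dual_aux (r : R) x : 1 < r -> lrnorm r%:E x = 1 ->
  exists2 y, dotv x y = 1 & forall v, lrnorm r%:E v = 1 -> dotv v y <= 1.
Proof.
move=> r1 x1.
have r0 : 0 < r by rewrite (lt_trans _ r1).
have s1 (z : 'cV[R]_d) : lrnorm r%:E z = 1 -> \sum_i `|z i 0| `^ r = 1.
  rewrite lrnormE => /(congr1 (fun t => t `^ r)); rewrite powR1 -powRrM mulVf ?gt_eqF//.
  by rewrite powRr1// sumr_ge0// => i _; exact: powR_ge0.
exists (\col_i (Num.sg (x i 0) * `|x i 0| `^ (r - 1))).
  rewrite -[RHS](s1 x x1); apply: eq_bigr => i _; rewrite mxE mulrA (mulrC (x i 0)) -normrEsg.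
  have [->|xi0] := eqVneq (x i 0) 0; first by rewrite normr0 mul0r powR0// gt_eqF.
  rewrite mulrC -[X in _ * X]powRr1// -powRD ?subrK//.
  by rewrite normr_eq0 xi0 implybT.
move=> v v1.
pose q := r / (r - 1).
have q0 : 0 < q by rewrite divr_gt0// subr_gt0.
have rq : r^-1 + q^-1 = 1.
  by rewrite /q; field; rewrite ?subr_eq0 !gt_eqF.
apply: (@le_trans _ _ (\sum_i (`|v i 0| `^ r / r + `|x i 0| `^ r / q))).
  apply: ler_sum => i _; rewrite mxE (le_trans (ler_norm _))//.
  rewrite normrM normrM normr_sg (ger0_norm (powR_ge0 _ _)).
  apply: (@le_trans _ _ (`|v i 0| * `|x i 0| `^ (r - 1))).
    by rewrite ler_wpM2l// ler_piMl ?powR_ge0// lern1 leq_b1.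
  have -> : `|x i 0| `^ r = (`|x i 0| `^ (r - 1)) `^ q.
    rewrite -powRrM /q; congr (_ `^ _); field; by rewrite subr_eq0 gt_eqF.
  by apply: conjugate_powR => //; rewrite powR_ge0.
by rewrite big_split/= -!mulr_suml !s1// !mul1r rq.
Qed.

(** Norming functional, the tool that reduces inequalities between norms to scalar ones: the
    triangle inequality here, later the norm of an integral or of a kernel average. It is a signed
    coordinate for r = oo, the vector of signs for r = 1, and comes from [lrnorm_dual_aux] by
    scaling otherwise. *)
Lemma lrnorm_dual r x : (1 <= r)%E ->
  exists2 y, dotv x y = lrnorm r x & forall v, dotv v y <= lrnorm r v.
Proof.
move=> r1.
have [x0|x0] := eqVneq (lrnorm r x) 0.
  exists 0; first by rewrite x0 -(scale0r 0) dotvZr mul0r.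
  by move=> v; rewrite -(scale0r 0) dotvZr mul0r lrnorm_ge0.
have {x0}xgt0 : 0 < lrnorm r x by rewrite lt_neqAle eq_sym x0 lrnorm_ge0.
case: r r1 xgt0 => [r| |] //; last first.
- move=> r1 xgt0.
  have [i xi] : exists i, lrnorm +oo%E x = `|x i 0|.
    have : exists2 i, True & \big[Num.max/0]_(i < d) `|x i 0| = `|x i 0|.
      move: xgt0; rewrite lrnormyE; move: (index_enum _) => s.
      elim: s => [|i s ih]; first by rewrite big_nil ltxx.
      rewrite big_cons; case: (ltP `|x i 0|) => [|_ _]; last by exists i.
      by move=> _ /ih.
    by move=> [i _ ?]; exists i.
  exists (\col_j (if j == i then Num.sg (x i 0) else 0)).
    rewrite xi /dotv (bigD1 i)//= big1 ?addr0 ?mxE ?eqxx.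
      by rewrite normrEsg mulrC.
    by move=> j /negPf ji; rewrite mxE ji mulr0.
  move=> v; rewrite /dotv (bigD1 i)//= big1 ?addr0 ?mxE ?eqxx; last first.
    by move=> j /negPf ji; rewrite mxE ji mulr0.
  rewrite (le_trans (ler_norm _))// normrM normr_sg.
  rewrite (@le_trans _ _ `|v i 0|)//; first by rewrite ler_piMr// lern1 leq_b1.
  exact: (@lrnorm_coord +oo%E).
rewrite lee_fin le_eqVlt => /predU1P[<-|r1] xgt0.
- have l1 (z : 'cV[R]_d) : lrnorm 1%:E z = \sum_i `|z i 0|.
    rewrite lrnormE invr1 powRr1; last by rewrite sumr_ge0// => i _; exact: powR_ge0.
    by apply: eq_bigr => i _; rewrite powRr1.
  exists (\col_i Num.sg (x i 0)).
    by rewrite l1; apply: eq_bigr => i _; rewrite mxE mulrC normrEsg.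
  move=> v; rewrite l1; apply: ler_sum => i _.
  rewrite mxE (le_trans (ler_norm _))// normrM normr_sg.
  by rewrite ler_piMr// lern1 leq_b1.
- set s := lrnorm _ x in xgt0 *.
  have r1' : (1 <= r%:E)%E by rewrite lee_fin ltW.
  have [|y xy vy] := @lrnorm_dual_aux r (s^-1 *: x) r1.
    by rewrite lrnormZ// ger0_norm ?invr_ge0 ?ltW// mulVf// gt_eqF.
  exists y.
    by move: xy => /(congr1 ( *%R s)); rewrite dotvZl mulrA mulfV ?gt_eqF// mul1r mulr1.
  move=> v; have [v0|v0] := eqVneq (lrnorm r%:E v) 0.
    by rewrite v0 (lrnorm_eq0 _ v0)// -(scale0r 0) dotvZl mul0r.
  have vgt0 : 0 < lrnorm r%:E v by rewrite lt_neqAle eq_sym v0 lrnorm_ge0.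
  have /vy : lrnorm r%:E ((lrnorm r%:E v)^-1 *: v) = 1.
    rewrite lrnormZ//; move: (lrnorm r%:E v) v0 vgt0 => k k0 kgt0.
    by rewrite ger0_norm ?invr_ge0 ?ltW// mulVf.
  rewrite dotvZl; move: (lrnorm r%:E v) (dotv v y) vgt0 => k l k0.
  by rewrite ler_pdivrMl// mulr1.
Qed.

Lemma ler_lrnormD r x y : (1 <= r)%E ->
  lrnorm r (x + y) <= lrnorm r x + lrnorm r y.
Proof.
by move=> r1; have [u <- h] := lrnorm_dual (x + y) r1; rewrite dotvDl lerD.
Qed.

Lemma lrnormN r x : (1 <= r)%E -> lrnorm r (- x) = lrnorm r x.
Proof. by move=> r1; rewrite -scaleN1r lrnormZ// normrN1 mul1r. Qed.

(** The norming vector y of x has entries at most 1 in absolute value: test it on sg(y_i) e_i, a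
    vector of norm at most 1. *)
Lemma lrnorm_le_sum r x : (1 <= r)%E -> lrnorm r x <= \sum_i `|x i 0|.
Proof.
move=> r1; have [y <- h] := lrnorm_dual x r1.
rewrite ler_sum// => i _; rewrite (le_trans (ler_norm _))// normrM ler_piMr//.
have e1 : lrnorm r (Num.sg (y i 0) *: delta_mx i 0 : 'cV[R]_d) <= 1.
  rewrite lrnormZ// normr_sg mulr_ile1// ?lern1 ?leq_b1 ?lrnorm_ge0//.
  have -> : (delta_mx i 0 : 'cV[R]_d) = \col_j (j == i)%:R.
    by apply/matrixP => a b; rewrite !mxE ord1 eqxx andbT.
  case: {h} r r1 => [r| |] // r1.
  - rewrite lee_fin in r1.
    rewrite lrnormE (bigD1 i)//= mxE eqxx normr1 powR1 big1 ?addr0 ?powR1//.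
    by move=> j /negPf ji; rewrite mxE ji normr0 powR0// gt_eqF// (lt_le_trans _ r1).
  - rewrite lrnormyE; elim/big_ind : _ => // [a b a1 b1|j _]; first by rewrite ge_max a1.
    by rewrite mxE ger0_norm// lern1 leq_b1.
apply: le_trans e1; apply: le_trans (h _).
rewrite dotvZl /dotv (bigD1 i)//= big1 ?addr0; last first.
  by move=> j /negPf ji; rewrite mxE ji mul0r.
by rewrite mxE !eqxx mul1r normrEsg.
Qed.

Lemma lrnorm2E x : lrnorm 2%:E x = Num.sqrt (dotv x x).
Proof.
rewrite lrnormE powR12_sqrt; last by rewrite sumr_ge0// => i _; exact: powR_ge0.
congr Num.sqrt; apply: eq_bigr => i _.
by rewrite powR_mulrn// real_normK ?num_real// expr2.
Qed.

Lemma cauchy_schwarz x y : `|dotv x y| <= lrnorm 2%:E x * lrnorm 2%:E y.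
Proof.
have h u v : dotv u v <= lrnorm 2%:E u * lrnorm 2%:E v.
  have [v0|v0] := eqVneq (lrnorm 2%:E v) 0.
    rewrite v0 mulr0 (@lrnorm_eq0 2%:E v) ?lee_fin ?ler1n//.
    by rewrite -(scale0r 0) dotvZr mul0r.
  have [u0|u0] := eqVneq (lrnorm 2%:E u) 0.
    rewrite u0 mul0r (@lrnorm_eq0 2%:E u) ?lee_fin ?ler1n//.
    by rewrite -(scale0r 0) dotvZl mul0r.
  have vgt0 : 0 < lrnorm 2%:E v by rewrite lt_neqAle eq_sym v0 lrnorm_ge0.
  have ugt0 : 0 < lrnorm 2%:E u by rewrite lt_neqAle eq_sym u0 lrnorm_ge0.
  (* This square expands to 2 |u| |v| (|u| |v| - <u, v>). *)
  have := dotv_ge0 (lrnorm 2%:E v *: u - lrnorm 2%:E u *: v).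
  rewrite !dotvBl !dotvBr !dotvZl !dotvZr (dotvC v u).
  have E (z : 'cV[R]_d) : dotv z z = lrnorm 2%:E z ^+ 2.
    by rewrite (lrnorm2E z) sqr_sqrtr// dotv_ge0.
  rewrite !E; move: (lrnorm 2%:E u) (lrnorm 2%:E v) (dotv u v) ugt0 vgt0.
  move=> a b c ugt0 vgt0 ge0; rewrite -subr_ge0.
  rewrite -(pmulr_rge0 _ (mulr_gt0 (mulr_gt0 (ltr0n _ 2) ugt0) vgt0)).
  by apply: le_trans ge0 _; rewrite le_eqVlt; apply/orP; left; apply/eqP; ring.
rewrite ler_norml h andbT lerNl -dotvNl; apply: le_trans (h _ _) _.
by rewrite lrnormN ?lee_fin ?ler1n.
Qed.

Lemma opnormP rho r A u : (1 <= rho)%E -> (1 <= r)%E ->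
  lrnorm r (A *m u) <= opnorm rho r A * lrnorm rho u.
Proof.
move=> rho1 r1.
(* Without a bound the supremum would be a default value; the sum of the |A i j| is one. *)
have ub : has_sup [set lrnorm r (A *m u) | u in [set u | lrnorm rho u <= 1]].
  split; first by exists (lrnorm r (A *m 0)); exists 0 => //=; rewrite lrnorm0.
  exists (\sum_i \sum_j `|A i j|) => _ [v /= v1 <-].
  rewrite (le_trans (lrnorm_le_sum _ r1))// ler_sum// => i _; rewrite mxE.
  rewrite (le_trans (ler_norm_sum _ _ _))// ler_sum// => j _.
  rewrite normrM ler_piMr// (le_trans _ v1)//; exact: lrnorm_coord.
have [u0|u0] := eqVneq (lrnorm rho u) 0.
  by rewrite u0 mulr0 (lrnorm_eq0 rho1 u0) mulmx0 lrnorm0.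
have ugt0 : 0 < lrnorm rho u by rewrite lt_neqAle eq_sym u0 lrnorm_ge0.
rewrite -ler_pdivrMr// mulrC.
rewrite -[(lrnorm rho u)^-1]ger0_norm ?invr_ge0 ?lrnorm_ge0//.
rewrite -lrnormZ// scalemxAr; apply: ub_le_sup; first by case: ub.
exists ((lrnorm rho u)^-1 *: u) => //=.
by rewrite lrnormZ// ger0_norm ?invr_ge0 ?lrnorm_ge0// mulVf.
Qed.

Lemma opnorm_ge0 rho r A : 0 <= opnorm rho r A.
Proof.
rewrite /opnorm; set B := [set _ | _ in _].
have [hB|hB] := pselect (has_sup B); last by rewrite sup_out.
have [[b Bb] ubB] := hB; have [u u1 E] := Bb.
by rewrite (le_trans (lrnorm_ge0 r (A *m u)))// ub_le_sup// E.
Qed.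

Lemma opnorm_le rho r A c : (1 <= rho)%E -> (1 <= r)%E ->
  (forall u, lrnorm r (A *m u) <= c * lrnorm rho u) -> 0 <= c ->
  opnorm rho r A <= c.
Proof.
move=> rho1 r1 h c0; apply: ge_sup.
  by exists (lrnorm r (A *m 0)); exists 0 => //=; rewrite lrnorm0.
by move=> _ [v /= v1 <-]; rewrite (le_trans (h v))// ler_piMr.
Qed.

End lrnorm_theory.

(** * Translations of the Gaussian law *)

(** Two image measures that agree on a pi-system generating the sigma-algebra coincide. Laws are
    compared in this form both for resampling a Gaussian coordinate and for independence. *)
Lemma ge0_integral_same_law {R : realType} {d1 d2 dY}
    {T1 : measurableType d1} {T2 : measurableType d2} {Y : measurableType dY}
    (m1 : {measure set T1 -> \bar R}) (m2 : {measure set T2 -> \bar R})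
    (f1 : T1 -> Y) (f2 : T2 -> Y) (G : set (set Y)) (g : Y -> \bar R) :
  (m1 setT < +oo)%E -> measurable_fun setT f1 -> measurable_fun setT f2 ->
  setI_closed G -> G setT -> measurable `<=` <<s G >> -> G `<=` measurable ->
  (forall A, G A -> m1 (f1 @^-1` A) = m2 (f2 @^-1` A)) ->
  measurable_fun setT g -> (forall y, 0 <= g y)%E ->
  (\int[m1]_x g (f1 x) = \int[m2]_x g (f2 x))%E.
Proof.
move=> m1oo mf1 mf2 GI GT Gm mG m12 mg g0.
pose F1 : {mfun T1 >-> Y} := HB.pack f1 (isMeasurableFun.Build _ _ _ _ f1 mf1).
pose F2 : {mfun T2 >-> Y} := HB.pack f2 (isMeasurableFun.Build _ _ _ _ f2 mf2).
have <- : (\int[pushforward m1 F1]_y g y = \int[m1]_x g (f1 x))%E.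
  by rewrite ge0_integral_pushforward.
have <- : (\int[pushforward m2 F2]_y g y = \int[m2]_x g (f2 x))%E.
  by rewrite ge0_integral_pushforward.
apply: eq_measure_integral => A mA _.
apply: (@g_sigma_algebra_measure_unique _ _ _ G mG (fun=> setT)) => //.
- by rewrite bigcup_const.
- exact: Gm.
Qed.

Import HBNNSimple.

(** The hypothesis is the case of indicators; simple functions follow by linearity and the general
    case by monotone convergence. *)
Lemma ge0_integral_density {R : realType} {dT} {T : measurableType dT}
    (mu nu : {measure set T -> \bar R}) (p : T -> R) (f : T -> \bar R) :
  measurable_fun setT p -> (forall x, 0 <= p x) ->
  (forall A, measurable A -> nu A = \int[mu]_(x in A) (p x)%:E)%E ->
  measurable_fun setT f -> (forall x, 0 <= f x)%E ->
  (\int[nu]_x f x = \int[mu]_x (f x * (p x)%:E))%E.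
Proof.
move=> mp p0 nuE mf f0.
have mpE : measurable_fun setT (EFin \o p) by exact/measurable_EFinP.
pose f_ := nnsfun_approx measurableT mf.
have cvgf x : EFin \o (f_ ^~ x) @ \oo --> f x.
  by apply: cvg_nnsfun_approx => // y _; exact: f0.
have nd x m n : (m <= n)%N -> ((f_ m x)%:E <= (f_ n x)%:E)%E.
  by move=> mn; rewrite lee_fin; exact/lefP/nd_nnsfun_approx.
transitivity (limn (fun n => \int[nu]_x (f_ n x)%:E)%E).
  rewrite -monotone_convergence//.
  - by apply: eq_integral => x _; apply/esym/cvg_lim => //; exact: cvgf.
  - by move=> n; exact/measurable_EFinP.
  - by move=> n x _; rewrite lee_fin.
  - by move=> x _ m n; exact: nd.
transitivity (limn (fun n => \int[mu]_x ((f_ n x)%:E * (p x)%:E))%E); last first.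
  rewrite -monotone_convergence//.
  - apply: eq_integral => x _; apply/cvg_lim => //.
    by apply: cvgeZr => //; exact: cvgf.
  - by move=> n; apply: emeasurable_funM => //; exact/measurable_EFinP.
  - by move=> n x _; rewrite mule_ge0// lee_fin.
  - by move=> x _ m n mn; rewrite lee_wpmul2r ?lee_fin//; exact: nd.
congr (limn _); apply/funext => n.
have E x : (f_ n x)%:E = \sum_(k \in range (f_ n))
    (k * \1_(f_ n @^-1` [set k]) x)%:E :> \bar R.
  by rewrite fsumEFin// -fimfunE.
under eq_integral do rewrite E.
rewrite ge0_integral_fsum//; last 2 first.
  - by move=> y; exact/measurable_EFinP/measurable_funM.
  - by move=> y x _; rewrite nnfun_muleindic_ge0.
under [RHS]eq_integral => x _.
  rewrite E ge0_mule_fsuml; last by move=> y; rewrite nnfun_muleindic_ge0.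
  over.
rewrite ge0_integral_fsum//; last 2 first.
  - move=> y; apply: emeasurable_funM => //.
    exact/measurable_EFinP/measurable_funM.
  - move=> y x _; rewrite mule_ge0 ?lee_fin//.
    exact: nnfun_muleindic_ge0.
apply: eq_fsbigr => k kr.
have k0 : 0 <= k by move: kr; rewrite inE => -[x _ <-].
under eq_integral do rewrite EFinM.
under [RHS]eq_integral do rewrite EFinM -muleA.
rewrite !ge0_integralZl//; last first.
- exact/measurable_EFinP.
- by move=> x _; rewrite mule_ge0 ?lee_fin.
- by apply: emeasurable_funM => //; exact/measurable_EFinP.
congr (_ * _)%E.
rewrite integral_indic// setIT nuE// [LHS]integral_mkcond.
apply: eq_integral => x _; rewrite patchE indicE.
by case: ifPn; rewrite ?mul1e ?mul0e.
Qed.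

(** * The standard normal law on the line *)

Section normal.
Context {R : realType}.
Local Notation mu := (@lebesgue_measure R).
Local Notation N := (normal_prob (0 : R) 1).
Implicit Type f : R -> \bar R.

(** The Lebesgue measure is determined by its values on half-open intervals, and translations
    preserve their lengths. *)
Lemma ge0_integral_lebesgue_shift f (s : R) :
  measurable_fun setT f -> (forall x, 0 <= f x)%E ->
  (\int[mu]_x f (x + s)%R = \int[mu]_x f x)%E.
Proof.
move=> mf f0.
have ms : measurable_fun [set: measurableTypeR R]
    (fun x : measurableTypeR R => x + s : measurableTypeR R).
  exact: measurable_funD.
pose S : {mfun _ >-> _} := HB.pack (fun x : measurableTypeR R => x + s : measurableTypeR R)
  (isMeasurableFun.Build _ _ _ _ _ ms).
have <- : (\int[pushforward mu S]_y f y = \int[mu]_x f (x + s)%R)%E.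
  by rewrite ge0_integral_pushforward.
apply: eq_measure_integral => A mA _.
apply/esym/lebesgue_measure_unique => //= _ [[a b]] _ <-.
rewrite /pushforward.
have -> : S @^-1` `]a, b]%classic = `](a - s), (b - s)]%classic.
  by apply/seteqP; split => x /=; rewrite !in_itv/= ltrBlDr lerBrDr.
by rewrite !lebesgue_measure_itv/= !lte_fin ltrD2r; case: ifP => // _; rewrite -!EFinB;
  congr EFin; ring.
Qed.

Lemma ge0_integral_normal f :
  measurable_fun setT f -> (forall x, 0 <= f x)%E ->
  (\int[N]_x f x = \int[mu]_x (f x * (normal_pdf 0 1 x)%:E))%E.
Proof.
move=> mf f0; apply: (ge0_integral_density (mu := mu) (nu := N)) => //.
- exact: measurable_normal_pdf.
- by move=> x; exact: normal_pdf_ge0.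
Qed.

(* [expR (x ^+ 2 / 2)] times the standard Gaussian is a multiple of the
   Lebesgue measure, hence translation invariant. *)
Lemma ge0_integral_normal_shift f s :
  measurable_fun setT f -> (forall x, 0 <= f x)%E ->
  (\int[N]_x (f (x + s)%R * (expR (x ^+ 2 / 2))%:E) =
   \int[N]_x (f x * (expR (x ^+ 2 / 2))%:E))%E.
Proof.
move=> mf f0.
have me : measurable_fun setT (fun x : R => (expR (x ^+ 2 / 2))%:E).
  apply/measurable_EFinP; apply: measurableT_comp => //.
  by apply: measurable_funM => //; exact: measurable_funX.
have H g : measurable_fun setT g -> (forall x, 0 <= g x)%E ->
  (\int[N]_x (g x * (expR (x ^+ 2 / 2))%:E) =
   \int[mu]_x g x * (normal_peak (1 : R))%:E)%E.
  move=> mg g0; rewrite ge0_integral_normal; last 2 first.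
  - exact: emeasurable_funM.
  - by move=> x; rewrite mule_ge0// lee_fin expR_ge0.
  rewrite -ge0_integralZr//; last by rewrite lee_fin normal_peak_ge0.
  apply: eq_integral => x _; rewrite -muleA -EFinM; congr (_ * _%:E)%E.
  rewrite normal_pdfE ?oner_eq0// mulrCA /normal_fun -expRD.
  rewrite subr0 expr1n mulrC -[RHS]mul1r; congr (_ * _).
  by rewrite mulNr addrN expR0.
rewrite !H//; first by rewrite ge0_integral_lebesgue_shift.
by apply: (measurableT_comp mf); exact: measurable_funD.
Qed.

End normal.

Definition update_coord {R : realType} {d} (i : 'I_d) (x : R) (v : 'cV[R]_d) : 'cV[R]_d :=
  \col_j (if j == i then x else v j 0).

(** * The standard Gaussian vector under translations *)

Section gaussian_vector.
Context {dT} {T : measurableType dT} {R : realType} (P : probability T R).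
Context {d : nat} (Z : {RV P >-> 'cV[R]_d}).
Hypothesis hZ : standard_gaussian P Z.
Local Notation N := (normal_prob (0 : R) 1).

(** The pi-system on which [standard_gaussian] prescribes the law. *)
Definition rectangles : set (set 'cV[R]_d) :=
  [set A | exists2 B : 'I_d -> set R, (forall i, measurable (B i)) &
    A = [set v : 'cV[R]_d | forall i, B i (v i 0)]].

Lemma rectangles_measurable : rectangles `<=` measurable.
Proof.
move=> _ [B mB ->].
have -> : [set v : 'cV[R]_d | forall i, B i (v i 0)] =
    \bigcap_(i in [set: 'I_d]) ((fun v : 'cV[R]_d => v i 0) @^-1` B i).
  by apply/seteqP; split => [v h i _|v h i]; exact: h.
apply: fin_bigcap_measurable => //.
by move=> i _; rewrite -[X in measurable X]setTI; exact: measurable_coord.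
Qed.

Lemma rectangles_setI : setI_closed rectangles.
Proof.
move=> _ _ [A mA ->] [B mB ->]; exists (fun i => A i `&` B i).
  by move=> i; exact: measurableI.
apply/seteqP; split => [v [h k] i|v h]; first by split; [exact: h|exact: k].
by split=> i; have [] := h i.
Qed.

Lemma rectangles_setT : rectangles setT.
Proof. by exists (fun=> setT) => //; apply/seteqP; split. Qed.

Lemma rectangles_generate : measurable `<=` <<s rectangles >>.
Proof.
apply: smallest_sub; first exact: smallest_sigma_algebra.
move=> _ [[i j] _ [B mB <-]]; rewrite setTI.
apply: sub_sigma_algebra; exists (fun k => if k == i then B else setT).
  by move=> k; case: ifP.
rewrite {j}(ord1 j); apply/seteqP; split => [v Bv k|v /(_ i)]/=.
  by case: eqP => // ->.
by rewrite eqxx.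
Qed.

Lemma measurable_update_coord i : measurable_fun setT
  (fun q : T * R => update_coord i q.2 (Z q.1)).
Proof.
apply: measurable_mx => // k j; under eq_fun do rewrite mxE.
case: (k == i); first exact: measurable_snd.
have mZ : measurable_fun setT (fun q : T * R => Z q.1) by exact: measurableT_comp.
exact: (measurable_mx_coord k 0 mZ).
Qed.

(** The coordinates of [Z] are independent and standard normal, so resampling one of them leaves the
    values of the law on rectangles unchanged. One coordinate is thereby isolated, and the
    translation formula on the line applies to it. *)
Lemma ge0_integral_update_coord i (f : 'cV[R]_d -> \bar R) :
  measurable_fun setT f -> (forall x, 0 <= f x)%E ->
  (\int[P]_w f (Z w) = \int[P]_w \int[N]_x f (update_coord i x (Z w)))%E.
Proof.
move=> mf f0.
have mu := measurable_update_coord i.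
rewrite -[RHS](fubini_tonelli1 (m1 := P) (m2 := N)
  (fun q : T * R => f (update_coord i q.2 (Z q.1))))//; last first.
  exact: measurableT_comp.
apply: (@ge0_integral_same_law _ _ _ _ _ _ _ P (P \x N)%E Z
  (fun q : T * R => update_coord i q.2 (Z q.1)) rectangles) => //.
- by apply: le_lt_trans (probability_le1 P measurableT) _; rewrite ltry.
- exact: rectangles_setI.
- exact: rectangles_setT.
- exact: rectangles_generate.
- exact: rectangles_measurable.
move=> _ [B mB ->].
(* The constraint on coordinate [i] bears on the new variable alone and the others, collected in
   [C], on [Z]: the event is a product. *)
pose C k := if k == i then setT else B k.
have mC k : measurable (C k) by rewrite /C; case: ifP.
rewrite [X in _ = (_ \x _)%E X](_ : _ =
    [set w | forall k, C k (Z w k 0)] `*` B i); last first.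
  apply/seteqP; split => [[w x] /= h|[w x] /= [h1 h2] k].
    split=> [k|]; last by have := h i; rewrite mxE eqxx.
    by rewrite /C; case: ifPn => // /negPf ki; have := h k; rewrite mxE ki.
  rewrite mxE; case: ifPn => [/eqP -> //|/negPf ki].
  by have := h1 k; rewrite /C ki.
have mCZ : measurable [set w | forall k, C k (Z w k 0)].
  have mr : measurable [set v : 'cV[R]_d | forall k, C k (v k 0)].
    by apply: rectangles_measurable; exists C.
  by rewrite -[X in measurable X]setTI; exact: (measurable_funPT Z measurableT _ mr).
rewrite product_measure1E//; last exact: mB.
rewrite [X in (X * _)%E](_ : _ = \prod_(k < d) N (C k))%E; last exact: hZ.
rewrite [LHS](_ : _ = \prod_(k < d) N (B k))%E; last exact: hZ.
rewrite (bigD1 i)//= muleC; congr (_ * _)%E.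
rewrite [RHS](bigD1 i)//= {1}/C eqxx probability_setT mul1e.
by apply: eq_bigr => k /negPf ki; rewrite /C ki.
Qed.

Definition gker_inv (v : 'cV[R]_d) : R := expR (dotv v v / 2).

Lemma measurable_gker_inv : measurable_fun setT gker_inv.
Proof.
apply: measurableT_comp => //; apply: measurable_funM => //.
exact: measurable_dotv.
Qed.

Lemma gker_inv_gt0 v : 0 < gker_inv v. Proof. exact: expR_gt0. Qed.

(** The weight [gker_inv] factorizes over the coordinates. Once coordinate [i] is resampled, it is
    exp(x^2/2) times a constant of the inner integral, and [ge0_integral_normal_shift] applies. *)
Lemma ge0_integral_gauss_shift1 i s (f : 'cV[R]_d -> \bar R) :
  measurable_fun setT f -> (forall x, 0 <= f x)%E ->
  (\int[P]_w (f (Z w + s *: delta_mx i 0)%R * (gker_inv (Z w))%:E) =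
   \int[P]_w (f (Z w) * (gker_inv (Z w))%:E))%E.
Proof.
move=> mf f0.
have mg : measurable_fun setT (fun v => (gker_inv v)%:E).
  by apply/measurable_EFinP; exact: measurable_gker_inv.
have mfs : measurable_fun setT (fun v : 'cV[R]_d => f (v + s *: delta_mx i 0)).
  by apply: (measurableT_comp mf); apply: measurable_mxD.
rewrite (ge0_integral_update_coord i
  (f := fun v => (f (v + s *: delta_mx i 0)%R * (gker_inv v)%:E)%E)); last 2 first.
- exact: emeasurable_funM.
- by move=> v; rewrite mule_ge0// lee_fin ltW// gker_inv_gt0.
rewrite (ge0_integral_update_coord i (f := fun v => (f v * (gker_inv v)%:E)%E)); last 2 first.
- exact: emeasurable_funM.
- by move=> v; rewrite mule_ge0// lee_fin ltW// gker_inv_gt0.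
apply: eq_integral => w _.
pose c := (expR (\sum_(j < d | j != i) Z w j 0 * Z w j 0 / 2))%:E.
have gE x : (gker_inv (update_coord i x (Z w)))%:E = ((expR (x ^+ 2 / 2))%:E * c)%E.
  rewrite -EFinM -expRD /gker_inv /dotv mulr_suml (bigD1 i)//= mxE eqxx expr2.
  by congr (expR (_ + _))%:E; apply: eq_bigr => j /negPf ji; rewrite mxE ji.
have uE x : update_coord i x (Z w) + s *: delta_mx i 0 =
    update_coord i (x + s) (Z w).
  apply/matrixP => j k; rewrite !mxE (ord1 k) eqxx andbT.
  by case: eqP => _; rewrite ?mulr1 ?mulr0 ?addr0.
under eq_integral do rewrite uE gE muleA.
under [RHS]eq_integral do rewrite gE muleA.
have mu : measurable_fun setT (fun x => f (update_coord i x (Z w))).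
  apply: (measurableT_comp mf).
  apply: measurable_mx => // k j; under eq_fun do rewrite mxE.
  by case: (k == i); [exact: measurable_id|exact: measurable_cst].
have mus : measurable_fun setT (fun x : R => f (update_coord i (x + s) (Z w))).
  by apply: (measurableT_comp mu); exact: measurable_funD.
have me : measurable_fun setT (fun x : R => (expR (x ^+ 2 / 2))%:E).
  apply/measurable_EFinP; apply: measurableT_comp => //.
  by apply: measurable_funM => //; exact: measurable_funX.
rewrite !ge0_integralZr//; last first.
- by rewrite lee_fin expR_ge0.
- by move=> x _; rewrite mule_ge0// lee_fin expR_ge0.
- exact: emeasurable_funM.
- by rewrite lee_fin expR_ge0.
- by move=> x _; rewrite mule_ge0// lee_fin expR_ge0.
- exact: emeasurable_funM.
by rewrite (ge0_integral_normal_shift s (f := fun x => f (update_coord i x (Z w)))).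
Qed.

(* [gker_inv] times the law of [Z] is a multiple of the Lebesgue measure. *)
Lemma ge0_integral_gauss_shift (h : 'cV[R]_d) (f : 'cV[R]_d -> \bar R) :
  measurable_fun setT f -> (forall x, 0 <= f x)%E ->
  (\int[P]_w (f (Z w + h)%R * (gker_inv (Z w))%:E) =
   \int[P]_w (f (Z w) * (gker_inv (Z w))%:E))%E.
Proof.
have -> : h = \sum_i h i 0 *: delta_mx i 0.
  apply/matrixP => j k; rewrite (ord1 k) summxE (bigD1 j)//= big1 => [|l lj].
    by rewrite !mxE !eqxx mulr1 addr0.
  by rewrite !mxE eq_sym (negPf lj) mulr0.
elim: (index_enum _) f => [|i s ih] f mf f0.
  by rewrite big_nil; under eq_integral do rewrite addr0.
under eq_integral do rewrite big_cons (addrC (h i 0 *: _)) addrA.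
apply: (etrans (ih (fun v => f (v + h i 0 *: delta_mx i 0)) _ _)) => //.
  by apply: (measurableT_comp mf); apply: measurable_mxD.
exact: ge0_integral_gauss_shift1.
Qed.

End gaussian_vector.

(** * Conditional expectations given [Z + h(V)] *)

(** On rectangles, independence says that the law of (Z, V) is the product of the marginal laws;
    Tonelli's theorem does the rest. The outer variable [w'] carries the independent copy of [V],
    frozen in the inner integral. *)
Lemma ge0_integral_indep {dT} {T : measurableType dT} {R : realType}
    (P : probability T R) {d1 d2} {T1 : measurableType d1}
    {T2 : measurableType d2} (Z : T -> T1) (V : T -> T2)
    (f : T1 * T2 -> \bar R) :
  measurable_fun setT Z -> measurable_fun setT V -> independent_RV P Z V ->
  measurable_fun setT f -> (forall x, 0 <= f x)%E ->
  (\int[P]_w f (Z w, V w) = \int[P]_w' \int[P]_w f (Z w, V w'))%E.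
Proof.
move=> mZ mV ind mf f0.
have mZV : measurable_fun setT (fun q : T * T => (Z q.1, V q.2)).
  by apply: measurable_fun_pair; exact: measurableT_comp.
rewrite -[RHS](fubini_tonelli2 (m1 := P) (m2 := P)
  (fun q : T * T => f (Z q.1, V q.2)))//; last exact: (measurableT_comp mf).
apply: (@ge0_integral_same_law _ _ _ _ _ _ _ P (P \x P)%E
  (fun w => (Z w, V w)) (fun q : T * T => (Z q.1, V q.2))
  [set A1 `*` A2 | A1 in measurable & A2 in measurable]) => //.
- by apply: le_lt_trans (probability_le1 P measurableT) _; rewrite ltry.
- exact: measurable_fun_pair.
- move=> _ _ [A mA [B mB <-]] [C mC [D mD <-]].
  by rewrite -setXI; exists (A `&` C); [exact: measurableI|exists (B `&` D) => //;
    exact: measurableI].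
- by exists setT => //; exists setT => //; rewrite setXTT.
- by rewrite -measurable_prod_measurableType.
- by move=> _ [A mA [B mB <-]]; exact: measurableX.
move=> _ [A mA [B mB <-]].
rewrite [X in _ = (_ \x _)%E X](_ : _ = (Z @^-1` A) `*` (V @^-1` B))//.
rewrite product_measure1E//; last 2 first.
- by rewrite -[X in measurable X]setTI; exact: mZ.
- by rewrite -[X in measurable X]setTI; exact: mV.
exact: ind.
Qed.

Section cond_exp_theory.
Context {dT} {T : measurableType dT} {R : realType} (P : probability T R).
Context {d'} {T' : measurableType d'} (W : T -> T') (mW : measurable_fun setT W).

Lemma sub_sigma_preimage A : g_sigma_algebra_preimage W A -> measurable A.
Proof. by move=> [B mB <-]; exact: mW. Qed.

(** The event {A < B} belongs to the sigma-algebra of [W], hence B - A has integral 0 over it while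
    being positive there. *)
Lemma is_cond_exp_ae_eq (F : T -> R) (E1 E2 : T -> R) :
  is_cond_exp P F W E1 -> is_cond_exp P F W E2 -> {ae P, forall w, E1 w = E2 w}.
Proof.
have half (A B : T -> R) : is_cond_exp P F W A -> is_cond_exp P F W B ->
    P [set w | A w < B w] = 0%E.
  move=> [mA iA hA] [mB iB hB].
  set D := [set w | A w < B w].
  have sD : g_sigma_algebra_preimage W D.
    have -> : D = (setT : set (g_sigma_algebra_preimageType W)) `&`
        [set w | A w < B w] by rewrite setTI.
    by have := measurable_fun_ltr mA mB measurableT (Y := [set true]) I; rewrite /preimage.
  have mD := sub_sigma_preimage sD.
  have iAD : P.-integrable D (EFin \o A) by apply: integrableS iA.
  have iBD : P.-integrable D (EFin \o B) by apply: integrableS iB.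
  have : (\int[P]_(w in D) ((B w)%:E - (A w)%:E) = 0)%E.
    rewrite integralB_EFin// hA// hB// subee// -hA//.
    exact: integrable_fin_num.
  have mBA : measurable_fun D (fun w => (B w)%:E - (A w)%:E)%E.
    by apply: emeasurable_funB; [exact: measurable_int iBD|exact: measurable_int iAD].
  move=> h0.
  have : (\int[P]_(w in D) `|(B w)%:E - (A w)%:E| = 0)%E.
    rewrite -[RHS]h0; apply: eq_integral => w; rewrite inE => Dw.
    by rewrite gee0_abs// -EFinB lee_fin subr_ge0 ltW.
  move=> /(ae_eq_integral_abs P mD mBA) [N [mN N0 DN]].
  apply/eqP; rewrite eq_le measure_ge0 andbT -N0; apply: le_measure; rewrite ?inE//.
  move=> w Dw; apply: DN => /= /(_ Dw) /eqP; rewrite -EFinB eqe subr_eq0 => /eqP E.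
  by move: Dw; rewrite /D /= E ltxx.
move=> h1 h2.
have n1 := half _ _ h1 h2; have n2 := half _ _ h2 h1.
have mE1 : measurable_fun setT E1.
  by have [_ /measurable_int /measurable_EFinP] := h1.
have mE2 : measurable_fun setT E2.
  by have [_ /measurable_int /measurable_EFinP] := h2.
have m1 : measurable [set w | E1 w < E2 w].
  by rewrite -[X in measurable X]setTI;
    exact: (measurable_fun_ltr mE1 mE2 measurableT (Y := [set true]) I).
have m2 : measurable [set w | E2 w < E1 w].
  by rewrite -[X in measurable X]setTI;
    exact: (measurable_fun_ltr mE2 mE1 measurableT (Y := [set true]) I).
exists ([set w | E1 w < E2 w] `|` [set w | E2 w < E1 w]); split.
- exact: measurableU.
- by rewrite measureU0.
- by move=> w /= /eqP; rewrite neq_lt => /orP.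
Qed.

(** As some version exists, the choice made by [xget] is itself a version, and not the default 0. *)
Lemma cond_exp_ae_eq (F E : T -> R) : is_cond_exp P F W E ->
  {ae P, forall w, cond_exp P F W w = E w}.
Proof.
move=> h; apply: (@is_cond_exp_ae_eq F) => //.
rewrite /cond_exp; apply: (@xgetPex _ (cst 0) [set E | is_cond_exp P F W E]).
by exists E.
Qed.

End cond_exp_theory.

(** * Bayes' kernel for a Gaussian vector shifted by an independent one *)

Section kernel.
Context {dT} {T : measurableType dT} {R : realType} (P : probability T R).
Context {d : nat} (Z : {RV P >-> 'cV[R]_d}).
Hypothesis hZ : standard_gaussian P Z.
Context {dS} {S : measurableType dS} (V : T -> S).
Hypothesis mV : measurable_fun setT V.
Hypothesis indep : independent_RV P Z V.

(** The Gaussian density without its normalizing constant, which cancels in the ratio [kwt]. *)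
Definition gker (v : 'cV[R]_d) : R := expR (- (dotv v v / 2)).

Lemma gker_gt0 v : 0 < gker v. Proof. exact: expR_gt0. Qed.

Lemma gker_le1 v : gker v <= 1.
Proof.
by rewrite /gker -[leRHS]expR0 ler_expR oppr_le0 mulr_ge0 ?invr_ge0// dotv_ge0.
Qed.

Lemma gker_invK v : gker v * gker_inv v = 1.
Proof. by rewrite /gker /gker_inv -expRD addNr expR0. Qed.

Lemma measurable_gker : measurable_fun setT gker.
Proof.
apply: measurableT_comp => //; apply: measurableT_comp => //.
by apply: measurable_funM => //; exact: measurable_dotv.
Qed.

Implicit Types (h : S -> 'cV[R]_d) (g : 'cV[R]_d).

(* Bayes' formula: conditionally on [Z + h(V) = g], the law of [V] has density
   [kwt h g] with respect to its unconditional law, and [Z = g - h(V)]. Hence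
   [kexp h F] at [Z + h(V)] is a version of [E[F(V, Z) | Z + h(V)]]. *)
Definition kden h g : R := fine (\int[P]_w' (gker (g - h (V w')))%:E).

Definition kwt h g w' : R := gker (g - h (V w')) / kden h g.

(** Extended-valued form for nonnegative functions, to which Tonelli's theorem applies directly;
    evaluated at |F|, it decides whether F is integrable under the kernel. *)
Definition kexpe h (f : S * 'cV[R]_d -> \bar R) g : \bar R :=
  (\int[P]_w' (f (V w', g - h (V w'))%R * (kwt h g w')%:E))%E.

Definition kexp h (F : S * 'cV[R]_d -> R) g : R :=
  (\int[P]_w' (F (V w', g - h (V w')) * kwt h g w'))%R.

Lemma measurable_arg h g : measurable_fun setT h ->
  measurable_fun setT (fun w' => g - h (V w')).
Proof. by move=> mh; apply: measurable_mxB => //; exact: measurableT_comp. Qed.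

Lemma measurable_kgker h g : measurable_fun setT h ->
  measurable_fun setT (fun w' => gker (g - h (V w'))).
Proof.
by move=> mh; apply: (measurableT_comp measurable_gker); exact: measurable_arg.
Qed.

Lemma kdenE h g : measurable_fun setT h ->
  ((kden h g)%:E = \int[P]_w' (gker (g - h (V w')))%:E)%E.
Proof.
move=> mh; rewrite /kden fineK// ge0_fin_numE; last first.
  by apply: integral_ge0 => w _; rewrite lee_fin ltW// gker_gt0.
apply: (@le_lt_trans _ _ (\int[P]_w' 1)%E).
  apply: ge0_le_integral => //.
  - by move=> w _; rewrite lee_fin ltW// gker_gt0.
  - by apply/measurable_EFinP; exact: measurable_kgker.
  - by move=> w _; rewrite lee_fin gker_le1.
rewrite integral_cst// mul1e.
by apply: le_lt_trans (probability_le1 P measurableT) _; rewrite ltry.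
Qed.

(** A nonnegative function of integral 0 vanishes almost everywhere, whereas [gker] is positive
    everywhere. *)
Lemma kden_gt0 h g : measurable_fun setT h -> 0 < kden h g.
Proof.
move=> mh; rewrite -lte_fin kdenE// lt0e integral_ge0 ?andbT; last first.
  by move=> w _; rewrite lee_fin ltW// gker_gt0.
apply/eqP => i0.
have : (\int[P]_w' `|(gker (g - h (V w')))%:E| = 0)%E.
  rewrite -[RHS]i0; apply: eq_integral => w _.
  by rewrite gee0_abs// lee_fin ltW// gker_gt0.
have mk : measurable_fun setT (fun w' => (gker (g - h (V w')))%:E).
  by apply/measurable_EFinP; exact: measurable_kgker.
move=> /(ae_eq_integral_abs P measurableT mk) [N [mN N0 DN]].
have : P setT = 0%E.
  apply/eqP; rewrite -measure_le0 -N0; apply: le_measure; rewrite ?inE//.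
  by move=> w _; apply: DN => /= /(_ I) /eqP; rewrite eqe gt_eqF// gker_gt0.
by move=> PT0; have := @probability_setT _ _ _ P; rewrite PT0 => /esym/eqP; rewrite onee_eq0.
Qed.

Lemma kwt_gt0 h g w : measurable_fun setT h -> 0 < kwt h g w.
Proof. by move=> mh; rewrite divr_gt0// ?gker_gt0// kden_gt0. Qed.

Lemma measurable_kwt h g : measurable_fun setT h -> measurable_fun setT (kwt h g).
Proof. by move=> mh; apply: measurable_funM => //; exact: measurable_kgker. Qed.

Lemma integral_kwt h g : measurable_fun setT h ->
  (\int[P]_w' (kwt h g w')%:E = 1)%E.
Proof.
move=> mh; under eq_integral do rewrite EFinM.
rewrite ge0_integralZr//; last 3 first.
- by apply/measurable_EFinP; exact: measurable_kgker.
- by move=> w _; rewrite lee_fin ltW// gker_gt0.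
- by rewrite lee_fin invr_ge0 ltW// kden_gt0.
by rewrite -kdenE// -EFinM mulfV// gt_eqF// kden_gt0.
Qed.

Section measurability.
Context {dO} {O : measurableType dO}.

(** The parameter [o] will be the time t or the pair of t and of a sample point. Joint measurability
    in it is what Tonelli's theorem over t requires later. *)
Lemma measurable_kden (h : O -> S -> 'cV[R]_d) (g : O -> 'cV[R]_d) :
  measurable_fun setT (fun q : O * S => h q.1 q.2) -> measurable_fun setT g ->
  measurable_fun setT (fun o => kden (h o) (g o)).
Proof.
move=> mh mg.
have mq : measurable_fun setT (fun q : O * T => (gker (g q.1 - h q.1 (V q.2)))%:E).
  apply/measurable_EFinP; apply: (measurableT_comp measurable_gker).
  apply: measurable_mxB; first exact: measurableT_comp.
  apply: (measurableT_comp mh (g := fun q : O * T => (q.1, V q.2))).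
  by apply: measurable_fun_pair => //; exact: measurableT_comp.
apply: (measurableT_comp (fine_measurable measurableT)).
apply: (measurable_fun_fubini_tonelli_F (m2 := P) _ mq).
by move=> q; rewrite lee_fin ltW// gker_gt0.
Qed.

Lemma measurable_kwt_joint (h : O -> S -> 'cV[R]_d) (g : O -> 'cV[R]_d) :
  measurable_fun setT (fun q : O * S => h q.1 q.2) -> measurable_fun setT g ->
  measurable_fun setT (fun q : O * T => kwt (h q.1) (g q.1) q.2).
Proof.
move=> mh mg; apply: measurable_funM.
  apply: (measurableT_comp measurable_gker).
  apply: measurable_mxB; first exact: measurableT_comp.
  apply: (measurableT_comp mh (g := fun q : O * T => (q.1, V q.2))).
  by apply: measurable_fun_pair => //; exact: measurableT_comp.
have -> : (fun q : O * T => (kden (h q.1) (g q.1))^-1) =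
    (fun o => (kden (h o) (g o))^-1) \o fst by [].
apply: measurableT_comp => //.
(* As the denominator is positive, its inverse is a power, and powers are measurable. *)
have -> : (fun o => (kden (h o) (g o))^-1) = (fun o => kden (h o) (g o) `^ (- 1)).
  apply/funext => o; rewrite powR_inv1// ltW// kden_gt0//.
  by apply: (measurableT_comp mh (g := fun s => (o, s))); exact: measurable_pair1.
by apply: (measurableT_comp (measurable_powR (-1))); exact: measurable_kden.
Qed.

Lemma measurable_karg (h : O -> S -> 'cV[R]_d) (g : O -> 'cV[R]_d) :
  measurable_fun setT (fun q : O * S => h q.1 q.2) -> measurable_fun setT g ->
  measurable_fun setT (fun q : O * T => (V q.2, g q.1 - h q.1 (V q.2))).
Proof.
move=> mh mg; apply: measurable_fun_pair; first exact: measurableT_comp.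
apply: measurable_mxB; first exact: measurableT_comp.
apply: (measurableT_comp mh (g := fun q : O * T => (q.1, V q.2))).
by apply: measurable_fun_pair => //; exact: measurableT_comp.
Qed.

Lemma measurable_kexpe (h : O -> S -> 'cV[R]_d) (g : O -> 'cV[R]_d) f :
  measurable_fun setT (fun q : O * S => h q.1 q.2) -> measurable_fun setT g ->
  measurable_fun setT f -> (forall x, 0 <= f x)%E ->
  measurable_fun setT (fun o => kexpe (h o) f (g o)).
Proof.
move=> mh mg mf f0.
apply: (measurable_fun_fubini_tonelli_F (m2 := P)
  (fun q : O * T => f (V q.2, (g q.1 - h q.1 (V q.2))%R) * (kwt (h q.1) (g q.1) q.2)%:E)%E).
  apply: emeasurable_funM.
    by apply: (measurableT_comp mf); exact: measurable_karg.
  by apply/measurable_EFinP; exact: measurable_kwt_joint.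
move=> q; rewrite mule_ge0// lee_fin ltW// kwt_gt0//.
by apply: (measurableT_comp mh (g := fun s => (q.1, s))); exact: measurable_pair1.
Qed.

End measurability.

Lemma measurable_kexpe1 h f : measurable_fun setT h -> measurable_fun setT f ->
  (forall x, 0 <= f x)%E -> measurable_fun setT (kexpe h f).
Proof.
move=> mh mf f0; apply: (measurable_kexpe (h := fun=> h) (g := id)) => //.
by apply: (measurableT_comp mh).
Qed.

Lemma kexpe_ge0 h f g : measurable_fun setT h -> (forall x, 0 <= f x)%E ->
  (0 <= kexpe h f g)%E.
Proof.
move=> mh f0; apply: integral_ge0 => w _.
by rewrite mule_ge0// lee_fin ltW// kwt_gt0.
Qed.

Lemma kexpe_le h f1 f2 g : measurable_fun setT h ->
  measurable_fun setT f1 -> measurable_fun setT f2 -> (forall x, 0 <= f1 x)%E ->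
  (forall x, f1 x <= f2 x)%E -> (kexpe h f1 g <= kexpe h f2 g)%E.
Proof.
move=> mh mf1 mf2 f10 f12.
have mk f : measurable_fun setT f ->
    measurable_fun setT (fun w' => f (V w', g - h (V w'))%R * (kwt h g w')%:E)%E.
  move=> mf; apply: emeasurable_funM; last first.
    by apply/measurable_EFinP; exact: measurable_kwt.
  apply: (measurableT_comp mf (g := fun w' => (V w', g - h (V w')))).
  by apply: measurable_fun_pair => //; exact: measurable_arg.
apply: ge0_le_integral => //; [|exact: mk|exact: mk|].
  by move=> w _; rewrite mule_ge0// lee_fin ltW// kwt_gt0.
by move=> w _; rewrite lee_wpmul2r// lee_fin ltW// kwt_gt0.
Qed.

(** The heart of Bayes' formula. With [V] frozen at a copy V', insert [gker (Z) * gker_inv (Z) = 1]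
    and translate [Z] by -h(V') by means of [ge0_integral_gauss_shift]. Then phi bears on [Z] alone,
    and the average over V' is the numerator of the kernel, that is [kexpe] times [kden]. *)
Lemma ge0_integral_shift_density h f (phi : 'cV[R]_d -> \bar R) :
  measurable_fun setT h -> measurable_fun setT f -> (forall x, 0 <= f x)%E ->
  measurable_fun setT phi -> (forall x, 0 <= phi x)%E ->
  (\int[P]_w (phi (Z w + h (V w))%R * f (V w, Z w)) =
   \int[P]_w (phi (Z w) * kexpe h f (Z w) * (kden h (Z w) * gker_inv (Z w))%:E))%E.
Proof.
move=> mh mf f0 mphi phi0.
pose u (q : 'cV[R]_d * S) := (phi (q.1 + h q.2)%R * f (q.2, q.1))%E.
have mu : measurable_fun setT u.
  apply: emeasurable_funM.
    apply: (measurableT_comp mphi); apply: measurable_mxD; first exact: measurable_fst.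
    exact: measurableT_comp.
  by apply: (measurableT_comp mf (g := fun q : 'cV[R]_d * S => (q.2, q.1))); exact: measurable_swap.
have u0 q : (0 <= u q)%E by rewrite mule_ge0.
rewrite (ge0_integral_indep (f := u))//.
pose v (w' w : T) := (phi (Z w) * (f (V w', Z w - h (V w'))%R *
   (gker (Z w - h (V w')))%:E) * (gker_inv (Z w))%:E)%E.
have step w' : (\int[P]_w u (Z w, V w') = \int[P]_w v w' w)%E.
  pose F x := (phi x * (f (V w', x - h (V w'))%R * (gker (x - h (V w')))%:E))%E.
  have mF : measurable_fun setT F.
    apply: emeasurable_funM => //; apply: emeasurable_funM.
        apply: (measurableT_comp mf (g := fun x : 'cV[R]_d => (V w', x - h (V w')))).
      by apply: measurable_fun_pair => //; exact: measurable_mxB.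
    apply/measurable_EFinP; apply: (measurableT_comp measurable_gker).
    exact: measurable_mxB.
  rewrite -[RHS](ge0_integral_gauss_shift hZ (h (V w')) (f := F))//; last first.
    by move=> x; rewrite !mule_ge0// lee_fin ltW// gker_gt0.
  apply: eq_integral => w _; rewrite /u /F /= addrK -!muleA -EFinM gker_invK.
  by rewrite mule1.
under eq_integral do rewrite step.
have mv : measurable_fun setT (fun q : T * T => v q.1 q.2).
  apply: emeasurable_funM; last first.
    apply/measurable_EFinP; apply: (measurableT_comp measurable_gker_inv).
    exact: measurableT_comp.
  apply: emeasurable_funM; first by apply: (measurableT_comp mphi); exact: measurableT_comp.
  have marg : measurable_fun setT (fun q : T * T => Z q.2 - h (V q.1)).
    apply: measurable_mxB; first exact: measurableT_comp.
    by apply: (measurableT_comp mh); exact: measurableT_comp.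
  apply: emeasurable_funM.
    apply: (measurableT_comp mf (g := fun q : T * T => (V q.1, Z q.2 - h (V q.1)))).
    by apply: measurable_fun_pair => //; exact: measurableT_comp.
  by apply/measurable_EFinP; apply: (measurableT_comp measurable_gker).
rewrite (fubini_tonelli (m1 := P) (m2 := P) (fun q : T * T => v q.1 q.2))//; last first.
  move=> q; apply: mule_ge0; last by rewrite lee_fin ltW// gker_inv_gt0.
  by apply: mule_ge0 => //; apply: mule_ge0 => //; rewrite lee_fin ltW// gker_gt0.
apply: eq_integral => w _.
have mfw : measurable_fun setT (fun w' => f (V w', Z w - h (V w'))).
  apply: (measurableT_comp mf (g := fun w' => (V w', Z w - h (V w')))).
  by apply: measurable_fun_pair => //; exact: measurable_arg.
have mgw : measurable_fun setT (fun w' => (gker (Z w - h (V w')))%:E).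
  by apply/measurable_EFinP; exact: measurable_kgker.
rewrite /v /= ge0_integralZr//; last 3 first.
- by apply: emeasurable_funM => //; exact: emeasurable_funM.
- by move=> w' _; rewrite !mule_ge0// lee_fin ltW// gker_gt0.
- by rewrite lee_fin ltW// gker_inv_gt0.
rewrite ge0_integralZl//; last 2 first.
- exact: emeasurable_funM.
- by move=> w' _; rewrite !mule_ge0// lee_fin ltW// gker_gt0.
rewrite EFinM muleA; congr (_ * _)%E; rewrite -muleA; congr (_ * _)%E.
rewrite /kexpe -ge0_integralZr//; last 3 first.
- by apply: emeasurable_funM => //; apply/measurable_EFinP; exact: measurable_kwt.
- by move=> w' _; rewrite mule_ge0// lee_fin ltW// kwt_gt0.
- by rewrite lee_fin ltW// kden_gt0.
apply: eq_integral => w' _; rewrite -muleA -EFinM /kwt divfK//.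
by rewrite gt_eqF// kden_gt0.
Qed.

(** [ge0_integral_shift_density] is used twice: for f with the test function phi, and for the
    constant 1 with the test function phi times [kexpe h f]. The right-hand sides agree since the
    kernel has total mass 1. *)
Lemma ge0_integral_kexpe h f (phi : 'cV[R]_d -> \bar R) :
  measurable_fun setT h -> measurable_fun setT f -> (forall x, 0 <= f x)%E ->
  measurable_fun setT phi -> (forall x, 0 <= phi x)%E ->
  (\int[P]_w (phi (Z w + h (V w))%R * kexpe h f (Z w + h (V w))%R) =
   \int[P]_w (phi (Z w + h (V w))%R * f (V w, Z w)))%E.
Proof.
move=> mh mf f0 mphi phi0.
rewrite [RHS](ge0_integral_shift_density mh mf f0 mphi phi0).
have := @ge0_integral_shift_density h (cst 1%E) (fun x => phi x * kexpe h f x)%E mh.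
under eq_integral do rewrite mule1.
move=> ->//; last 2 first.
- by apply: emeasurable_funM => //; exact: measurable_kexpe1.
- by move=> x; rewrite mule_ge0// kexpe_ge0.
apply: eq_integral => w _; congr (_ * _)%E.
rewrite -[RHS]mule1; congr (_ * _)%E.
by rewrite /kexpe; under eq_integral do rewrite mul1e; exact: integral_kwt.
Qed.

Definition kpath h w : 'cV[R]_d := Z w + h (V w).

Lemma measurable_kpath h : measurable_fun setT h -> measurable_fun setT (kpath h).
Proof. by move=> mh; apply: measurable_mxD => //; exact: measurableT_comp. Qed.

Lemma measurable_VZ : measurable_fun setT (fun w => (V w, Z w)).
Proof. exact: measurable_fun_pair. Qed.

Lemma ge0_integral_kexpeT h f :
  measurable_fun setT h -> measurable_fun setT f -> (forall x, 0 <= f x)%E ->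
  (\int[P]_w kexpe h f (kpath h w) = \int[P]_w f (V w, Z w))%E.
Proof.
move=> mh mf f0.
have := ge0_integral_kexpe mh mf f0 (phi := cst 1%E) (@measurable_cst _ _ _ _ _ _) (fun _ => lee01).
by under eq_integral do rewrite mul1e; under [in RHS]eq_integral do rewrite mul1e.
Qed.

(** With the indicator of [B] as test function, this is the defining identity of a conditional
    expectation for nonnegative functions. *)
Lemma ge0_integral_kexpe_preimage h f B :
  measurable_fun setT h -> measurable_fun setT f -> (forall x, 0 <= f x)%E ->
  measurable B ->
  (\int[P]_(w in kpath h @^-1` B) kexpe h f (kpath h w) =
   \int[P]_(w in kpath h @^-1` B) f (V w, Z w))%E.
Proof.
move=> mh mf f0 mB.
have mphi : measurable_fun setT (fun x : 'cV[R]_d => (\1_B x : R)%:E).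
  by apply/measurable_EFinP; exact: measurable_indic.
have := ge0_integral_kexpe mh mf f0 mphi => /(_ (fun x => _)) H.
have {}H := H (fun x => ltac:(by rewrite lee_fin)).
rewrite integral_mkcond [RHS]integral_mkcond.
have E (u : T -> \bar R) w : (u \_ (kpath h @^-1` B)) w = ((\1_B (kpath h w) : R)%:E * u w)%E.
  rewrite patchE indicE.
  have -> : (w \in kpath h @^-1` B) = (kpath h w \in B).
    by apply/idP/idP; rewrite !inE.
  by case: ifP => _; rewrite ?mul1e ?mul0e.
under eq_integral do rewrite E.
by under [RHS]eq_integral do rewrite E.
Qed.

Section real_valued.
Variables (h : S -> 'cV[R]_d) (F : S * 'cV[R]_d -> R).
Hypotheses (mh : measurable_fun setT h) (mF : measurable_fun setT F).

Let aF q := (`|F q|)%:E.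
Let maF : measurable_fun setT aF.
Proof. by apply/measurable_EFinP; exact: measurableT_comp. Qed.
Let aF0 q : (0 <= aF q)%E. Proof. by rewrite lee_fin. Qed.

Lemma measurable_kintegrand g :
  measurable_fun setT (fun w' => F (V w', g - h (V w')) * kwt h g w').
Proof.
apply: measurable_funM; last exact: measurable_kwt.
apply: (measurableT_comp mF (g := fun w' => (V w', g - h (V w')))).
by apply: measurable_fun_pair => //; exact: measurable_arg.
Qed.

Lemma kexpe_abs g : kexpe h aF g =
  (\int[P]_w' `|(F (V w', g - h (V w')) * kwt h g w')%:E|)%E.
Proof.
apply: eq_integral => w _; rewrite abse_EFin normrM EFinM; congr (_ * _%:E)%E.
by rewrite ger0_norm// ltW// kwt_gt0.
Qed.

Hypothesis iF : P.-integrable setT (fun w => (F (V w, Z w))%:E).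

Lemma integrable_kexpe_abs :
  P.-integrable setT (fun w => kexpe h aF (kpath h w)).
Proof.
apply/integrableP; split.
  apply: (measurableT_comp (measurable_kexpe1 mh maF aF0)).
  exact: measurable_kpath.
under eq_integral do rewrite gee0_abs ?kexpe_ge0//.
rewrite ge0_integral_kexpeT//.
by have /integrableP[_] := iF; under eq_integral do rewrite abse_EFin.
Qed.

(** The kernel average of |F| has mean E|F(V, Z)|, so it is finite almost surely. *)
Lemma ae_kintegrable : {ae P, forall w, P.-integrable setT
  (fun w' => (F (V w', kpath h w - h (V w')) * kwt h (kpath h w) w')%:E)}.
Proof.
have := integrable_ae measurableT integrable_kexpe_abs.
apply: filterS => w /(_ I) fin.
apply/integrableP; split; first by apply/measurable_EFinP; exact: measurable_kintegrand.
by rewrite -kexpe_abs -ge0_fin_numE// kexpe_ge0.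
Qed.

Let Fp := (EFin \o F)^\+%E.
Let Fn := (EFin \o F)^\-%E.
Let mFE : measurable_fun setT (EFin \o F). Proof. exact/measurable_EFinP. Qed.
Let mFp : measurable_fun setT Fp. Proof. exact: measurable_funepos. Qed.
Let mFn : measurable_fun setT Fn. Proof. exact: measurable_funeneg. Qed.
Let Fp0 q : (0 <= Fp q)%E. Proof. exact: funepos_ge0. Qed.
Let Fn0 q : (0 <= Fn q)%E. Proof. exact: funeneg_ge0. Qed.

(** An integral is by definition the difference of those of the positive and negative parts, which
    transfers the results on [kexpe] to signed functions at every point [g]. *)
Lemma kexpE g : kexp h F g = fine (kexpe h Fp g - kexpe h Fn g).
Proof.
rewrite /kexp /Rintegral integralE; congr (fine (_ - _)); apply: eq_integral => w _.
  rewrite /Fp !funeposE/= EFinM muleC [RHS]muleC maxe_pMr ?mule0// lee_fin.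
  by rewrite ltW// kwt_gt0.
rewrite /Fn !funenegE/= [RHS]muleC maxe_pMr ?lee_fin ?ltW ?kwt_gt0// mule0.
by rewrite -EFinM mulrN mulrC.
Qed.

Lemma measurable_kexp : measurable_fun setT (kexp h F).
Proof.
have -> : kexp h F = fun g => fine (kexpe h Fp g - kexpe h Fn g).
  by apply/funext => g; exact: kexpE.
apply: (measurableT_comp (fine_measurable measurableT)).
by apply: emeasurable_funB; exact: measurable_kexpe1.
Qed.

Lemma kexp_le g : (`|kexp h F g|%:E <= kexpe h aF g)%E.
Proof.
rewrite kexpe_abs; apply: le_trans (le_abse_integral _ _ _) => //; last first.
  by apply/measurable_EFinP; exact: measurable_kintegrand.
(* For an infinite integral [fine] is 0, and the bound persists. *)
rewrite /kexp /Rintegral; case: integral => [x| |] /=; rewrite ?abse_EFin ?normr0 ?leey//.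
Qed.

Lemma is_cond_exp_kexp :
  is_cond_exp P (fun w => F (V w, Z w)) (kpath h) (fun w => kexp h F (kpath h w)).
Proof.
have mG := measurable_kpath mh.
have mkG : measurable_fun setT (fun w => kexp h F (kpath h w)).
  exact: (measurableT_comp measurable_kexp).
have ikG : P.-integrable setT (EFin \o (fun w => kexp h F (kpath h w))).
  apply: (le_integrable measurableT _ _ integrable_kexpe_abs).
    exact/measurable_EFinP.
  by move=> w _; rewrite (gee0_abs (kexpe_ge0 _ _ _))//; exact: kexp_le.
split => //.
  move=> _ B mB; exists (kexp h F @^-1` B) => //.
  by rewrite -[X in measurable X]setTI; exact: measurable_kexp.
move=> _ [B mB <-]; rewrite setTI.
have mA : measurable (kpath h @^-1` B).
  by rewrite -[X in measurable X]setTI; exact: mG.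
have ikp : P.-integrable setT (fun w => kexpe h Fp (kpath h w)).
  apply: (le_integrable measurableT _ _ integrable_kexpe_abs).
    exact: (measurableT_comp (measurable_kexpe1 mh mFp Fp0)).
  move=> w _; rewrite !gee0_abs ?kexpe_ge0//; apply: kexpe_le => // q.
  by rewrite /Fp funeposE ge_max !lee_fin ler_norm normr_ge0.
have ikn : P.-integrable setT (fun w => kexpe h Fn (kpath h w)).
  apply: (le_integrable measurableT _ _ integrable_kexpe_abs).
    exact: (measurableT_comp (measurable_kexpe1 mh mFn Fn0)).
  move=> w _; rewrite !gee0_abs ?kexpe_ge0//; apply: kexpe_le => // q.
  by rewrite /Fn funenegE ge_max !lee_fin -normrN ler_norm normr_ge0.
(* The two parts have finite kernel averages only almost surely, hence an almost everywhere equality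
   in order to remove [fine]. *)
transitivity (\int[P]_(w in kpath h @^-1` B) (kexpe h Fp (kpath h w) - kexpe h Fn (kpath h w)))%E.
  apply: ae_eq_integral => //.
  - by apply: measurable_funTS; exact/measurable_EFinP.
  - apply: measurable_funTS; apply: emeasurable_funB.
      exact: (measurableT_comp (measurable_kexpe1 mh mFp Fp0)).
    exact: (measurableT_comp (measurable_kexpe1 mh mFn Fn0)).
  have := integrable_ae measurableT ikp; have := integrable_ae measurableT ikn.
  apply: filterS2 => w /(_ I) hn /(_ I) hp _.
  by rewrite kexpE fineK// fin_numB hp.
rewrite integralB//; [|exact: integrableS ikp|exact: integrableS ikn].
rewrite !ge0_integral_kexpe_preimage//.
rewrite [RHS]integralE; congr (_ - _)%E; apply: eq_integral => w _.
  by rewrite /Fp !funeposE.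
by rewrite /Fn !funenegE.
Qed.

Lemma cond_exp_kexp : {ae P, forall w,
  cond_exp P (fun w => F (V w, Z w)) (kpath h) w = kexp h F (kpath h w)}.
Proof.
by apply: cond_exp_ae_eq; [exact: measurable_kpath|exact: is_cond_exp_kexp].
Qed.

End real_valued.

End kernel.

Local Open Scope ereal_scope.

(** * Norms on a probability space *)

Lemma lee_poweR {R : realType} (x y : \bar R) (r : R) : (0 <= r)%R -> 0 <= x ->
  x <= y -> x `^ r <= y `^ r.
Proof.
move=> r0 x0 xy; apply: gt0_ler_poweR => //; rewrite in_itv/= leey andbT//.
exact: le_trans xy.
Qed.

(** The integral of a nonnegative function is a supremum over the simple functions below it, which
    is monotone as such. This serves for integrands whose measurability in t is unknown, as they
    contain norms of chosen versions. *)
Lemma ge0_le_integral_nonmeasurable {dT} {T : measurableType dT} {R : realType}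
    (mu : {measure set T -> \bar R}) (D : set T) (f g : T -> \bar R) :
  (forall x, D x -> 0 <= f x) -> (forall x, D x -> f x <= g x) ->
  \int[mu]_(x in D) f x <= \int[mu]_(x in D) g x.
Proof.
move=> f0 fg; rewrite !ge0_integralE//; last first.
  by move=> x Dx; apply: le_trans (fg _ Dx); exact: f0.
apply: le_ereal_sup => _ [h hf <-]; exists h => // x.
apply: le_trans (hf x) _; rewrite !patchE; case: ifPn => //.
by rewrite inE => /fg.
Qed.

Section Lnorm_probability.
Context {dT} {T : measurableType dT} {R : realType} (P : probability T R).
Local Notation "'N_ p [ f ]" := (Lnorm P p (EFin \o f)).
Implicit Types (f g : T -> R) (p q a b : \bar R).

Lemma probability_setT_gt0 : 0 < P setT.
Proof. by rewrite probability_setT lte01. Qed.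

Lemma LnormE f (q : R) : 'N_q%:E[f] = (\int[P]_w (`|f w| `^ q)%:E) `^ q^-1.
Proof.
by rewrite unlock; congr (_ `^ _); apply: eq_integral => w _.
Qed.

Lemma LnormyE f : 'N_+oo[f] = ess_sup P (fun w => `|f w|%:E).
Proof. by rewrite unlock probability_setT_gt0. Qed.

Lemma Lnormy_leP f p : 'N_+oo[f] <= p <-> {ae P, forall w, `|f w|%:E <= p}.
Proof. by rewrite LnormyE; split => /ess_supP. Qed.

Lemma measurable_abs_powR f (q : R) : measurable_fun setT f ->
  measurable_fun setT (fun w => (`|f w| `^ q)%:E).
Proof.
move=> mf; apply/measurable_EFinP; apply: (measurableT_comp (measurable_powR _)).
exact: measurableT_comp.
Qed.

Lemma Lnorm_le_ae p f g : 1 <= p -> measurable_fun setT f ->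
  measurable_fun setT g -> {ae P, forall w, `|f w| <= `|g w|}%R ->
  'N_p[f] <= 'N_p[g].
Proof.
case: p => [q| |] // q1 mf mg fg; last first.
  rewrite !LnormyE; apply: le_ess_sup; apply: filterS fg => w.
  by rewrite lee_fin.
rewrite !LnormE; rewrite lee_fin in q1.
have q0 : (0 < q)%R by rewrite (lt_le_trans _ q1).
apply: lee_poweR; first by rewrite invr_ge0 ltW.
  by apply: integral_ge0 => w _; rewrite lee_fin powR_ge0.
apply: ae_ge0_le_integral => //.
- exact: measurable_abs_powR.
- exact: measurable_abs_powR.
apply: filterS fg => w fgw _; rewrite lee_fin ge0_ler_powR ?nnegrE//.
exact: ltW.
Qed.

Lemma Lnorm_eq_ae p f g : 1 <= p -> measurable_fun setT f ->
  measurable_fun setT g -> {ae P, forall w, f w = g w} -> 'N_p[f] = 'N_p[g].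
Proof.
move=> p1 mf mg fg; apply/eqP; rewrite eq_le !Lnorm_le_ae//;
  by apply: filterS fg => w ->.
Qed.

Lemma Lnorm_cst1_le p : 1 <= p -> 'N_p[cst 1%R] <= 1.
Proof.
case: p => [q| |] // q1.
  rewrite LnormE /=; under eq_integral do rewrite normr1 powR1.
  by rewrite integral_cst// mul1e [X in X `^ _](@probability_setT _ _ _ P) poweR1r.
by apply/Lnormy_leP/nearW => w; rewrite normr1.
Qed.

Lemma inve_fin (q : R) : (1 <= q)%R -> (q%:E)^-1 = (q^-1)%:E.
Proof. by move=> q1; rewrite inver gt_eqF// (lt_le_trans _ q1). Qed.

Lemma inve_finE q : 1 <= q -> exists2 x : R, (0 <= x <= 1)%R & q^-1 = x%:E.
Proof.
case: q => [q| |] // q1; last by exists 0%R; rewrite ?lexx ?ler01 ?invey.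
rewrite lee_fin in q1; have q0 : (0 < q)%R by rewrite (lt_le_trans _ q1).
by exists (q^-1)%R; rewrite ?inve_fin// invr_ge0 invf_le1// q1 ltW.
Qed.

Lemma Lnorm_scale p (c : R) f : 1 <= p -> measurable_fun setT f ->
  'N_p[(fun w => c * f w)%R] = `|c|%:E * 'N_p[f].
Proof.
case: p => [q| |] // q1 mf; last first.
  rewrite !LnormyE -(ess_supZl _ _ (normr_ge0 c)); last exact: probability_setT_gt0.
  by congr (ess_sup _ _); apply/funext => w /=; rewrite normrM.
rewrite lee_fin in q1; have q0 : (0 < q)%R by rewrite (lt_le_trans _ q1).
rewrite !LnormE /=; under eq_integral do rewrite normrM powRM// EFinM.
rewrite ge0_integralZl//; last exact: measurable_abs_powR.
rewrite poweRM ?lee_fin ?powR_ge0//; last first.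
  by apply: integral_ge0 => w _; rewrite lee_fin powR_ge0.
by rewrite poweR_EFin -powRrM mulfV ?gt_eqF// powRr1.
Qed.

Lemma Lnorm_eq0_ae p f : 1 <= p -> measurable_fun setT f ->
  'N_p[f] = 0 -> {ae P, forall w, f w = 0%R}.
Proof.
move=> p1 mf /(Lnorm_eq0_eq0 _) h.
have {}h : EFin \o f = \0 %[ae P].
  by apply: h; [exact/measurable_EFinP|exact: lt_le_trans p1].
by apply: filterS h => w /(_ I) [].
Qed.

Lemma Lnorm_ae0 p f : 1 <= p -> measurable_fun setT f ->
  {ae P, forall w, f w = 0%R} -> 'N_p[f] = 0.
Proof.
move=> p1 mf f0; rewrite (@Lnorm_eq_ae p f (cst 0%R))//.
by apply: Lnorm0; rewrite gt_eqF// (lt_le_trans _ p1).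
Qed.

Lemma Lnorm_hoelder_y p f g : 1 <= p ->
  measurable_fun setT f -> measurable_fun setT g ->
  'N_p[f \* g]%R <= 'N_+oo[f] * 'N_p[g].
Proof.
move=> p1 mf mg.
have mfg : measurable_fun setT (f \* g)%R by exact: measurable_funM.
(* A null [g] is treated apart: the right side is then 0 even if the norm of [f] is infinite. *)
have [g0|g0] := eqVneq ('N_p[g]) 0.
  rewrite g0 mule0 Lnorm_ae0//.
  by apply: filterS (Lnorm_eq0_ae p1 mg g0) => w /= ->; rewrite mulr0.
have gpos : 0 < 'N_p[g] by rewrite lt0e g0 Lnorm_ge0.
have := Lnorm_ge0 P +oo (EFin \o f).
case E : ('N_+oo[f]) => [m| |] // m0; last by rewrite gt0_mulye// leey.
rewrite lee_fin in m0.
rewrite -[X in X%:E * _](ger0_norm m0) -Lnorm_scale//.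
apply: Lnorm_le_ae => //; first exact: measurable_funM.
have /Lnormy_leP : 'N_+oo[f] <= m%:E by rewrite E.
apply: filterS => w; rewrite lee_fin => fm.
by rewrite /= !normrM ler_wpM2r// (ger0_norm m0).
Qed.

(** For finite exponents, this is the inequality for conjugate exponents applied to |f|^q and |g|^q
    with a/q and b/q, where p = q. If one of a and b is infinite, the other one equals p. *)
Lemma Lnorm_hoelder p a b f g : 1 <= p -> 1 <= a -> 1 <= b ->
  p^-1 = a^-1 + b^-1 -> measurable_fun setT f -> measurable_fun setT g ->
  'N_p[f \* g]%R <= 'N_a[f] * 'N_b[g].
Proof.
move=> p1 a1 b1 pab mf mg.
have [aoo|aoo] := eqVneq a +oo.
  have -> : b = p.
    by move: pab; rewrite aoo invey add0e => /(congr1 inve); rewrite !inveK.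
  by rewrite aoo; exact: Lnorm_hoelder_y.
have [boo|boo] := eqVneq b +oo.
  have -> : a = p.
    by move: pab; rewrite boo invey adde0 => /(congr1 inve); rewrite !inveK.
  have -> : (f \* g = g \* f)%R by apply/funext => w /=; rewrite mulrC.
  by rewrite boo muleC; exact: Lnorm_hoelder_y.
case: a a1 aoo pab => [a| |] // a1 _; case: b b1 boo => [b| |] // b1 _.
rewrite lee_fin in a1; rewrite lee_fin in b1; rewrite !inve_fin// => pab.
have a0 : (0 < a)%R by rewrite (lt_le_trans _ a1).
have b0 : (0 < b)%R by rewrite (lt_le_trans _ b1).
case: p p1 pab => [q| |] // q1; last first.
  by rewrite invey => -[] /eqP; rewrite eq_sym gt_eqF// addr_gt0 ?invr_gt0.
rewrite lee_fin in q1; rewrite inve_fin// => -[qab].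
have q0 : (0 < q)%R by rewrite (lt_le_trans _ q1).
have H := @hoelder _ _ _ P (fun w => `|f w| `^ q)%R (fun w => `|g w| `^ q)%R (a / q) (b / q).
have {}H := H _ _ (divr_gt0 a0 q0) (divr_gt0 b0 q0) _.
have mfq : measurable_fun setT (fun w => `|f w| `^ q)%R.
  exact/measurable_EFinP/measurable_abs_powR.
have mgq : measurable_fun setT (fun w => `|g w| `^ q)%R.
  exact/measurable_EFinP/measurable_abs_powR.
have e1 : ((a / q)^-1 + (b / q)^-1 = 1)%R.
  by rewrite !invf_div -mulrDr -qab mulfV// gt_eqF.
have {H} := H mfq mgq e1.
have N1 : 'N_1[(fun w => `|f w| `^ q)%R \* (fun w => `|g w| `^ q)%R]%R =
    \int[P]_w (`|(f \* g)%R w| `^ q)%:E.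
  rewrite Lnorm1; apply: eq_integral => w _ /=.
  by rewrite ger0_norm ?mulr_ge0 ?powR_ge0// normrM powRM.
have NE k c : (0 < c)%R -> 'N_(c / q)%:E[(fun w => `|k w| `^ q)%R] =
    (\int[P]_w (`|k w| `^ c)%:E) `^ (q / c).
  move=> c0; rewrite LnormE /= invf_div; congr (_ `^ _).
  apply: eq_integral => w _; rewrite ger0_norm ?powR_ge0// -powRrM.
  by rewrite mulrCA mulfV ?mulr1// gt_eqF.
rewrite N1 !NE// => H.
rewrite !LnormE.
apply: le_trans (lee_poweR _ _ H) _; first by rewrite invr_ge0 ltW.
  by apply: integral_ge0 => w _; rewrite lee_fin powR_ge0.
rewrite poweRM ?poweR_ge0// -!poweRrM.
have e c : (q / c / q = c^-1)%R by rewrite mulrAC mulfV ?mul1r// gt_eqF.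
by rewrite !e.
Qed.

(** The exponent s with 1/s = 1/a + 1/b is at least 1 because 1/s <= 1/p <= 1. It reduces three
    factors to two, and it is also needed when two of the factors stand under the same kernel
    average. *)
Lemma hoelder_split p a b c : 1 <= p -> 1 <= a -> 1 <= b -> 1 <= c ->
  p^-1 = a^-1 + b^-1 + c^-1 ->
  exists s, [/\ 1 <= s, s^-1 = a^-1 + b^-1 & p^-1 = s^-1 + c^-1].
Proof.
move=> p1 a1 b1 c1 pabc.
have i0 (x : \bar R) : 1 <= x -> 0 <= inve x.
  by move=> x1; rewrite inve_ge0 (le_trans _ x1).
exists (inve (inve a + inve b)); rewrite !inveK; split => //.
rewrite inve_ge1 ?adde_ge0 ?i0//.
apply: (@le_trans _ _ (inve p)); first by rewrite pabc leeDl ?i0.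
by have [x /andP[_ x1] ->] := inve_finE p1; rewrite lee_fin.
Qed.

(** Hoelder's inequality against the constant 1, with the exponent [q] conjugate to [p], possibly
    infinite. *)
Lemma Lnorm_lty_integrable p f : 1 <= p -> measurable_fun setT f ->
  'N_p[f] < +oo -> P.-integrable setT (EFin \o f).
Proof.
move=> p1 mf foo.
have [x x01 px] := inve_finE p1.
pose q := inve (1 - x)%:E.
have q1 : 1 <= q.
  rewrite inve_ge1 ?lee_fin ?subr_ge0; first by rewrite gerBl; case/andP: x01.
  by case/andP: x01.
have pq : inve (1 : \bar R) = inve p + inve q.
  by rewrite inveK px -EFinD addrC subrK inve1.
apply/integrableP; split; first exact/measurable_EFinP.
rewrite -Lnorm1.
have -> : 'N_1[f] = 'N_1[f \* cst 1]%R.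
  by apply: eq_Lnorm => w /=; rewrite mulr1.
apply: le_lt_trans (Lnorm_hoelder _ p1 q1 pq mf _) _ => //.
apply: le_lt_trans (lee_wpmul2l _ (Lnorm_cst1_le q1)) _; first exact: Lnorm_ge0.
by rewrite mule1.
Qed.

Lemma Lnorm_ge_mon p f : 1 <= p -> measurable_fun setT f -> 'N_1[f] <= 'N_p[f].
Proof.
move=> p1 mf.
have [x x01 px] := inve_finE p1.
pose q := inve (1 - x)%:E.
have q1 : 1 <= q.
  rewrite inve_ge1 ?lee_fin ?subr_ge0; first by rewrite gerBl; case/andP: x01.
  by case/andP: x01.
have pq : inve (1 : \bar R) = inve p + inve q.
  by rewrite inveK px -EFinD addrC subrK inve1.
have -> : 'N_1[f] = 'N_1[f \* cst 1]%R.
  by apply: eq_Lnorm => w /=; rewrite mulr1.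
apply: le_trans (Lnorm_hoelder _ p1 q1 pq mf _) _ => //.
apply: le_trans (lee_wpmul2l _ (Lnorm_cst1_le q1)) _; first exact: Lnorm_ge0.
by rewrite mule1.
Qed.

End Lnorm_probability.

(** * Minkowski's integral inequality *)

Section minkowski_integral.
Context {dT} {T : measurableType dT} {R : realType} (P : probability T R).
Local Notation "'N_ p [ f ]" := (Lnorm P p (EFin \o f)).
Local Notation leb := (@lebesgue_measure R).
Variables (psi : R -> T -> R) (N : R -> \bar R) (f : T -> R).
Hypothesis mpsi : measurable_fun setT (fun q : R * T => psi q.1 q.2).
Hypothesis psi0 : forall t w, (0 <= psi t w)%R.
Hypothesis mf : measurable_fun setT f.
Hypothesis f0 : forall w, (0 <= f w)%R.
Hypothesis fpsi :
  {ae P, forall w, (f w)%:E <= \int[leb]_(t in `[0%R, 1%R]) (psi t w)%:E}.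

Let mI : measurable (`[0%R, 1%R] : set R). Proof. exact: measurable_itv. Qed.

Lemma measurable_psi_t t : measurable_fun setT (psi t).
Proof. by apply: (measurableT_comp mpsi (g := fun w => (t, w))); exact: measurable_pair1. Qed.

(* Tonelli against a weight, which avoids any measurability of [N]. *)
Lemma weighted_integral_le (k : T -> R) (K : R) :
  measurable_fun setT k -> (forall w, (0 <= k w)%R) -> (0 < K)%R ->
  (forall t, (0 <= t <= 1)%R -> \int[P]_w (psi t w * k w)%:E <= N t * K%:E) ->
  \int[P]_w (f w * k w)%:E <= \int[leb]_(t in `[0%R, 1%R]) N t * K%:E.
Proof.
move=> mk k0 K0 hN.
pose u (q : T * R) := ((psi q.2 q.1)%:E * (k q.1)%:E * (\1_(`[0%R, 1%R]) q.2)%:E).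
have mpsi' : measurable_fun setT (fun q : T * R => (psi q.2 q.1)%:E).
  apply/measurable_EFinP.
  by apply: (measurableT_comp mpsi (g := fun q : T * R => (q.2, q.1))); exact: measurable_swap.
have mu : measurable_fun setT u.
  apply: emeasurable_funM; first apply: emeasurable_funM => //.
    by apply/measurable_EFinP; exact: measurableT_comp.
  apply/measurable_EFinP.
  have m1 : measurable_fun setT (\1_(`[0%R, 1%R]) : R -> R) by exact: measurable_indic.
  exact: (measurableT_comp m1).
have u0 q : 0 <= u q by rewrite /u !mule_ge0 ?lee_fin.
have mp w : measurable_fun setT (fun t => (psi t w)%:E).
  apply/measurable_EFinP.
  by apply: (measurableT_comp mpsi (g := fun t => (t, w))); exact: measurable_pair2.
apply: (@le_trans _ _ (\int[P]_w \int[leb]_t u (w, t))).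
  apply: ae_ge0_le_integral => //.
  - by move=> w _; rewrite lee_fin mulr_ge0.
  - by apply/measurable_EFinP; exact: measurable_funM.
  - by move=> w _; apply: integral_ge0.
  - exact: (measurable_fun_fubini_tonelli_F (m2 := leb) _ mu u0).
  apply: filterS fpsi => w fw _.
  have -> : \int[leb]_t u (w, t) =
      (k w)%:E * \int[leb]_(t in `[0%R, 1%R]) (psi t w)%:E.
    rewrite -ge0_integralZl//; last 3 first.
    - by apply: measurable_funTS; exact: mp.
    - by move=> t _; rewrite lee_fin.
    - by rewrite lee_fin.
    rewrite [RHS]integral_mkcond; apply: eq_integral => t _.
    rewrite /u /= patchE indicE; case: ifP => _; rewrite ?mule0// mule1.
    by rewrite muleC.
  by rewrite EFinM muleC lee_wpmul2l// lee_fin.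
rewrite (fubini_tonelli (m1 := P) (m2 := leb) u mu u0).
pose m t := \int[P]_w (psi t w * k w)%:E.
have mm : measurable_fun setT m.
  apply: (measurable_fun_fubini_tonelli_F (m2 := P) (fun q : R * T => (psi q.1 q.2 * k q.2)%:E)).
    apply/measurable_EFinP; apply: measurable_funM => //.
    by apply: measurableT_comp.
  by move=> q; rewrite lee_fin mulr_ge0.
have m0 t : 0 <= m t by apply: integral_ge0 => w _; rewrite lee_fin mulr_ge0.
(* The constant [K] is pulled out of the integral of the measurable function K^-1 m, and not out of
   that of [N]; then K^-1 m <= N is integrated by plain monotonicity. *)
apply: (@le_trans _ _ (\int[leb]_(t in `[0%R, 1%R]) (K%:E * ((K^-1)%:E * m t)))).
  rewrite [leRHS]integral_mkcond le_eqVlt; apply/orP; left; apply/eqP.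
  apply: eq_integral => t _; rewrite patchE muleA -EFinM mulfV ?gt_eqF// mul1e.
  rewrite /u /= indicE; case: ifP => _ /=.
    by apply: eq_integral => w _; rewrite mule1.
  by rewrite integral0_eq// => w _; rewrite mule0.
rewrite ge0_integralZl//; last 3 first.
- by apply: measurable_funTS; exact: measurable_funeM.
- by move=> t _; rewrite mule_ge0// lee_fin invr_ge0 ltW.
- by rewrite lee_fin ltW.
rewrite muleC; apply: lee_wpmul2r; first by rewrite lee_fin ltW.
apply: ge0_le_integral_nonmeasurable.
  by move=> t _; rewrite mule_ge0// lee_fin invr_ge0 ltW.
move=> t; rewrite /= in_itv /= => t01.
by rewrite lee_pdivrMl// muleC; exact: hN.
Qed.

Let Nint_ge0 p : (forall t, (0 <= t <= 1)%R -> 'N_p[psi t] <= N t) ->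
  0 <= \int[leb]_(t in `[0%R, 1%R]) N t.
Proof.
move=> hN; apply: integral_ge0 => t; rewrite /= in_itv/= => t01.
by apply: le_trans (hN t t01); exact: Lnorm_ge0.
Qed.

(** Let c be the right-hand side. The indicator of A = {f > c} as a weight gives that f has integral
    at most c P(A) over A; hence the positive part of f - c has integral 0. *)
Lemma minkowski_integral_y :
  (forall t, (0 <= t <= 1)%R -> 'N_+oo[psi t] <= N t) ->
  'N_+oo[f] <= \int[leb]_(t in `[0%R, 1%R]) N t.
Proof.
move=> hN; have := Nint_ge0 hN.
case E : (\int[leb]_(t in _) N t) => [c| |] // c0; last by rewrite leey.
rewrite lee_fin in c0; apply/Lnormy_leP.
pose A := [set w | (c < f w)%R].
have mA : measurable A.
  rewrite -[X in measurable X]setTI.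
  exact: (measurable_fun_ltr (measurable_cst c) mf measurableT (Y := [set true]) I).
have [PA0|PA0] := eqVneq (P A) 0.
  exists A; split => // w /=; rewrite lee_fin (ger0_norm (f0 w)) => /negP.
  by rewrite -ltNge.
have PAfin : P A \is a fin_num by apply: fin_num_measure.
have a0 : (0 < fine (P A))%R by rewrite fine_gt0// lt0e PA0 measure_ge0/= -ge0_fin_numE.
have mA1 : measurable_fun setT (\1_A : T -> R) by exact: measurable_indic.
have A1 : \int[P]_w (\1_A w)%:E = (fine (P A))%:E.
  by rewrite integral_indic// setIT fineK.
have := @weighted_integral_le (\1_A) (fine (P A)) mA1 _ a0.
rewrite E => /(_ _ _)/wrap[].
- by [].
- move=> t t01; apply: (@le_trans _ _ ('N_1[\1_A \* psi t]%R)).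
    rewrite Lnorm1; apply: ge0_le_integral => //.
    + by move=> w _; rewrite lee_fin mulr_ge0.
    + by apply/measurable_EFinP; apply: measurable_funM => //; exact: measurable_psi_t.
    + apply: measurableT_comp => //; apply/measurable_EFinP.
      by apply: measurable_funM => //; exact: measurable_psi_t.
    + by move=> w _; rewrite /= lee_fin mulrC ler_norm.
  have -> : (\1_A \* psi t = psi t \* \1_A)%R by apply/funext => w /=; rewrite mulrC.
  apply: le_trans (Lnorm_hoelder_y P _ (measurable_psi_t t) mA1) _ => //.
  apply: lee_pmul; rewrite ?Lnorm_ge0 ?hN//.
  rewrite Lnorm1 le_eqVlt; apply/orP; left; apply/eqP; rewrite -A1.
  by apply: eq_integral => w _; rewrite /= ger0_norm.
move=> le1.
pose e w := (Num.max (f w - c) 0)%R.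
have me : measurable_fun setT e.
  by apply: measurable_maxr => //; exact: measurable_funB.
have e0 w : (0 <= e w)%R by rewrite le_max lexx orbT.
have fe w : ((f w * \1_A w)%:E = (e w)%:E + (c * \1_A w)%:E).
  rewrite -EFinD /e indicE; congr _%:E; have [h|h] := leP (f w) c.
    rewrite memNset /A/=; last by rewrite ltNge h.
    by rewrite !mulr0 addr0; apply/esym/max_idPr; rewrite subr_le0.
  rewrite mem_set//= !mulr1 (max_idPl _) ?subrK// subr_ge0.
  exact: ltW.
have : \int[P]_w (e w)%:E <= 0.
  move: le1; under eq_integral do rewrite fe.
  rewrite ge0_integralD//; last 4 first.
  - by move=> w _; rewrite lee_fin.
  - exact/measurable_EFinP.
  - by move=> w _; rewrite lee_fin mulr_ge0.
  - by apply/measurable_EFinP; exact: measurable_funM.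
  under [X in _ + X <= _ -> _]eq_integral do rewrite EFinM.
  rewrite ge0_integralZl//; last exact/measurable_EFinP.
  rewrite A1 -EFinM -leeBrDr// -EFinB subrr.
  done.
move=> e_le0.
have : \int[P]_w `|(e w)%:E| = 0.
  apply/eqP; rewrite eq_le integral_ge0 ?andbT//.
  apply: le_trans e_le0; rewrite le_eqVlt; apply/orP; left; apply/eqP.
  by apply: eq_integral => w _; rewrite gee0_abs// lee_fin.
have meE : measurable_fun setT (EFin \o e) by exact/measurable_EFinP.
move=> /(ae_eq_integral_abs P measurableT meE).
apply: filterS => w /(_ I) [] ew0; rewrite lee_fin ger0_norm//.
by rewrite -subr_le0 -ew0 le_max lexx.
Qed.

(** Duality with the weight f^(q-1), whose norm for the conjugate exponent q' is the power 1/q' of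
    the integral I of f^q: this yields I <= c I^(1/q'). Dividing requires I to be finite, so f is
    first truncated at n, and monotone convergence removes the truncation. *)
Lemma minkowski_integral_fin (q : R) : (1 <= q)%R ->
  (forall t, (0 <= t <= 1)%R -> 'N_q%:E[psi t] <= N t) ->
  'N_q%:E[f] <= \int[leb]_(t in `[0%R, 1%R]) N t.
Proof.
move=> q1 hN; have := Nint_ge0 hN.
have q0 : (0 < q)%R by rewrite (lt_le_trans _ q1).
move: q1; rewrite le_eqVlt => /predU1P[qE|q1].
  move=> _; rewrite -{}qE in hN *.
  have := @weighted_integral_le (cst 1%R) 1 (measurable_cst _) (fun=> ler01) ltr01.
  rewrite mule1 => H; rewrite Lnorm1.
  have -> : \int[P]_x `|(EFin \o f) x| = \int[P]_w (f w * cst 1%R w)%:E.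
    by apply: eq_integral => w _; rewrite /= ger0_norm ?mulr1.
  apply: H => t t01; rewrite mule1; apply: le_trans (hN t t01).
  rewrite Lnorm1 le_eqVlt; apply/orP; left; apply/eqP; apply: eq_integral => w _.
  by rewrite /= ger0_norm// mulr1.
case E : (\int[leb]_(t in _) N t) => [c| |] // c0; last by rewrite leey.
rewrite lee_fin in c0.
pose fn n w := Num.min (f w) n%:R.
have fn0 n w : (0 <= fn n w)%R by rewrite le_min f0 ler0n.
have mfn n : measurable_fun setT (fn n) by exact: measurable_minr.
pose I n := \int[P]_w (fn n w `^ q)%:E.
have I0 n : 0 <= I n by apply: integral_ge0 => w _; rewrite lee_fin powR_ge0.
have mpow (r : R) n : measurable_fun setT (fun w => fn n w `^ r)%R.
  exact: (measurableT_comp (measurable_powR _)).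
have Ifin n : I n \is a fin_num.
  rewrite ge0_fin_numE//; apply: (@le_lt_trans _ _ (\int[P]_w (n%:R `^ q)%:E)).
    apply: ge0_le_integral => //.
    - by move=> w _; rewrite lee_fin powR_ge0.
    - exact/measurable_EFinP.
    - by move=> w _; rewrite lee_fin (ge0_ler_powR (ltW q0)) ?nnegrE// /fn ge_min lexx orbT.
  by rewrite integral_cst// [X in _ * X](@probability_setT _ _ _ P) mule1 ltry.
have Ile n : I n <= (c `^ q)%:E.
  set i := fine (I n); have IE : I n = i%:E by rewrite fineK.
  have := I0 n; rewrite IE !lee_fin le_eqVlt => /predU1P[<-|i0]; first exact: powR_ge0.
  pose q' := (q / (q - 1))%R.
  have q'0 : (0 < q')%R by rewrite divr_gt0// subr_gt0.
  have qq' : (q^-1 + q'^-1 = 1)%R by rewrite /q'; field; rewrite ?subr_eq0 !gt_eqF.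
  have := @weighted_integral_le (fun w => fn n w `^ (q - 1))%R (i `^ q'^-1) (mpow _ _).
  rewrite E => /(_ _ _ _)/wrap[].
  - by move=> w; exact: powR_ge0.
  - by rewrite powR_gt0.
  - move=> t t01.
    apply: (@le_trans _ _ ('N_1[psi t \* (fun w => fn n w `^ (q - 1))]%R)).
      rewrite Lnorm1 le_eqVlt; apply/orP; left; apply/eqP; apply: eq_integral => w _.
      by rewrite /= ger0_norm// mulr_ge0// powR_ge0.
    apply: le_trans (hoelder P (measurable_psi_t t) (mpow _ _) q0 q'0 qq') _.
    apply: lee_pmul; rewrite ?Lnorm_ge0 ?hN//.
    rewrite LnormE -poweR_EFin -IE le_eqVlt; apply/orP; left; apply/eqP; congr (_ `^ _).
    apply: eq_integral => w _; rewrite /= ger0_norm ?powR_ge0// -powRrM.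
    by congr (_ `^ _)%:E; rewrite /q'; field; rewrite subr_eq0 gt_eqF.
  move=> le1.
  have le2 : i%:E <= c%:E * (i `^ q'^-1)%:E.
    apply: le_trans le1; rewrite -IE; apply: ge0_le_integral => //.
    - by move=> w _; rewrite lee_fin powR_ge0.
    - exact/measurable_EFinP.
    - by apply/measurable_EFinP; exact: measurable_funM.
    move=> w _; rewrite lee_fin.
    have [->|fnw] := eqVneq (fn n w) 0%R.
      by rewrite powR0 ?gt_eqF// mulr_ge0// powR_ge0.
    have -> : (fn n w `^ q = fn n w * fn n w `^ (q - 1))%R.
      rewrite mulrC -[X in (_ * X)%R]powRr1// -powRD ?subrK//.
      by rewrite fnw implybT.
    by rewrite ler_wpM2r ?powR_ge0// /fn ge_min lexx.
  have le3 : (i `^ q^-1 <= c)%R.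
    have iE : i = (i `^ q^-1 * i `^ q'^-1)%R.
      rewrite -powRD ?qq' ?powRr1 ?ltW//.
      by apply/implyP => _; rewrite gt_eqF.
    by move: le2; rewrite -EFinM lee_fin {1}iE ler_pM2r// powR_gt0.
  have -> : i = ((i `^ q^-1) `^ q)%R by rewrite -powRrM mulVf ?gt_eqF// powRr1// ltW.
  by rewrite ge0_ler_powR ?nnegrE ?powR_ge0// ltW.
have limI : \int[P]_w (f w `^ q)%:E = limn I.
  rewrite -monotone_convergence//.
  - apply: eq_integral => w _; apply/esym/lim_near_cst => //.
    near=> n; congr (_ `^ _)%:E; apply/min_idPl.
    by near: n; exact: nbhs_infty_ger.
  - by move=> n; exact/measurable_EFinP.
  - by move=> n w _; rewrite lee_fin powR_ge0.
  - move=> w _ m n mn; rewrite lee_fin (ge0_ler_powR (ltW q0)) ?nnegrE ?fn0//.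
    by rewrite /fn le_min !ge_min lexx /= ler_nat mn orbT.
have : \int[P]_w (f w `^ q)%:E <= (c `^ q)%:E.
  rewrite limI; apply: lime_le; last by apply: nearW => n; exact: Ile.
  apply: ereal_nondecreasing_is_cvgn => m n mn; apply: ge0_le_integral => //.
  - by move=> w _; rewrite lee_fin powR_ge0.
  - exact/measurable_EFinP.
  - exact/measurable_EFinP.
  - move=> w _; rewrite lee_fin (ge0_ler_powR (ltW q0)) ?nnegrE ?fn0//.
    by rewrite /fn le_min !ge_min lexx /= ler_nat mn orbT.
move=> le1; rewrite LnormE.
under eq_integral do rewrite ger0_norm//.
apply: le_trans (lee_poweR _ _ le1) _; first by rewrite invr_ge0 ltW.
  by apply: integral_ge0 => w _; rewrite lee_fin powR_ge0.
by rewrite poweR_EFin -powRrM mulfV ?gt_eqF// powRr1.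
Unshelve. all: by end_near. Qed.

Lemma minkowski_integral p : 1 <= p ->
  (forall t, (0 <= t <= 1)%R -> 'N_p[psi t] <= N t) ->
  'N_p[f] <= \int[leb]_(t in `[0%R, 1%R]) N t.
Proof.
case: p => [q| |] // q1; first exact: minkowski_integral_fin.
exact: minkowski_integral_y.
Qed.

End minkowski_integral.

(** * The kernel as a contraction of L^p *)

Section kernel_contraction.
Context {dT} {T : measurableType dT} {R : realType} (P : probability T R).
Context {d : nat} (Z : {RV P >-> 'cV[R]_d}).
Hypothesis hZ : standard_gaussian P Z.
Context {dS} {S : measurableType dS} (V : T -> S).
Hypothesis mV : measurable_fun setT V.
Hypothesis indep : independent_RV P Z V.
Variables (h : S -> 'cV[R]_d) (F : S * 'cV[R]_d -> R).
Hypotheses (mh : measurable_fun setT h) (mF : measurable_fun setT F).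
Local Notation "'N_ p [ f ]" := (Lnorm P p (EFin \o f)).

Lemma ae_kexpe0 (f : S * 'cV[R]_d -> \bar R) : measurable_fun setT f ->
  (forall q, 0 <= f q) -> {ae P, forall w, f (V w, Z w) = 0} ->
  {ae P, forall w, kexpe P V h f (kpath Z V h w) = 0}.
Proof.
move=> mf f0 fae.
have mk : measurable_fun setT (fun w => kexpe P V h f (kpath Z V h w)).
  apply: (measurableT_comp (measurable_kexpe1 P mV mh mf f0)).
  exact: measurable_kpath.
have : \int[P]_w `|kexpe P V h f (kpath Z V h w)| = 0.
  under eq_integral do rewrite gee0_abs ?kexpe_ge0//.
  rewrite (ge0_integral_kexpeT hZ mV indep mh mf f0).
  have <- : \int[P]_w (cst 0 w) = 0 :> \bar R by rewrite integral0.
  apply: ae_eq_integral => //.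
    by apply: (measurableT_comp mf); exact: measurable_VZ.
  by apply: filterS fae => w ->.
move=> /(ae_eq_integral_abs P measurableT mk).
by apply: filterS => w /(_ I).
Qed.

Let aF q := (`|F q|)%:E.
Let maF : measurable_fun setT aF.
Proof. by apply/measurable_EFinP; exact: measurableT_comp. Qed.

Let mF_VZ : measurable_fun setT (fun w => F (V w, Z w)).
Proof. by apply: (measurableT_comp mF); exact: measurable_VZ. Qed.

Let mkF : measurable_fun setT (fun w => kexp P V h F (kpath Z V h w)).
Proof.
apply: (measurableT_comp (measurable_kexp P mV mh mF)).
exact: measurable_kpath.
Qed.

(** Hoelder's inequality after splitting the weight into its powers 1/q and 1/q'; the second factor
    has norm 1, as the weight has total mass 1. *)
Lemma kexp_jensen (q : R) g : (1 <= q)%R ->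
  (`|kexp P V h F g| `^ q)%:E <= kexpe P V h (fun x => (`|F x| `^ q)%:E) g.
Proof.
rewrite le_eqVlt => /predU1P[<-|q1].
  rewrite powRr1//; apply: le_trans (kexp_le P mV mh mF g) _.
  rewrite le_eqVlt; apply/orP; left; apply/eqP; apply: eq_integral => w _.
  by rewrite powRr1.
have q0 : (0 < q)%R by rewrite (lt_trans _ q1).
pose q' := (q / (q - 1))%R.
have q'0 : (0 < q')%R by rewrite divr_gt0// subr_gt0.
have qq' : (q^-1 + q'^-1 = 1)%R by rewrite /q'; field; rewrite ?subr_eq0 !gt_eqF.
pose u w := (`|F (V w, g - h (V w))| * kwt P V h g w `^ q^-1)%R.
pose v w := (kwt P V h g w `^ q'^-1)%R.
have mk := measurable_kwt P mV g mh.
have k0 w : (0 < kwt P V h g w)%R by exact: kwt_gt0.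
have mFg : measurable_fun setT (fun w => F (V w, g - h (V w)))%R.
  apply: (measurableT_comp mF (g := fun w => (V w, g - h (V w))%R)).
  by apply: measurable_fun_pair => //; exact: measurable_arg.
have mu : measurable_fun setT u.
  apply: measurable_funM; first exact: measurableT_comp.
  exact: (measurableT_comp (measurable_powR _)).
have mv : measurable_fun setT v by exact: (measurableT_comp (measurable_powR _)).
have le1 : `|kexp P V h F g|%:E <= 'N_q%:E[u] * 'N_q'%:E[v].
  apply: le_trans (hoelder P mu mv q0 q'0 qq').
  apply: le_trans (kexp_le P mV mh mF g) _.
  rewrite Lnorm1 le_eqVlt; apply/orP; left; apply/eqP; apply: eq_integral => w _.
  rewrite [RHS]/= [in RHS]ger0_norm ?mulr_ge0 ?powR_ge0//.
  rewrite /u /v -EFinM -mulrA -powRD; last by apply/implyP => _; rewrite gt_eqF.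
  by rewrite qq' powRr1// ltW.
have v1 : 'N_q'%:E[v] = 1.
  rewrite LnormE (_ : \int[P]_w _ = 1) ?poweR1r// -[RHS](integral_kwt P mV g mh).
  apply: eq_integral => w _; rewrite ger0_norm ?powR_ge0// -powRrM mulVf ?gt_eqF// powRr1//.
  exact: ltW.
have uq : 'N_q%:E[u] = (kexpe P V h (fun x => (`|F x| `^ q)%:E) g) `^ q^-1.
  rewrite LnormE; congr (_ `^ _); apply: eq_integral => w _.
  rewrite ger0_norm ?mulr_ge0 ?powR_ge0// powRM ?powR_ge0// -powRrM mulVf ?gt_eqF//.
  by rewrite powRr1 ?EFinM// ltW.
move: le1; rewrite v1 mule1 uq => le1.
rewrite -poweR_EFin; apply: le_trans (lee_poweR _ _ le1) _ => //; first exact: ltW.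
by rewrite -poweRrM mulVf ?gt_eqF// poweRe1// kexpe_ge0.
Qed.

(** For finite exponents, integrate Jensen's inequality and use that kernel averages preserve means.
    For p = oo and a finite essential bound m, the excess [u] of |F| over m is almost surely null,
    hence so is its kernel average, and |KF| <= m + Ku. *)
Lemma Lnorm_kexp_le p : 1 <= p ->
  'N_p[(fun w => kexp P V h F (kpath Z V h w))] <= 'N_p[(fun w => F (V w, Z w))].
Proof.
case: p => [q| |] // q1.
  rewrite lee_fin in q1; have q0 : (0 < q)%R by rewrite (lt_le_trans _ q1).
  rewrite !LnormE; apply: lee_poweR; first by rewrite invr_ge0 ltW.
    by apply: integral_ge0 => w _; rewrite lee_fin powR_ge0.
  have mFq : measurable_fun setT (fun x => (`|F x| `^ q)%:E).
    apply/measurable_EFinP; apply: (measurableT_comp (measurable_powR _)).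
    exact: measurableT_comp.
  have Fq0 x : 0 <= (`|F x| `^ q)%:E by rewrite lee_fin powR_ge0.
  rewrite -(ge0_integral_kexpeT hZ mV indep mh mFq Fq0).
  apply: ge0_le_integral => //.
  - exact: measurable_abs_powR.
  - apply: (measurableT_comp (measurable_kexpe1 P mV mh mFq Fq0)).
    exact: measurable_kpath.
  - by move=> w _; exact: kexp_jensen.
have := Lnorm_ge0 P +oo (EFin \o (fun w => F (V w, Z w))).
case E : ('N_+oo[(fun w => F (V w, Z w))]) => [m| |] // m0; last by rewrite leey.
rewrite lee_fin in m0; apply/Lnormy_leP.
have /Lnormy_leP Fm : 'N_+oo[(fun w => F (V w, Z w))] <= m%:E by rewrite E.
pose u q := (Num.max (`|F q| - m) 0)%R.
have mu : measurable_fun setT (fun q => (u q)%:E).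
  apply/measurable_EFinP; apply: measurable_maxr => //.
  by apply: measurable_funB => //; exact: measurableT_comp.
have u0 q : 0 <= (u q)%:E by rewrite lee_fin le_max lexx orbT.
have uae : {ae P, forall w, (u (V w, Z w))%:E = 0}.
  apply: filterS Fm => w; rewrite lee_fin => Fwm.
  by congr _%:E; apply/max_idPr; rewrite subr_le0.
apply: filterS (ae_kexpe0 mu u0 uae) => w kw0.
apply: le_trans (kexp_le P mV mh mF _) _.
apply: (@le_trans _ _ (kexpe P V h (fun q => m%:E + (u q)%:E) (kpath Z V h w))).
  apply: kexpe_le => //; first by apply: emeasurable_funD.
  by move=> q; rewrite -EFinD lee_fin -lerBlDl le_max lexx.
rewrite /kexpe; under eq_integral do rewrite ge0_muleDl ?u0 ?lee_fin//.
rewrite ge0_integralD//; last 4 first.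
- by move=> w' _; rewrite mule_ge0// lee_fin ltW// kwt_gt0.
- by apply: emeasurable_funM => //; apply/measurable_EFinP; exact: measurable_kwt.
- by move=> w' _; rewrite mule_ge0// lee_fin ltW// kwt_gt0.
- apply: emeasurable_funM; last by apply/measurable_EFinP; exact: measurable_kwt.
  apply: (measurableT_comp mu (g := fun w' => (V w', (kpath Z V h w - h (V w'))%R))).
  by apply: measurable_fun_pair => //; exact: measurable_arg.
move: kw0; rewrite /kexpe => ->; rewrite adde0.
rewrite ge0_integralZl//; last 2 first.
- by apply/measurable_EFinP; exact: measurable_kwt.
- by move=> w' _; rewrite lee_fin ltW// kwt_gt0.
by rewrite integral_kwt// mule1.
Qed.

End kernel_contraction.

(** * One-dimensional projections of the Gaussian vector *)

Section gaussian_shift_law.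
Context {R : realType}.
Local Notation N := (normal_prob (0 : R) 1).

(* The Cameron-Martin formula on the line. It characterizes the standard normal
   law (its case [f = 1] gives the moment generating function), which identifies
   the law of [<Z, u>] for a unit vector [u] without rotating [Z]. *)
Definition shift_law {dT} {T : measurableType dT} (m : {measure set T -> \bar R}) (X : T -> R) :=
  forall (f : R -> \bar R) (s : R), measurable_fun setT f -> (forall x, 0 <= f x) ->
  \int[m]_w f (X w + s)%R = \int[m]_w (f (X w) * (expR (s * X w - s ^+ 2 / 2))%:E).

(** Write f(x + s) = F(x + s) exp(x^2/2) with F(x) = f(x) exp(-(x - s)^2/2), then translate. *)
Lemma normal_shift_law : shift_law N (fun x : R => x).
Proof.
move=> f s mf f0.
pose F x := f x * (expR (- ((x - s) ^+ 2 / 2)))%:E.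
have mF : measurable_fun setT F.
  apply: emeasurable_funM => //; apply/measurable_EFinP; apply: measurableT_comp => //.
  apply: measurableT_comp => //; apply: measurable_funM => //.
  by apply: measurable_funX; exact: measurable_funB.
have F0 x : 0 <= F x by rewrite mule_ge0// lee_fin expR_ge0.
transitivity (\int[N]_x (F (x + s)%R * (expR (x ^+ 2 / 2))%:E)).
  by apply: eq_integral => x _; rewrite /F -muleA -EFinM -expRD addrK addNr expR0 mule1.
rewrite ge0_integral_normal_shift//; apply: eq_integral => x _; rewrite /F -muleA -EFinM -expRD.
by congr (_ * (expR _)%:E); field.
Qed.

Lemma normal_mgf (s : R) : \int[N]_x (expR (s * x - s ^+ 2 / 2))%:E = 1.
Proof.
have := @normal_shift_law (cst 1) s (measurable_cst _) (fun=> lee01).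
rewrite integral_cst// mul1e [X in X = _](@probability_setT _ _ _ N) => ->.
by apply: eq_integral => x _; rewrite mul1e.
Qed.

(** Let y be standard normal and independent of X, and compute the mean of f(X + y) exp(-X y -
    y^2/2) in two ways. With y frozen, the shift law of X turns it into the mean of f(X). With X
    frozen, the shift law of y gives f(y) exp(X y - y^2/2), and averaging over X cancels the
    exponential because E exp(sX) = exp(s^2/2); the mean of f(y) remains. *)
Lemma shift_law_normal {dT} {T : measurableType dT} (P : probability T R) (X : T -> R)
    (f : R -> \bar R) : measurable_fun setT X -> shift_law P X ->
  measurable_fun setT f -> (forall x, 0 <= f x) ->
  \int[P]_w f (X w) = \int[N]_x f x.
Proof.
move=> mX hX mf f0.
have mgf s : \int[P]_w (expR (s * X w))%:E = (expR (s ^+ 2 / 2))%:E.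
  have := hX (cst 1) s (measurable_cst _) (fun=> lee01).
  rewrite integral_cst// mul1e [X in X = _](@probability_setT _ _ _ P) => /esym H.
  rewrite -[RHS]mul1e -H muleC -ge0_integralZl//; last 2 first.
  - apply: emeasurable_funM => //; apply/measurable_EFinP; apply: measurableT_comp => //.
    by apply: measurable_funB => //; exact: measurable_funM.
  - by move=> w _; rewrite mule_ge0// lee_fin expR_ge0.
  apply: eq_integral => w _; rewrite mul1e -EFinM -expRD.
  by congr (expR _)%:E; rewrite addrC subrK.
pose u (q : T * R) := f (X q.1 + q.2)%R * (expR (- (X q.1 * q.2) - q.2 ^+ 2 / 2))%:E.
have mu : measurable_fun setT u.
  have mX1 : measurable_fun setT (fun q : T * R => X q.1) by exact: measurableT_comp.
  apply: emeasurable_funM.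
    by apply: (measurableT_comp mf); exact: measurable_funD.
  apply/measurable_EFinP; apply: measurableT_comp => //; apply: measurable_funB.
    by apply: measurableT_comp => //; exact: measurable_funM.
  by apply: measurable_funM => //; exact: measurable_funX.
have u0 q : 0 <= u q by rewrite mule_ge0// lee_fin expR_ge0.
have := fubini_tonelli (m1 := P) (m2 := N) u mu u0.
have mexp (a b c : R) : measurable_fun setT (fun y : R => expR (a * y ^+ 2 + b * y + c)).
  apply: measurableT_comp => //; apply: measurable_funD => //; apply: measurable_funD.
    by apply: measurable_funM => //; exact: measurable_funX.
  exact: measurable_funM.
have -> : \int[N]_y \int[P]_w u (w, y) = \int[P]_w f (X w).
  rewrite -[RHS]mule1 -[X in _ * X](@probability_setT _ _ _ N).
  rewrite -integral_cst//; apply: eq_integral => y _.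
  pose g x := f x * (expR (- ((x - y) * y) - y ^+ 2 / 2))%:E.
  have mg : measurable_fun setT g.
    apply: emeasurable_funM => //; apply/measurable_EFinP; apply: measurableT_comp => //.
    apply: measurable_funB => //; apply: measurableT_comp => //.
    by apply: measurable_funM => //; exact: measurable_funB.
  have g0 x : 0 <= g x by rewrite mule_ge0// lee_fin expR_ge0.
  transitivity (\int[P]_w g (X w + y)%R).
    by apply: eq_integral => w _; rewrite /u /g /= addrK.
  rewrite hX//; apply: eq_integral => w _.
  rewrite /g -muleA -EFinM -expRD -[RHS]mule1; congr (_ * _).
  set e := (X in expR X); have -> : e = 0%R by rewrite /e; field.
  by rewrite expR0.
have -> : \int[P]_w \int[N]_y u (w, y) =
    \int[P]_w \int[N]_y (f y * (expR (X w * y - y ^+ 2 / 2))%:E).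
  apply: eq_integral => w _.
  pose k y := f y * (expR (- (X w * (y - X w)) - (y - X w) ^+ 2 / 2))%:E.
  have mk : measurable_fun setT k.
    apply: emeasurable_funM => //; apply/measurable_EFinP; apply: measurableT_comp => //.
    apply: measurable_funB; last first.
      by apply: measurable_funM => //; apply: measurable_funX; exact: measurable_funB.
    apply: measurableT_comp => //; apply: measurable_funM => //.
    exact: measurable_funB.
  have k0 x : 0 <= k x by rewrite mule_ge0// lee_fin expR_ge0.
  transitivity (\int[N]_y k (y + X w)%R).
    by apply: eq_integral => y _; rewrite /u /k /= addrK addrC.
  rewrite (normal_shift_law (X w) mk k0); apply: eq_integral => y _.
  by rewrite /k -muleA -EFinM -expRD; congr (_ * (expR _)%:E); field.
move=> <-.
pose v (q : T * R) := f q.2 * (expR (X q.1 * q.2 - q.2 ^+ 2 / 2))%:E.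
have mv : measurable_fun setT v.
  have mX1 : measurable_fun setT (fun q : T * R => X q.1) by exact: measurableT_comp.
  apply: emeasurable_funM; first exact: (measurableT_comp mf).
  apply/measurable_EFinP; apply: measurableT_comp => //; apply: measurable_funB.
    exact: measurable_funM.
  by apply: measurable_funM => //; exact: measurable_funX.
have v0 q : 0 <= v q by rewrite mule_ge0// lee_fin expR_ge0.
rewrite (fubini_tonelli (m1 := P) (m2 := N) v mv v0).
apply: eq_integral => y _; rewrite /v /=.
under eq_integral do rewrite expRD EFinM muleA muleAC.
rewrite ge0_integralZl//; last 2 first.
- apply/measurable_EFinP; apply: measurableT_comp => //; exact: measurable_funM.
- by rewrite mule_ge0// lee_fin expR_ge0.
under eq_integral do rewrite mulrC.
rewrite mgf -muleA -EFinM -expRD addNr expR0; exact: mule1.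
Qed.

(** |x| <= exp(x) + exp(-x), whose mean is finite by [normal_mgf] at s = 1 and s = -1. *)
Lemma normal_abs_lty : \int[N]_x `|x|%:E < +oo.
Proof.
have me s : measurable_fun setT (fun x : R => (expR (s * x - s ^+ 2 / 2))%:E).
  apply/measurable_EFinP; apply: measurableT_comp => //.
  by apply: measurable_funB => //; exact: measurable_funM.
apply: (@le_lt_trans _ _ (\int[N]_x ((expR (1 / 2))%:E * ((expR (1 * x - 1 ^+ 2 / 2))%:E
   + (expR (- 1 * x - (- 1) ^+ 2 / 2))%:E)))).
  apply: ge0_le_integral => //.
  - by apply/measurable_EFinP; exact: normr_measurable.
  - by apply: measurable_funeM; apply: emeasurable_funD; exact: me.
  move=> x _; rewrite -EFinD -EFinM lee_fin mulrDr -!expRD sqrrN expr1n mul1r mulN1r.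
  rewrite ![(2^-1 + _)%R]addrC !subrK.
  have h (y : R) : (y <= expR y)%R by apply: le_trans (expR_ge1Dx y); rewrite lerDr.
  rewrite ler_norml; apply/andP; split.
    by rewrite lerNl; apply: le_trans (h _) _; rewrite lerDr expR_ge0.
  by rewrite mul1r; apply: le_trans (h _) _; rewrite lerDl expR_ge0.
rewrite ge0_integralZl//; last 2 first.
- by apply: emeasurable_funD; exact: me.
- by move=> x _; rewrite -EFinD lee_fin addr_ge0// expR_ge0.
rewrite ge0_integralD//; last 2 first.
- exact: me.
- exact: me.
by rewrite !normal_mgf -EFinD -EFinM ltry.
Qed.

Lemma not_covered_by_null {dT} {T : measurableType dT} (mu : probability T R)
    (A B : set T) : mu A = 0 -> mu B = 0 -> measurable A -> measurable B ->
  ~ [set: T] `<=` A `|` B.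
Proof.
move=> A0 B0 mA mB sub; have : mu setT <= 0.
  apply: le_trans (le_measure mu _ _ sub) _; rewrite ?inE//; first exact: measurableU.
  by apply: le_trans (measureU2 _ mA mB) _; rewrite [X in X + _]A0 [X in _ + X]B0 adde0.
by rewrite probability_setT lee_fin ler10.
Qed.

(** Thanks to this, E|<Z, Y>| controls E|Y|_2, and all the norms [gauss_norm] are positive. *)
Lemma normal_abs_gt0 : 0 < \int[N]_x `|x|%:E.
Proof.
rewrite lt0e integral_ge0 ?andbT//; apply/eqP => i0.
have mx : measurable_fun setT (EFin : R -> \bar R) by exact/measurable_EFinP.
have := (ae_eq_integral_abs N measurableT mx).1 i0.
move=> [A [mA A0 hA]].
have N0 : N [set 0%R] = 0.
  have := @normal_prob_dominates R 0 1; move=> /null_content_dominatesP; apply.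
    exact: measurable_set1.
  exact: lebesgue_measure_set1.
apply: (@not_covered_by_null _ _ N A [set 0%R] A0 N0 mA) => //.
move=> x _; have [->|x0] := eqVneq x 0%R; [by right|left].
by apply: hA => /= /(_ I) [] /eqP; rewrite (negPf x0).
Qed.

End gaussian_shift_law.

(** * Scalar products of the Gaussian vector with an independent vector *)

Section gaussian_marginals.
Context {dT} {T : measurableType dT} {R : realType} (P : probability T R).
Context {d : nat} (Z : {RV P >-> 'cV[R]_d}).
Hypothesis hZ : standard_gaussian P Z.
Local Notation N := (normal_prob (0 : R) 1).
Local Notation "'N_ p [ f ]" := (Lnorm P p (EFin \o f)).

(** Translating [Z] by s u adds s to <Z, u> since u is a unit vector, and the ratio of the Gaussian
    kernels at Z - s u and at Z is exp(s <Z, u> - s^2/2). *)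
Lemma dotv_shift_law (u : 'cV[R]_d) : dotv u u = 1%R ->
  shift_law P (fun w => dotv (Z w) u).
Proof.
move=> u1 f s mf f0.
have mdu : measurable_fun setT (fun v : 'cV[R]_d => dotv v u) by exact: measurable_dotv.
pose F (v : 'cV[R]_d) := f (dotv v u) * (gker (v - s *: u))%:E.
have mF : measurable_fun setT F.
  apply: emeasurable_funM; first exact: (measurableT_comp mf).
  apply/measurable_EFinP; apply: (measurableT_comp measurable_gker).
  exact: measurable_mxB.
have F0 x : 0 <= F x by rewrite mule_ge0// lee_fin ltW// gker_gt0.
transitivity (\int[P]_w (F (Z w + s *: u)%R * (gker_inv (Z w))%:E)).
  apply: eq_integral => w _.
  by rewrite /F -muleA -EFinM addrK gker_invK mule1 dotvDl dotvZl u1 mulr1.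
rewrite (ge0_integral_gauss_shift hZ)//; apply: eq_integral => w _;
  rewrite /F -muleA -EFinM /gker /gker_inv -expRD.
congr (_ * (expR _)%:E); rewrite dotvBl !dotvBr !dotvZl !dotvZr u1 (dotvC u).
by field.
Qed.

(** For nonzero y, [shift_law_normal] is applied to the projection on the unit vector y/|y|_2. *)
Lemma ge0_integral_dotv (y : 'cV[R]_d) (f : R -> \bar R) :
  measurable_fun setT f -> (forall x, 0 <= f x) ->
  \int[P]_w f (dotv (Z w) y) = \int[N]_x f (lrnorm 2%:E y * x)%R.
Proof.
move=> mf f0; have h2 : 1 <= 2%:E :> \bar R by rewrite lee_fin ler1n.
have [y0|y0] := eqVneq (lrnorm 2%:E y) 0%R.
  have -> : \int[P]_w f (dotv (Z w) y) = \int[P]_w (cst (f 0%R) w).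
    apply: eq_integral => w _; rewrite (lrnorm_eq0 h2 y0).
    by rewrite -(scale0r 0%R) dotvZr mul0r.
  have -> : \int[N]_x f (lrnorm 2%:E y * x)%R = \int[N]_x (cst (f 0%R) x).
    by apply: eq_integral => x _; rewrite y0 mul0r.
  rewrite !integral_cst//; congr (_ * _).
  by rewrite [LHS](@probability_setT _ _ _ P) [RHS](@probability_setT _ _ _ N).
set c := lrnorm 2%:E y in y0 *.
have cc : (c * c = dotv y y)%R by rewrite /c lrnorm2E -expr2 sqr_sqrtr// dotv_ge0.
pose u := (c^-1 *: y)%R.
have u1 : dotv u u = 1%R.
  by rewrite /u dotvZl dotvZr -cc mulrA -invfM mulVf// mulf_neq0.
have mcf : measurable_fun setT (fun x : R => f (c * x)%R).
  by apply: (measurableT_comp mf); exact: measurable_funM.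
rewrite -(shift_law_normal (P := P) (X := fun w => dotv (Z w) u) _ (dotv_shift_law u1) mcf)//.
  by apply: eq_integral => w _; rewrite /u dotvZr mulrA mulfV// mul1r.
exact: measurable_dotv.
Qed.

Context {dS} {S : measurableType dS} (V : T -> S).
Hypothesis mV : measurable_fun setT V.
Hypothesis indep : independent_RV P Z V.
Variables (hY : S -> 'cV[R]_d) (mhY : measurable_fun setT hY).

Let mdot : measurable_fun setT (fun q : 'cV[R]_d * S => dotv q.1 (hY q.2)).
Proof. by apply: measurable_dotv => //; exact: measurableT_comp. Qed.

Let mnY : measurable_fun setT (fun s => lrnorm 2%:E (hY s)).
Proof. exact: measurable_lrnorm. Qed.

Lemma ge0_integral_dotv_indep (f : R -> \bar R) :
  measurable_fun setT f -> (forall x, 0 <= f x) ->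
  \int[P]_w f (dotv (Z w) (hY (V w))) =
  \int[P]_w' \int[N]_x f (lrnorm 2%:E (hY (V w')) * x)%R.
Proof.
move=> mf f0.
rewrite (ge0_integral_indep (f := fun q : 'cV[R]_d * S => f (dotv q.1 (hY q.2))) _ mV indep)//.
  by apply: eq_integral => w' _; exact: (ge0_integral_dotv (hY (V w')) mf f0).
exact: (measurableT_comp mf mdot).
Qed.

(** An equality, because it serves in both directions: with a constant vector it shows that [Z] is
    integrable, and it deduces the integrability of Y from that of <Y, Z>. *)
Lemma integral_dotv_abs : \int[P]_w `|dotv (Z w) (hY (V w))|%:E =
  \int[P]_w (lrnorm 2%:E (hY (V w)))%:E * \int[N]_x `|x|%:E.
Proof.
rewrite (ge0_integral_dotv_indep (f := fun x => `|x|%:E))//; last first.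
  by apply/measurable_EFinP; exact: normr_measurable.
rewrite -ge0_integralZr//; last 3 first.
- by apply/measurable_EFinP; exact: (measurableT_comp mnY).
- by move=> w _; rewrite lee_fin lrnorm_ge0.
- by apply: integral_ge0 => x _.
apply: eq_integral => w' _.
rewrite -ge0_integralZl//; last 2 first.
- by apply/measurable_EFinP; exact: normr_measurable.
- by rewrite lee_fin lrnorm_ge0.
by apply: eq_integral => x _; rewrite normrM EFinM (ger0_norm (lrnorm_ge0 _ _)).
Qed.

(** Given V, <Z, Y> is distributed as |Y|_2 g. For finite exponents the integrals factorize and the
    inequality is an equality; the essential supremum is treated through the excess over a bound. *)
Lemma Lnorm_dotv_le b : 1 <= b ->
  'N_b[(fun w => dotv (Z w) (hY (V w)))] <=
  'N_b[(fun w => lrnorm 2%:E (hY (V w)))] * gauss_norm b.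
Proof.
have mYV : measurable_fun setT (fun w => lrnorm 2%:E (hY (V w))).
  exact: (measurableT_comp mnY).
have mZY : measurable_fun setT (fun w => dotv (Z w) (hY (V w))).
  by apply: measurable_dotv => //; exact: measurableT_comp.
case: b => [b| |] // b1.
  rewrite lee_fin in b1; have b0 : (0 < b)%R by rewrite (lt_le_trans _ b1).
  rewrite /gauss_norm !LnormE -poweRM; last 2 first.
  - by apply: integral_ge0 => w _; rewrite lee_fin powR_ge0.
  - by apply: integral_ge0 => w _; rewrite lee_fin powR_ge0.
  rewrite le_eqVlt; apply/orP; left; apply/eqP; congr (_ `^ _).
  have mp : measurable_fun setT (fun x : R => (`|x| `^ b)%:E).
    apply/measurable_EFinP; apply: (measurableT_comp (measurable_powR _)).
    exact: normr_measurable.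
  rewrite (ge0_integral_dotv_indep mp); last by move=> x; rewrite lee_fin powR_ge0.
  rewrite -ge0_integralZr//; last 2 first.
  - exact: measurable_abs_powR.
  - by apply: integral_ge0 => x _; rewrite lee_fin powR_ge0.
  apply: eq_integral => w' _; rewrite -ge0_integralZl//.
  by apply: eq_integral => x _; rewrite normrM powRM// EFinM.
have := Lnorm_ge0 N +oo (fun x => x%:E); rewrite /gauss_norm.
case E : (Lnorm N +oo _) => [m| |] // m0; last first.
  (* An infinite Gaussian norm makes the bound trivial, except against a null Y, where the product
     is 0. *)
  have [Y0|Y0] := eqVneq 'N_+oo[(fun w => lrnorm 2%:E (hY (V w)))] 0.
    rewrite Y0 mul0e Lnorm_ae0//.
    apply: filterS (Lnorm_eq0_ae b1 mYV Y0) => w /(lrnorm_eq0 _) ->.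
      by rewrite -(scale0r 0%R) dotvZr mul0r.
    by rewrite lee_fin ler1n.
  by rewrite gt0_muley ?leey// lt0e Y0 Lnorm_ge0.
rewrite lee_fin in m0.
have /Lnormy_leP Nm : Lnorm N +oo (EFin \o (fun x : R => x)) <= m%:E.
  by rewrite -E; exact: lexx.
rewrite muleC -{1}(ger0_norm m0) -(Lnorm_scale _ _ b1 mYV).
apply: Lnorm_le_ae => //; first exact: measurable_funM.
(* The excess of |<Z, Y>| over m |Y|_2 has integral 0: with V frozen, <Z, y> is distributed as |y|_2
   g, and |g| <= m almost surely. *)
pose f (q : 'cV[R]_d * S) := (Num.max (`|dotv q.1 (hY q.2)| - m * lrnorm 2%:E (hY q.2)) 0)%R.
have mf : measurable_fun setT (fun q => (f q)%:E).
  apply/measurable_EFinP; apply: measurable_maxr => //.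
  apply: measurable_funB; first exact: measurableT_comp.
  by apply: measurable_funM => //; exact: (measurableT_comp mnY).
have f0 q : 0 <= (f q)%:E by rewrite lee_fin le_max lexx orbT.
have f0' : \int[P]_w `|(f (Z w, V w))%:E| = 0.
  under eq_integral do rewrite gee0_abs//.
  rewrite (ge0_integral_indep (f := fun q => (f q)%:E) _ mV indep)//.
  rewrite integral0_eq// => w' _.
  set c := lrnorm 2%:E (hY (V w')).
  have mg : measurable_fun setT (fun x : R => (Num.max (`|x| - m * c) 0)%:E).
    apply/measurable_EFinP; apply: measurable_maxr => //.
    by apply: measurable_funB => //; exact: measurableT_comp.
  rewrite [LHS](ge0_integral_dotv (hY (V w')) mg); last first.
    by move=> x; rewrite lee_fin le_max lexx orbT.
  rewrite -/c -[RHS](integral0 N setT); apply: ae_eq_integral => //.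
    apply: (measurableT_comp mg); exact: measurable_funM.
  apply: filterS Nm => x xm _; congr (_%:E); apply/max_idPr.
  rewrite normrM (ger0_norm (lrnorm_ge0 _ _)) subr_le0 mulrC.
  by rewrite ler_wpM2r// lrnorm_ge0.
have mfZ : measurable_fun setT (fun w => (f (Z w, V w))%:E).
  by apply: (measurableT_comp mf); exact: measurable_fun_pair.
apply: filterS ((ae_eq_integral_abs P measurableT mfZ).1 f0') => w /(_ I) [] fw.
rewrite normrM (ger0_norm m0) (ger0_norm (lrnorm_ge0 _ _)).
by rewrite -subr_le0 -fw /f le_max lexx.
Qed.

End gaussian_marginals.

Local Close Scope ereal_scope.

(** * Differentiation of the kernel along a line *)

Section calculus_along_a_line.
Context {R : realType} {d : nat} (a b : 'cV[R]_d).

Definition line (t : R) : 'cV[R]_d := a + t *: b.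

Lemma is_diff_line (t : R) : is_diff t line ( *:%R ^~ b).
Proof.
have -> : line = cst a + ( *:%R ^~ b) by [].
rewrite -[X in is_diff _ _ X]add0r.
exact: is_diffD (is_diff_cst _ _) (is_diff_scalel _ _).
Qed.

Lemma continuous_line : continuous line.
Proof. by move=> t; apply: differentiable_continuous; have [] := is_diff_line t. Qed.

Lemma continuous_coord_line {m n} (F : 'cV[R]_d -> 'M[R]_(m, n)) i j :
  continuous F -> continuous (fun t => F (line t) i j).
Proof.
move=> cF t; apply: (@continuous_comp _ _ _ (F \o line) (fun M => M i j)).
  by apply: continuous_comp; [exact: continuous_line|exact: cF].
exact: coord_continuous.
Qed.

Lemma derive_jac (f : 'cV[R]_d -> 'cV[R]_d) z : differentiable f z ->
  'D_b f z = jac f z *m b.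
Proof.
move=> df; rewrite deriveE//.
have {1}-> : b = \sum_j b j 0 *: delta_mx j 0.
  by rewrite {1}[b]matrix_sum_delta; apply: eq_bigr => j _; rewrite big_ord1.
rewrite linear_sum; apply/matrixP => i k; rewrite ord1 summxE !mxE.
apply: eq_bigr => j _; rewrite linearZ !mxE mulrC; congr (_ * _).
by rewrite deriveE.
Qed.

Lemma is_derive_line (f : 'cV[R]_d -> 'cV[R]_d) i (t : R) : differentiable f (line t) ->
  is_derive t (1 : R) (fun t => f (line t) i 0) ((jac f (line t) *m b) i 0).
Proof.
move=> df; have hf : is_diff (line t) f ('d f (line t)) by split.
have [dfl Dfl] := is_diff_comp (is_diff_line t) hf.
have dd : derivable (f \o line) t 1 by exact: diff_derivable.
apply: DeriveDef; first exact: ((derivable_mxP _ _ _).1 dd i 0).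
have -> : jac f (line t) *m b = 'D_1 (f \o line) t.
  rewrite -derive_jac// deriveE// [RHS]deriveE//.
  by rewrite (congr1 (fun h : R -> 'cV[R]_d => h 1) Dfl) /= scale1r.
by rewrite derive_mx// mxE.
Qed.

Lemma continuous_dotv_line (c : 'cV[R]_d) : continuous (fun t => dotv (line t) c).
Proof.
have -> : (fun t => dotv (line t) c) = (fun t => dotv a c + t * dotv b c).
  by apply/funext => t; rewrite dotvDl dotvZl.
by move=> t; apply: cvgD; [exact: cvg_cst|apply: cvgMl; exact: cvg_id].
Qed.

Lemma is_derive_gker_line (t : R) : is_derive t (1 : R) (fun t => gker (line t))
  (- (dotv (line t) b * gker (line t))).
Proof.
(* The exponent -|a + s b|^2/2, expanded as a polynomial in s. *)
pose E (s : R) : R := - 2^-1 * (dotv a a + 2 * dotv a b * s + dotv b b * (s * s)).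
have -> : (fun t => gker (line t)) = expR \o E.
  apply/funext => s; rewrite /gker /line /E /=; congr expR.
  by rewrite dotvDl !dotvDr !dotvZl !dotvZr (dotvC b a); field.
have dE : is_derive t (1 : R) E (- dotv (line t) b).
  have h1 := is_derive_id t (1 : R).
  have h2 := is_deriveZ (2 * dotv a b) h1.
  have h3 := is_deriveZ (dotv b b) (is_deriveM h1 h1).
  have h := is_deriveZ (- 2^-1) (is_deriveD (is_deriveD (is_derive_cst (dotv a a) t
    (1 : R)) h2) h3).
  apply: (is_derive_eq h); rewrite /line dotvDl dotvZl /GRing.scale/=.
  by field.
have -> : - (dotv (line t) b * gker (line t)) = expR (E t) * (- dotv (line t) b).
  rewrite mulrN mulrC; congr (- (_ * _)); rewrite /gker /line /E; congr expR.
  by rewrite dotvDl !dotvDr !dotvZl !dotvZr (dotvC b a); field.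
exact: is_derive1_comp.
Qed.

Lemma continuous_gker_line : continuous (fun t => gker (line t)).
Proof.
move=> t; apply: differentiable_continuous; apply/derivable1_diffP.
by have [] := is_derive_gker_line t.
Qed.

(** |v_j| <= 1 + v_j^2/2 <= exp(|v|^2/2), so each |v_j| gker(v) is at most 1. The derivative of
    [gker] along a line is thus bounded uniformly in t by the l^1 norm of the direction. *)
Lemma dotv_gker_le (v : 'cV[R]_d) : `|dotv v b| * gker v <= \sum_j `|b j 0|.
Proof.
rewrite (le_trans (ler_wpM2r (ltW (gker_gt0 _)) (ler_norm_sum _ _ _)))// mulr_suml.
apply: ler_sum => j _; rewrite normrM mulrAC ler_piMl//.
rewrite /gker expRN ler_pdivrMr ?expR_gt0// mul1r.
have h : (`|v j 0| ^+ 2 <= dotv v v).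
  rewrite real_normK ?num_real// /dotv (bigD1 j)//= -expr2 lerDl.
  by apply: sumr_ge0 => i _; rewrite -expr2 sqr_ge0.
apply: le_trans (expR_ge1Dx _).
have := sqr_ge0 (`|v j 0| - 1); rewrite sqrrB1 => h2.
by nra.
Qed.

End calculus_along_a_line.

(** * The denominator of the kernel along a path *)

Section kernel_density_along_a_line.
Context {dT} {T : measurableType dT} {R : realType} (P : probability T R).
Context {d : nat} (A B : T -> 'cV[R]_d).
Hypotheses (mA : measurable_fun setT A) (mB : measurable_fun setT B).
Hypothesis iB : forall j, P.-integrable setT (fun w => (B w j 0)%:E).

Let mline t : measurable_fun setT (fun w => line (A w) (B w) t).
Proof. by apply: measurable_mxD => //; exact: measurable_mxZ. Qed.

Let mg t : measurable_fun setT (fun w => gker (line (A w) (B w) t)).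
Proof. exact: (measurableT_comp measurable_gker). Qed.

Let G w := \sum_j `|B w j 0|.

Let G0 w : 0 <= G w.
Proof. exact: sumr_ge0. Qed.

Let iG : P.-integrable setT (EFin \o G).
Proof.
rewrite (_ : _ \o _ = fun w => (\sum_j (`|B w j 0|)%:E)%E); last first.
  by apply/funext => w; rewrite /= sumEFin.
apply: integrable_sum => // j _.
by have := integrable_abse (iB j).
Qed.

Let ig t : P.-integrable setT (EFin \o (fun w => gker (line (A w) (B w) t))).
Proof.
have i1 : P.-integrable setT (EFin \o cst (1 : R)) by exact: finite_measure_integrable_cst.
apply: (le_integrable measurableT _ _ i1); first exact/measurable_EFinP.
by move=> w _; rewrite lee_fin normr1 ger0_norm ?gker_le1// ltW// gker_gt0.
Qed.

(** With A = g0 - X' and B = y - Y', this is the denominator of the kernel at the point g0 + t y. *)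
Definition line_density t := \int[P]_w gker (line (A w) (B w) t).

Definition line_density' t :=
  \int[P]_w (- (dotv (line (A w) (B w) t) (B w) * gker (line (A w) (B w) t))).

Let D1 t w : derive1 (fun t => gker (line (A w) (B w) t)) t =
  - (dotv (line (A w) (B w) t) (B w) * gker (line (A w) (B w) t)).
Proof. by rewrite derive1E; have [_] := is_derive_gker_line (A w) (B w) t. Qed.

Let D1_le t w :
  `|- (dotv (line (A w) (B w) t) (B w) * gker (line (A w) (B w) t))| <= G w.
Proof.
by rewrite normrN normrM (ger0_norm (ltW (gker_gt0 _))) dotv_gker_le.
Qed.

Lemma integrable_line_density' t : P.-integrable setT (EFin \o (fun w =>
  - (dotv (line (A w) (B w) t) (B w) * gker (line (A w) (B w) t)))).
Proof.
apply: (le_integrable measurableT _ _ iG).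
  apply/measurable_EFinP; apply: measurableT_comp => //; apply: measurable_funM => //.
  exact: measurable_dotv.
by move=> w _; rewrite lee_fin (ger0_norm (G0 w)).
Qed.

(** Differentiation under the integral, dominated by the integrable function [G] of [dotv_gker_le],
    which does not depend on t. *)
Lemma is_derive_line_density t :
  is_derive t (1 : R) line_density (line_density' t).
Proof.
have It : t \in `]t - 1, t + 1[ by rewrite in_itv/= ltrBlDr !ltrDl ltr01.
have h := @derivable_under_integral R _ T P
  (fun t w => gker (line (A w) (B w) t)) setT measurableT t (t - 1) (t + 1).
have h' := @differentiation_under_integral R _ T P
  (fun t w => gker (line (A w) (B w) t)) setT measurableT t (t - 1) (t + 1).
apply: DeriveDef.
  apply: (h It _ _ G) => //.
  - by move=> s w _ _; have [] := is_derive_gker_line (A w) (B w) s.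
  - by move=> s w _ _; rewrite /partial1of2 D1.
rewrite -derive1E /line_density (h' It _ _ G)//.
- by apply: eq_Rintegral => w _; rewrite /partial1of2 D1.
- by move=> s w _ _; have [] := is_derive_gker_line (A w) (B w) s.
- by move=> s w _ _; rewrite /partial1of2 D1.
Qed.

Lemma continuous_line_density' : continuous line_density'.
Proof.
move=> t.
have It : t \in `]t - 1, t + 1[ by rewrite in_itv/= ltrBlDr !ltrDl ltr01.
have h := @continuity_under_integral R _ T P
  (fun t w => - (dotv (line (A w) (B w) t) (B w) * gker (line (A w) (B w) t)))
  setT measurableT (t - 1) (t + 1).
have {}h := h _ _ G iG.
apply: h => //.
- move=> s _.
  exact: integrable_line_density'.
- apply: aeW => w _ s _; apply: (@cvgN _ R^o); apply: (@cvgM _ R^o).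
    exact: continuous_dotv_line.
  exact: continuous_gker_line.
- by move=> s _; apply: aeW => w _.
- by rewrite inE.
Qed.

End kernel_density_along_a_line.

(** * Linearity of kernel averages at a fixed point *)

Section kernel_expectation_calculus.
Context {dT} {T : measurableType dT} {R : realType} (P : probability T R).
Context {d : nat} {dS} {S : measurableType dS} (V : T -> S).
Hypothesis mV : measurable_fun setT V.
Local Notation absF F := (fun q : S * 'cV[R]_d => (`|F q|)%:E).

Lemma measurable_kexp_joint {dO} {O : measurableType dO}
    (h : O -> S -> 'cV[R]_d) (g : O -> 'cV[R]_d) (F : S * 'cV[R]_d -> R) :
  measurable_fun setT (fun q : O * S => h q.1 q.2) -> measurable_fun setT g ->
  measurable_fun setT F -> measurable_fun setT (fun o => kexp P V (h o) F (g o)).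
Proof.
move=> mh mg mF.
have mho o : measurable_fun setT (h o).
  by apply: (measurableT_comp mh (g := fun s => (o, s))); exact: measurable_pair1.
have mFE : measurable_fun setT (EFin \o F) by exact/measurable_EFinP.
under eq_fun do rewrite kexpE//.
apply: (measurableT_comp (fine_measurable measurableT)).
apply: emeasurable_funB; apply: measurable_kexpe => //.
- exact: measurable_funepos.
- exact: measurable_funeneg.
Qed.

Variables (h : S -> 'cV[R]_d) (g : 'cV[R]_d).
Hypothesis mh : measurable_fun setT h.
Implicit Types F : S * 'cV[R]_d -> R.

(** At a given point [g], the operator [kexp] is linear on functions integrable under the kernel;
    elsewhere its value may be a mere convention. *)
Definition kfin F := measurable_fun setT F /\ (kexpe P V h (absF F) g < +oo)%E.

Lemma kfin_integrable F : kfin F ->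
  P.-integrable setT (fun w' => (F (V w', g - h (V w')) * kwt P V h g w')%:E).
Proof.
move=> [mF fF]; apply/integrableP; split.
  by apply/measurable_EFinP; exact: measurable_kintegrand.
by rewrite -kexpe_abs.
Qed.

Lemma kfinP F : measurable_fun setT F ->
  P.-integrable setT (fun w' => (F (V w', g - h (V w')) * kwt P V h g w')%:E) -> kfin F.
Proof. by move=> mF /integrableP[_]; rewrite -kexpe_abs. Qed.

Lemma kfinD F1 F2 : kfin F1 -> kfin F2 -> kfin (F1 \+ F2).
Proof.
move=> h1 h2; have [m1 _] := h1; have [m2 _] := h2.
apply: kfinP; first exact: measurable_funD.
under eq_fun do rewrite mulrDl EFinD.
by apply: integrableD => //; exact: kfin_integrable.
Qed.

Lemma kexpD F1 F2 : kfin F1 -> kfin F2 ->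
  kexp P V h (F1 \+ F2) g = kexp P V h F1 g + kexp P V h F2 g.
Proof.
move=> h1 h2; rewrite /kexp -RintegralD//; [|exact: kfin_integrable..].
by apply: eq_Rintegral => w _; rewrite mulrDl.
Qed.

Lemma kfinZ k F : kfin F -> kfin (fun q => k * F q).
Proof.
move=> hF; have [mF _] := hF; apply: kfinP; first exact: measurable_funM.
under eq_fun do rewrite -mulrA EFinM.
by apply: integrableZl => //; exact: kfin_integrable.
Qed.

Lemma kexpZ k F : kfin F -> kexp P V h (fun q => k * F q) g = k * kexp P V h F g.
Proof.
move=> hF; rewrite /kexp -RintegralZl//; last exact: kfin_integrable.
by apply: eq_Rintegral => w _; rewrite mulrA.
Qed.

Lemma kfinN F : kfin F -> kfin (fun q => - F q).
Proof.
move=> /(kfinZ (-1)); rewrite (_ : (fun q => - F q) = fun q => -1 * F q)//.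
by apply/funext => q; rewrite mulN1r.
Qed.

Lemma kexpN F : kfin F -> kexp P V h (fun q => - F q) g = - kexp P V h F g.
Proof.
move=> hF; rewrite -[RHS]mulN1r -kexpZ//.
by congr (kexp _ _ _ _ _); apply/funext => q; rewrite mulN1r.
Qed.

Lemma kfinB F1 F2 : kfin F1 -> kfin F2 -> kfin (F1 \- F2).
Proof. by move=> h1 h2; apply: (kfinD h1 (kfinN h2)). Qed.

Lemma kexpB F1 F2 : kfin F1 -> kfin F2 ->
  kexp P V h (F1 \- F2) g = kexp P V h F1 g - kexp P V h F2 g.
Proof. by move=> h1 h2; rewrite -kexpN// -kexpD//; exact: kfinN. Qed.

Lemma kfin_kexp_sum (I : Type) (r : seq I) (F : I -> S * 'cV[R]_d -> R) :
  (forall i, kfin (F i)) -> kfin (fun q => \sum_(i <- r) F i q) /\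
  kexp P V h (fun q => \sum_(i <- r) F i q) g = \sum_(i <- r) kexp P V h (F i) g.
Proof.
move=> hF; elim: r => [|i r [IH IHe]].
  have -> : (fun q : S * 'cV[R]_d => \sum_(i <- [::]) F i q) = cst 0.
    by apply/funext => q; rewrite big_nil.
  split; last first.
    rewrite big_nil /kexp; under eq_Rintegral do rewrite mul0r.
    by rewrite Rintegral_cst// mul0r.
  split; first exact: measurable_cst.
  rewrite /kexpe integral0_eq ?ltry// => w _; rewrite normr0; exact: mul0e.
have -> : (fun q => \sum_(i <- i :: r) F i q) = F i \+ (fun q => \sum_(i <- r) F i q).
  by apply/funext => q; rewrite big_cons.
by rewrite big_cons kexpD// IHe; split => //; exact: kfinD.
Qed.

Lemma kfin_sum (I : Type) (r : seq I) (F : I -> S * 'cV[R]_d -> R) :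
  (forall i, kfin (F i)) -> kfin (fun q => \sum_(i <- r) F i q).
Proof. by move=> /(kfin_kexp_sum r)[]. Qed.

Lemma kexp_sum (I : Type) (r : seq I) (F : I -> S * 'cV[R]_d -> R) :
  (forall i, kfin (F i)) ->
  kexp P V h (fun q => \sum_(i <- r) F i q) g = \sum_(i <- r) kexp P V h (F i) g.
Proof. by move=> /(kfin_kexp_sum r)[]. Qed.

End kernel_expectation_calculus.

(** * Absolute continuity in t of the kernel average of H *)

Section pathwise_derivative.
Context {dT} {T : measurableType dT} {R : realType} (P : probability T R).
Context {d : nat} {dS} {S : measurableType dS} (V : T -> S).
Hypothesis mV : measurable_fun setT V.
Variables (hX hY : S -> 'cV[R]_d).
Hypotheses (mX : measurable_fun setT hX) (mY : measurable_fun setT hY).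
Hypothesis iY : forall j, P.-integrable setT (fun w => (hY (V w) j 0)%:E).
Variable H : S -> 'cV[R]_d -> 'cV[R]_d.
Hypothesis mH : measurable_fun setT (fun q : S * 'cV[R]_d => H q.1 q.2).
Hypothesis mJ : measurable_fun setT (fun q : S * 'cV[R]_d => jac (H q.1) q.2).
Hypothesis cdH : forall s, continuously_differentiable (H s).
Local Notation absF F := (fun q : S * 'cV[R]_d => (`|F q|)%:E).
Local Notation leb := (@lebesgue_measure R).

Definition hpath t s : 'cV[R]_d := hX s + t *: hY s.

Lemma measurable_hpath_joint :
  measurable_fun setT (fun q : R * S => hpath q.1 q.2).
Proof.
apply: measurable_mxD; first exact: measurableT_comp.
by apply: measurable_mxZ => //; exact: measurableT_comp.
Qed.

Lemma measurable_hpath t : measurable_fun setT (hpath t).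
Proof. by apply: measurable_mxD => //; exact: measurable_mxZ. Qed.

Variables (g0 y : 'cV[R]_d) (i : 'I_d).

Let g t : 'cV[R]_d := g0 + t *: y.
Let A w := g0 - hX (V w).
Let B w := y - hY (V w).

Let mA : measurable_fun setT A.
Proof. by apply: measurable_mxB => //; exact: measurableT_comp. Qed.

Let mB : measurable_fun setT B.
Proof. by apply: measurable_mxB => //; exact: measurableT_comp. Qed.

Let iB j : P.-integrable setT (fun w => (B w j 0)%:E).
Proof.
under eq_fun do rewrite !mxE EFinD EFinN.
by apply: integrableB => //; exact: finite_measure_integrable_cst.
Qed.

Lemma lineE w t : line (A w) (B w) t = g t - hpath t (V w).
Proof.
by rewrite /line /A /B /g /hpath scalerBr addrACA opprD.
Qed.

Definition Fcoord (q : S * 'cV[R]_d) : R := H q.1 q.2 i 0.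
(** Minus the logarithmic derivative of [gker] along the path, on which the argument moves with
    velocity y - Y'. *)
Definition Flin (q : S * 'cV[R]_d) : R := dotv q.2 (y - hY q.1).
(** The derivative of H_i times [gker] along the path, divided by [gker]. *)
Definition Fderiv (q : S * 'cV[R]_d) : R :=
  (jac (H q.1) q.2 *m (y - hY q.1)) i 0 - Fcoord q * Flin q.

Lemma measurable_Fcoord : measurable_fun setT Fcoord.
Proof. exact: (measurable_mx_coord (F := fun q : S * 'cV[R]_d => H q.1 q.2)). Qed.

Let mYy : measurable_fun setT (fun q : S * 'cV[R]_d => y - hY q.1).
Proof. by apply: measurable_mxB => //; exact: measurableT_comp. Qed.

Lemma measurable_Flin : measurable_fun setT Flin.
Proof. by apply: measurable_dotv. Qed.

Lemma measurable_Fderiv : measurable_fun setT Fderiv.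
Proof.
apply: measurable_funB; last first.
  by apply: measurable_funM; [exact: measurable_Fcoord|exact: measurable_Flin].
apply: (measurable_mx_coord (F := fun q : S * 'cV[R]_d => jac (H q.1) q.2 *m (y - hY q.1))).
exact: measurable_mulmx.
Qed.

Definition path_den t := kden P V (hpath t) (g t).
(** Minus the logarithmic derivative of the denominator [path_den]. *)
Definition path_mean t := kexp P V (hpath t) Flin (g t).

Lemma path_denE : path_den = line_density P A B.
Proof.
apply/funext => t; rewrite /path_den /kden /line_density /Rintegral.
have E w : gker (g t - hpath t (V w)) = gker (line (A w) (B w) t) by rewrite lineE.
by apply: congr1; apply: eq_integral => w _; rewrite E.
Qed.

Lemma path_den_gt0 t : 0 < path_den t.
Proof. exact: (kden_gt0 _ mV _ (measurable_hpath t)). Qed.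

Lemma path_meanE t : line_density' P A B t = - (path_den t * path_mean t).
Proof.
have D0 : path_den t != 0 by rewrite gt_eqF ?path_den_gt0.
suff -> : path_mean t = line_density' P A B t * - (path_den t)^-1 by field.
rewrite /line_density' -RintegralZr//; last exact: integrable_line_density'.
apply: eq_Rintegral => w _; rewrite mulrNN /kwt mulrA.
by rewrite -/(path_den t) -lineE.
Qed.

Lemma is_derive_path_den t : is_derive t (1 : R) path_den (- (path_den t * path_mean t)).
Proof. by rewrite -path_meanE path_denE; exact: is_derive_line_density. Qed.

Lemma continuous_path_den : continuous path_den.
Proof.
move=> t; apply: differentiable_continuous; apply/derivable1_diffP.
by have [] := is_derive_path_den t.
Qed.

Lemma continuous_path_mean : continuous path_mean.
Proof.
have -> : path_mean = fun t => - (line_density' P A B t / path_den t).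
  apply/funext => t; rewrite path_meanE mulNr opprK mulrAC mulfV ?mul1r// gt_eqF ?path_den_gt0//.
move=> t; apply: (@cvgN _ R^o); apply: (@cvgM _ R^o).
  exact: continuous_line_density'.
by apply: cvgV; [rewrite gt_eqF ?path_den_gt0|exact: continuous_path_den].
Qed.

Definition path_fun w t :=
  Fcoord (V w, line (A w) (B w) t) * gker (line (A w) (B w) t) / path_den t.

(** The quotient rule: [Fderiv] comes from the numerator, [path_mean] from the denominator. *)
Definition path_deriv w t :=
  (Fderiv (V w, line (A w) (B w) t) + Fcoord (V w, line (A w) (B w) t) * path_mean t)
  * (gker (line (A w) (B w) t) / path_den t).

Lemma is_derive_path_fun w t : is_derive t (1 : R) (path_fun w) (path_deriv w t).
Proof.
have h1 : is_derive t (1 : R) (fun t => Fcoord (V w, line (A w) (B w) t))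
    ((jac (H (V w)) (line (A w) (B w) t) *m B w) i 0).
  by apply: (@is_derive_line _ _ _ _ (H (V w))); have [] := cdH (V w).
have h2 := is_derive_gker_line (A w) (B w) t.
have D0 : path_den t != 0 by rewrite gt_eqF ?path_den_gt0.
have h3 := is_deriveV D0 (is_derive_path_den t).
apply: (is_derive_eq (is_deriveM (is_deriveM h1 h2) h3)).
rewrite /path_deriv /Fderiv /Flin /Fcoord /= /GRing.scale/=.
rewrite -/(B w).
rewrite mulrfctE; set jb := (_ *m _) i 0.
by field.
Qed.

Lemma continuous_path_fun w : continuous (path_fun w).
Proof.
move=> t; apply: differentiable_continuous; apply/derivable1_diffP.
by have [] := is_derive_path_fun w t.
Qed.

Lemma continuous_path_deriv w : continuous (path_deriv w).
Proof.
have cline (M : 'cV[R]_d -> 'cV[R]_d) j : continuous M ->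
    continuous (fun t => M (line (A w) (B w) t) j 0).
  exact: continuous_coord_line.
have cJ : continuous (jac (H (V w))) by have [] := cdH (V w).
have cH : continuous (fun t => Fcoord (V w, line (A w) (B w) t)).
  apply: (cline (H (V w)) i) => z; apply: differentiable_continuous.
  by have [] := cdH (V w).
move=> t; apply: (@cvgM _ R^o); last first.
  apply: (@cvgM _ R^o); first exact: continuous_gker_line.
  by apply: cvgV; [rewrite gt_eqF ?path_den_gt0|exact: continuous_path_den].
apply: (@cvgD _ R^o); last by apply: (@cvgM _ R^o); [exact: cH|exact: continuous_path_mean].
apply: (@cvgB _ R^o); last first.
  by apply: (@cvgM _ R^o); [exact: cH|exact: continuous_dotv_line].
rewrite /= -/(B w).
under eq_cvg do rewrite mxE.
rewrite mxE; apply: cvg_big => //; first exact: add_continuous.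
move=> j _; apply: cvgMr_tmp.
exact: (@continuous_coord_line _ _ _ _ _ _ _ i j cJ).
Qed.

(** For each sample point the integrand of the kernel average is C^1 in t. Its increment is written
    as an integral before averaging, since only integrability over t is at hand for the average of
    the derivative. *)
Lemma FTC_phi w :
  (\int[leb]_(t in `[0%R, 1%R]) (path_deriv w t)%:E = (path_fun w 1)%:E - (path_fun w 0)%:E)%E.
Proof.
apply: continuous_FTC2 => //.
- by apply: continuous_subspaceT; exact: continuous_path_deriv.
- split.
  + by move=> t _; have [] := is_derive_path_fun w t.
  + by apply: cvg_at_right_filter; exact: continuous_path_fun.
  + by apply: cvg_at_left_filter; exact: continuous_path_fun.
- by move=> t _; rewrite derive1E; have [_] := is_derive_path_fun w t.
Qed.

Let I : set R := `[0, 1].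
Let mI : measurable I. Proof. exact: measurable_itv. Qed.

Let mg : measurable_fun setT g.
Proof. by apply: measurable_mxD => //; exact: measurable_mxZ. Qed.

Lemma measurable_path_deriv : measurable_fun setT (fun q : R * T => path_deriv q.2 q.1).
Proof.
have mline : measurable_fun setT (fun q : R * T => (V q.2, line (A q.2) (B q.2) q.1)).
  have -> : (fun q : R * T => (V q.2, line (A q.2) (B q.2) q.1)) =
      fun q => (V q.2, g q.1 - hpath q.1 (V q.2)).
    by apply/funext => q; rewrite lineE.
  exact: (measurable_karg mV (h := hpath) (g := g) measurable_hpath_joint mg).
have mm : measurable_fun setT path_mean.
  exact: (measurable_kexp_joint P mV (h := hpath)
    (g := g) measurable_hpath_joint mg measurable_Flin).
have -> : (fun q : R * T => path_deriv q.2 q.1) = (fun q : R * T =>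
    (Fderiv (V q.2, line (A q.2) (B q.2) q.1) +
     Fcoord (V q.2, line (A q.2) (B q.2) q.1) * path_mean q.1) *
    kwt P V (hpath q.1) (g q.1) q.2).
  by apply/funext => q; rewrite /path_deriv lineE.
apply: measurable_funM; last first.
  exact: (measurable_kwt_joint P mV (h := hpath) (g := g) measurable_hpath_joint mg).
apply: measurable_funD; first exact: (measurableT_comp measurable_Fderiv).
apply: measurable_funM; first exact: (measurableT_comp measurable_Fcoord).
exact: measurableT_comp.
Qed.

(** The average of [path_deriv] over the copy, hence the derivative of K_t H_i along the path. *)
Definition psi_path t := kexp P V (hpath t) Fderiv (g t) +
  kexp P V (hpath t) Fcoord (g t) * kexp P V (hpath t) Flin (g t).

Lemma path_derivE w t : path_deriv w t =
  Fderiv (V w, g t - hpath t (V w)) * kwt P V (hpath t) (g t) w +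
  path_mean t * (Fcoord (V w, g t - hpath t (V w)) * kwt P V (hpath t) (g t) w).
Proof. rewrite /path_deriv /kwt lineE -/(path_den t); set k := gker _ / _.
by ring. Qed.

(** By compactness of [0, 1]. The product of K_t H_i with [path_mean] is then dominated by a
    multiple of K_t |H_i|, whose integral over t is finite. *)
Lemma path_mean_bounded : exists2 C : R, 0 <= C & forall t, I t -> `|path_mean t| <= C.
Proof.
have [c c01 hc] := @EVT_max R (fun t => `|path_mean t|) 0 1 ler01
  (continuous_subspaceT (fun t => cvg_norm (@continuous_path_mean t))).
by exists `|path_mean c| => // t; exact: hc.
Qed.

Hypothesis fderiv : (\int[leb]_(t in I) kexpe P V (hpath t) (absF Fderiv) (g t) < +oo)%E.
Hypothesis fcoord : (\int[leb]_(t in I) kexpe P V (hpath t) (absF Fcoord) (g t) < +oo)%E.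

Lemma measurable_path_kabs (F : S * 'cV[R]_d -> R) : measurable_fun setT F ->
  measurable_fun setT (fun t => kexpe P V (hpath t) (absF F) (g t)).
Proof.
move=> mF; apply: (measurable_kexpe P mV (h := hpath) (g := g)) => //.
- exact: measurable_hpath_joint.
- by apply/measurable_EFinP; exact: measurableT_comp.
Qed.

Lemma path_kabs_ge0 (F : S * 'cV[R]_d -> R) t : (0 <= kexpe P V (hpath t) (absF F) (g t))%E.
Proof. by apply: kexpe_ge0 => //; exact: measurable_hpath. Qed.

Lemma path_deriv_abs_le (C : R) t : 0 <= C -> `|path_mean t| <= C ->
  (\int[P]_w `|(path_deriv w t)%:E| <= kexpe P V (hpath t) (absF Fderiv) (g t) +
    C%:E * kexpe P V (hpath t) (absF Fcoord) (g t))%E.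
Proof.
move=> C0 mC; have mht := measurable_hpath t.
rewrite !kexpe_abs// -ge0_integralZl//; last first.
  by apply: measurableT_comp => //; apply/measurable_EFinP;
    exact: (measurable_kintegrand P mV mht measurable_Fcoord).
have mk (F : S * 'cV[R]_d -> R) : measurable_fun setT F -> measurable_fun setT (fun w =>
    (`|(F (V w, g t - hpath t (V w)) * kwt P V (hpath t) (g t) w)%:E|)%E).
  move=> mF; apply: measurableT_comp => //; apply/measurable_EFinP.
  exact: (measurable_kintegrand P mV mht mF).
rewrite -ge0_integralD//; [|exact: mk measurable_Fderiv| |]; last 2 first.
- by move=> w _; rewrite mule_ge0// lee_fin.
- by apply: measurable_funeM; exact: mk measurable_Fcoord.
apply: ge0_le_integral => //.
- apply: measurableT_comp => //; apply/measurable_EFinP.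
  by apply: (measurableT_comp measurable_path_deriv (g := fun w => (t, w)));
    exact: measurable_pair1.
- apply: emeasurable_funD; first exact: mk measurable_Fderiv.
  by apply: measurable_funeM; exact: mk measurable_Fcoord.
move=> w _; rewrite path_derivE !abse_EFin -EFinM -EFinD lee_fin.
by rewrite (le_trans (ler_normD _ _))// lerD2l normrM ler_wpM2r.
Qed.

Lemma path_kabs_lty (C : R) : 0 <= C ->
  (\int[leb]_(t in I) (kexpe P V (hpath t) (absF Fderiv) (g t) +
    C%:E * kexpe P V (hpath t) (absF Fcoord) (g t)) < +oo)%E.
Proof.
move=> C0; rewrite ge0_integralD//; last 4 first.
- by move=> t _; exact: path_kabs_ge0.
- by apply: measurable_funTS; exact: measurable_path_kabs measurable_Fderiv.
- by move=> t _; rewrite mule_ge0 ?path_kabs_ge0.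
- by apply: measurable_funTS; apply: measurable_funeM;
  exact: measurable_path_kabs measurable_Fcoord.
rewrite ge0_integralZl//; last 2 first.
- by apply: measurable_funTS; exact: (measurable_path_kabs measurable_Fcoord).
- by move=> t _; exact: path_kabs_ge0.
by apply: lte_add_pinfty => //; exact: lte_mul_pinfty.
Qed.

Lemma path_ae_kfin (F : S * 'cV[R]_d -> R) : measurable_fun setT F ->
  (\int[leb]_(t in I) kexpe P V (hpath t) (absF F) (g t) < +oo)%E ->
  {ae leb, forall t, I t -> kfin P V (hpath t) (g t) F}.
Proof.
move=> mF fF.
have iF : leb.-integrable I (fun t => kexpe P V (hpath t) (absF F) (g t)).
  apply/integrableP; split; first by apply: measurable_funTS; exact: measurable_path_kabs.
  by under eq_integral do rewrite gee0_abs ?path_kabs_ge0//.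
have /(_ mI) := integrable_ae _ iF; apply: filterS => t h It; split => //.
by rewrite -ge0_fin_numE ?path_kabs_ge0//; exact: h.
Qed.

Lemma path_integral_deriv t : kfin P V (hpath t) (g t) Fderiv -> kfin P V (hpath t) (g t) Fcoord ->
  (\int[P]_w (path_deriv w t)%:E = (psi_path t)%:E)%E.
Proof.
move=> h1 h2; have mht := measurable_hpath t.
have i1 := kfin_integrable mV mht h1; have i2 := kfin_integrable mV mht h2.
under eq_integral do rewrite path_derivE EFinD [X in (_ + X)%E]EFinM.
rewrite integralD//; last exact: integrableZl.
rewrite integralZl// /psi_path EFinD; congr (_ + _)%E.
  by rewrite /kexp /Rintegral fineK//; exact: integrable_fin_num.
rewrite [in RHS]mulrC EFinM; congr (_ * _)%E.
by rewrite /kexp /Rintegral fineK//; exact: integrable_fin_num.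
Qed.

Lemma measurable_psi_path : measurable_fun setT psi_path.
Proof.
have mk (F : S * 'cV[R]_d -> R) : measurable_fun setT F ->
    measurable_fun setT (fun t => kexp P V (hpath t) F (g t)).
  exact: (measurable_kexp_joint P mV (h := hpath) (g := g) measurable_hpath_joint mg).
apply: measurable_funD; first exact: mk measurable_Fderiv.
by apply: measurable_funM; [exact: mk measurable_Fcoord|exact: mk measurable_Flin].
Qed.

Lemma integrable_psi_path : leb.-integrable I (EFin \o psi_path).
Proof.
have [C C0 hC] := path_mean_bounded.
apply/integrableP; split.
  by apply: measurable_funTS; apply/measurable_EFinP; exact: measurable_psi_path.
apply: le_lt_trans (path_kabs_lty C0); apply: ge0_le_integral => //.
- by apply: measurable_funTS; apply: measurableT_comp => //;
    apply/measurable_EFinP; exact: measurable_psi_path.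
- apply: measurable_funTS; apply: emeasurable_funD;
  first exact: measurable_path_kabs measurable_Fderiv.
  by apply: measurable_funeM; exact: measurable_path_kabs measurable_Fcoord.
move=> t It; rewrite abse_EFin.
apply: (@le_trans _ _ (`|kexp P V (hpath t) Fderiv (g t)|%:E +
  C%:E * `|kexp P V (hpath t) Fcoord (g t)|%:E)%E).
  rewrite -EFinM -EFinD lee_fin (le_trans (ler_normD _ _))// lerD2l normrM mulrC.
  by rewrite ler_wpM2r// hC.
have mht := measurable_hpath t.
apply: leeD; first exact: (kexp_le P mV mht measurable_Fderiv (g t)).
by rewrite lee_wpmul2l ?lee_fin//; exact: (kexp_le P mV mht measurable_Fcoord (g t)).
Qed.

Hypothesis fcoord01 : forall t, t = 0 \/ t = 1 ->
  kfin P V (hpath t) (g t) Fcoord.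

(** [FTC_phi] is averaged over the copy and the integrals are exchanged. An almost everywhere
    statement in t says nothing about the end points, whence the separate assumption [fcoord01]. *)
Lemma kexp_path_FTC : ((kexp P V (hpath 1) Fcoord (g 1) -
  kexp P V (hpath 0) Fcoord (g 0))%:E = \int[leb]_(t in I) (psi_path t)%:E)%E.
Proof.
have [C C0 hC] := path_mean_bounded.
have phiE t : t = 0 \/ t = 1 ->
    P.-integrable setT (EFin \o path_fun^~ t) /\
    (\int[P]_w (path_fun w t)%:E = (kexp P V (hpath t) Fcoord (g t))%:E)%E.
  move=> t01; have mht := measurable_hpath t.
  have i1 := kfin_integrable mV mht (fcoord01 t01).
  have E w : path_fun w t = Fcoord (V w, g t - hpath t (V w)) * kwt P V (hpath t) (g t) w.
    by rewrite /path_fun lineE -mulrA.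
  split; first by apply: eq_integrable i1 => // w _; rewrite /= E.
  under eq_integral do rewrite E.
  by rewrite /kexp /Rintegral fineK//; exact: integrable_fin_num.
have [i1 E1] := phiE 1 (or_intror erefl); have [i0 E0] := phiE 0 (or_introl erefl).
transitivity (\int[P]_w \int[leb]_(t in I) (path_deriv w t)%:E)%E.
  apply: (@etrans _ _ (\int[P]_w (path_fun w 1)%:E - \int[P]_w (path_fun w 0)%:E)%E).
    exact: (etrans (EFinB _ _) (congr2 (fun a b => a - b)%E (esym E1) (esym E0))).
  move=> {E1 E0}; apply: (etrans (esym (integralB measurableT i1 i0))).
  by apply: eq_integral => w _; rewrite FTC_phi.
(* Extension by 0 outside [0, 1], as Fubini's theorem is applied over the whole line. *)
pose f (q : R * T) := ((path_deriv q.2 q.1)%:E * (\1_I q.1)%:E)%E.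
have mf : measurable_fun setT f.
  apply: emeasurable_funM; apply/measurable_EFinP; first exact: measurable_path_deriv.
  by apply: (measurableT_comp (measurable_indic mI)).
have fI t w : I t -> f (t, w) = (path_deriv w t)%:E.
  by move=> It; rewrite /f /= indicE mem_set// mule1.
have fnI t w : ~ I t -> f (t, w) = 0%E.
  by move=> It; rewrite /f /= indicE memNset// mule0.
have iff : (leb \x P)%E.-integrable setT f.
  apply/integrable12ltyP; first exact: mf.
  have -> : (\int[leb]_t \int[P]_w `|f (t, w)| =
      \int[leb]_(t in I) \int[P]_w `|(path_deriv w t)%:E|)%E.
    rewrite [RHS]integral_mkcond; apply: eq_integral => t _; rewrite patchE.
    case: ifPn => [|/negP]; rewrite inE => It.
      by apply: eq_integral => w _; rewrite fI.
    by apply: integral0_eq => w _; rewrite fnI// abse0.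
  apply: le_lt_trans (path_kabs_lty C0).
  apply: ge0_le_integral_nonmeasurable => t It; first exact: integral_ge0.
  by apply: path_deriv_abs_le => //; exact: hC.
transitivity (\int[leb]_(t in I) \int[P]_w (path_deriv w t)%:E)%E; last first.
  apply: ae_eq_integral => //.
  - apply: (eq_measurable_fun (fun t => \int[P]_w f (t, w))%E).
      by move=> t; rewrite inE => It; apply: eq_integral => w _; exact: fI.
    apply: measurable_funTS; exact: (measurable_fubini_F iff).
  - by apply: measurable_funTS; apply/measurable_EFinP; exact: measurable_psi_path.
  have h1 := path_ae_kfin measurable_Fderiv fderiv.
  have h2 := path_ae_kfin measurable_Fcoord fcoord.
  apply: (@filterS2 _ _ (ae_filter_ringOfSetsType leb) _ _ _ _ h1 h2) => t k1 k2 It.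
  by apply: path_integral_deriv; [exact: k1|exact: k2].
transitivity (\int[P]_w \int[leb]_t f (t, w))%E.
  apply: eq_integral => w _; rewrite integral_mkcond; apply: eq_integral => t _.
  rewrite patchE; case: ifPn => [|/negP]; rewrite inE => It; first by rewrite fI.
  by rewrite fnI.
rewrite -(Fubini iff) [RHS]integral_mkcond; apply: eq_integral => t _; rewrite patchE.
case: ifPn => [|/negP]; rewrite inE => It.
  by apply: eq_integral => w _; rewrite fI.
by apply: integral0_eq => w _; rewrite fnI.
Qed.

End pathwise_derivative.

(** * Conditional expectations along the interpolation *)

(** An entry of the Jacobian is the limit of the difference quotients with steps 1/(n+1), which are
    jointly measurable because H is. *)
Lemma measurable_jac {R : realType} {d : nat} {dS} {S : measurableType dS}
    (H : S -> 'cV[R]_d -> 'cV[R]_d) :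
  measurable_fun setT (fun q : S * 'cV[R]_d => H q.1 q.2) ->
  (forall s z, differentiable (H s) z) ->
  measurable_fun setT (fun q : S * 'cV[R]_d => jac (H q.1) q.2).
Proof.
move=> mH dH; apply: measurable_mx => // i j.
pose e : 'cV[R]_d := delta_mx j 0.
pose Q (n : nat) (q : S * 'cV[R]_d) : R :=
  n.+1%:R * (H q.1 (q.2 + n.+1%:R^-1 *: e) i 0 - H q.1 q.2 i 0).
apply: (@measurable_fun_cvg _ _ _ _ Q).
  move=> n; apply: measurable_funM => //; apply: measurable_funB.
    apply: (measurable_mx_coord (F := fun q : S * 'cV[R]_d => H q.1 (q.2 + n.+1%:R^-1 *: e))).
    apply: (measurableT_comp mH (g := fun q : S * 'cV[R]_d => (q.1, q.2 + n.+1%:R^-1 *: e))).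
    by apply: measurable_fun_pair => //; exact: measurable_mxD.
  exact: (measurable_mx_coord (F := fun q : S * 'cV[R]_d => H q.1 q.2)).
move=> [s z] _ /=.
have [dl Dl] := @is_derive_line _ _ z e (H s) i 0 (dH s _).
have l0 : line z e 0 = z by rewrite /line scale0r addr0.
have -> : jac (H s) z i j = (jac (H s) (line z e 0) *m e) i 0.
  rewrite l0 [RHS]mxE (bigD1 j)//= big1 ?addr0 => [|k kj]; rewrite !mxE ?eqxx ?mulr1//.
  by rewrite (negPf kj) mulr0.
rewrite -Dl; move: dl => /cvgr_dnbhsP /(_ (fun n => n.+1%:R^-1)) h.
have {}h := h (conj (fun n => invr_neq0 (lt0r_neq0 (ltr0Sn R n))) cvg_harmonic).
have -> : (fun n => Q n (s, z)) = (fun n => (n.+1%:R^-1)^-1 *: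
    (((fun t : R => H s (line z e t) i 0) \o shift 0) (n.+1%:R^-1 *: 1) -
      H s (line z e 0) i 0)).
  by apply/funext => n; rewrite /Q l0 /= invrK addr0 /line /GRing.scale/= mulr1.
exact: h.
Qed.

Section kernel_matrix.
Context {dT} {T : measurableType dT} {R : realType} (P : probability T R).
Context {d : nat} {dS} {S : measurableType dS} (V : T -> S).

Definition kexpM {m n} h (F : S * 'cV[R]_d -> 'M[R]_(m, n)) g : 'M[R]_(m, n) :=
  \matrix_(i, j) kexp P V h (fun q => F q i j) g.

End kernel_matrix.

Section measurable_cond_exp.
Context {dT} {T : measurableType dT} {R : realType} (P : probability T R).

(** Valid for a chosen version and for the default 0 alike; the replacement of versions inside L^p
    norms rests on it. *)
Lemma measurable_cond_exp {d'} {T' : measurableType d'} (F : T -> R) (W : T -> T') :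
  measurable_fun setT (cond_exp P F W).
Proof.
rewrite /cond_exp; have [[E hE]|no] := pselect (exists E, is_cond_exp P F W E).
  have [_ /measurable_int /measurable_EFinP] // :=
    @xgetPex _ (cst 0) [set E | is_cond_exp P F W E] (ex_intro _ E hE).
rewrite xgetPN// => E hE; by apply: no; exists E.
Qed.

Lemma measurable_cond_expM {d'} {T' : measurableType d'} m n
    (F : T -> 'M[R]_(m, n)) (W : T -> T') : measurable_fun setT (cond_expM P F W).
Proof.
apply: measurable_mx => // i j; under eq_fun do rewrite mxE.
exact: measurable_cond_exp.
Qed.

End measurable_cond_exp.

(** * Finiteness along almost every path *)

Section path_integrability.
Context {dT} {T : measurableType dT} {R : realType} (P : probability T R).
Context {d : nat} (Z : {RV P >-> 'cV[R]_d}).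
Hypothesis hZ : standard_gaussian P Z.
Context {dS} {S : measurableType dS} (V : T -> S).
Hypothesis mV : measurable_fun setT V.
Hypothesis indep : independent_RV P Z V.
Variables (hX hY : S -> 'cV[R]_d).
Hypotheses (mX : measurable_fun setT hX) (mY : measurable_fun setT hY).
Local Notation absF F := (fun q : S * 'cV[R]_d => (`|F q|)%:E).
Local Notation leb := (@lebesgue_measure R).
Local Notation hp := (hpath hX hY).
Local Notation I := (`[0%R, 1%R]%classic : set R).

Definition start w : 'cV[R]_d := Z w + hX (V w).

Lemma kpath_hpath t w : kpath Z V (hp t) w = start w + t *: hY (V w).
Proof. by rewrite /kpath /hpath addrA. Qed.

Lemma interpE t : interp (hX \o V) (hY \o V) Z t = kpath Z V (hp t).
Proof. by apply/funext => w; rewrite kpath_hpath. Qed.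

(* This averaged form of finiteness is all that [E|F(V, Z)| < +oo] provides, for
   almost every value of the base point [g0 = Z + X] and of the direction [y = Y]. *)
Definition pathfin (g0 y : 'cV[R]_d) (F : S * 'cV[R]_d -> R) :=
  measurable_fun setT F /\
  (\int[leb]_(t in I) kexpe P V (hp t) (absF F) (g0 + t *: y) < +oo)%E.

Let mjoint : measurable_fun setT (fun q : (R * T) * S => hp q.1.1 q.2).
Proof.
apply: measurable_mxD; first exact: measurableT_comp.
apply: measurable_mxZ; last exact: measurableT_comp.
by apply: measurableT_comp.
Qed.

Let mstart : measurable_fun setT (fun q : R * T => start q.2 + q.1 *: hY (V q.2)).
Proof.
apply: measurable_mxD.
  apply: measurable_mxD; first exact: measurableT_comp.
  by apply: (measurableT_comp mX); exact: measurableT_comp.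
apply: measurable_mxZ => //.
by apply: (measurableT_comp mY); exact: measurableT_comp.
Qed.

(** By Tonelli's theorem and the preservation of means, the expectation of the integral of K_t
    |F|(G_t) over t in [0, 1] is E|F(V, Z)|, which is finite. *)
Lemma ae_pathfin (F : S * 'cV[R]_d -> R) : measurable_fun setT F ->
  P.-integrable setT (fun w => (F (V w, Z w))%:E) ->
  {ae P, forall w, pathfin (start w) (hY (V w)) F}.
Proof.
move=> mF iF.
pose f (q : R * T) :=
  (kexpe P V (hp q.1) (absF F) (start q.2 + q.1 *: hY (V q.2))%R * (\1_I q.1)%:E)%E.
have maF : measurable_fun setT (absF F).
  by apply/measurable_EFinP; exact: measurableT_comp.
have mI : measurable I by exact: measurable_itv.
have mf : measurable_fun setT f.
  apply: emeasurable_funM; last first.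
    by apply/measurable_EFinP; apply: (measurableT_comp (measurable_indic mI)).
  by apply: (measurable_kexpe P mV (h := fun o : R * T => hp o.1)
    (g := fun q => start q.2 + q.1 *: hY (V q.2)) mjoint mstart maF) => q; rewrite lee_fin.
have f0 q : (0 <= f q)%E.
  by rewrite mule_ge0 ?lee_fin// kexpe_ge0//; exact: measurable_hpath.
have fE w : (\int[leb]_t f (t, w) =
    \int[leb]_(t in I) kexpe P V (hp t) (absF F) (start w + t *: hY (V w)))%E.
  rewrite [RHS]integral_mkcond; apply: eq_integral => t _; rewrite patchE /f /= indicE.
  by case: ifP; rewrite ?mule1 ?mule0.
have i1 : (\int[P]_w \int[leb]_t f (t, w) < +oo)%E.
  rewrite -(fubini_tonelli (m1 := leb) (m2 := P) f mf f0).
  apply: (@le_lt_trans _ _ (\int[leb]_(t in I) \int[P]_w `|F (V w, Z w)|%:E)%E).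
    rewrite [leRHS]integral_mkcond; apply: ge0_le_integral_nonmeasurable => t _.
      exact: integral_ge0.
    rewrite patchE; case: ifPn => It; last first.
      by rewrite integral0_eq// => w _; rewrite /f /= indicE (negPf It) mule0.
    rewrite -(ge0_integral_kexpeT hZ mV indep (measurable_hpath mX mY t) maF); last first.
      by move=> q; rewrite lee_fin.
    apply: ge0_le_integral_nonmeasurable => w _; first exact: f0.
    by rewrite /f /= indicE It mule1 kpath_hpath.
  rewrite integral_cst//.
  have /integrableP[_ iFlt] := iF; apply: lte_mul_pinfty => //.
  + exact: integral_ge0.
  + by rewrite ge0_fin_numE//; exact: integral_ge0.
  + by rewrite [X in (X < _)%E](lebesgue_measure_itv) /= lte_fin ltr01 sube0 ltry.
have mF1 : measurable_fun setT (fun w => \int[leb]_t f (t, w))%E.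
  exact: (measurable_fun_fubini_tonelli_G (m1 := leb) f mf f0).
have i2 : P.-integrable setT (fun w => \int[leb]_t f (t, w))%E.
  apply/integrableP; split => //.
  by under eq_integral do rewrite gee0_abs ?integral_ge0//.
have := integrable_ae measurableT i2; apply: filterS => w /(_ Logic.I) h.
by split => //; rewrite -fE -ge0_fin_numE// integral_ge0.
Qed.

Section closure.
Variables g0 y : 'cV[R]_d.

Let mkt F : measurable_fun setT F -> (forall q, 0 <= F q)%E ->
  measurable_fun I (fun t => kexpe P V (hp t) F (g0 + t *: y)).
Proof.
move=> mF F0; apply: measurable_funTS.
apply: (measurable_kexpe P mV (h := hp) (g := fun t => g0 + t *: y)) => //.
  exact: measurable_hpath_joint.
by apply: measurable_mxD => //; exact: measurable_mxZ.
Qed.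

(** Domination by a combination of two functions, from which the closure under sums, differences and
    multiples follows. *)
Lemma pathfin_le (F1 F2 F : S * 'cV[R]_d -> R) (k1 k2 : R) : 0 <= k1 -> 0 <= k2 ->
  pathfin g0 y F1 -> pathfin g0 y F2 -> measurable_fun setT F ->
  (forall q, `|F q| <= k1 * `|F1 q| + k2 * `|F2 q|) -> pathfin g0 y F.
Proof.
move=> k10 k20 h1 h2 mF le; split; first exact: mF.
have m1 := h1.1; have m2 := h2.1.
have ma (G : S * 'cV[R]_d -> R) : measurable_fun setT G -> measurable_fun setT (absF G).
  by move=> mG; apply/measurable_EFinP; exact: measurableT_comp.
have a0 (G : S * 'cV[R]_d -> R) q : (0 <= absF G q)%E by rewrite lee_fin.
have k0 (G : S * 'cV[R]_d -> R) t : (0 <= kexpe P V (hp t) (absF G) (g0 + t *: y))%E.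
  by apply: kexpe_ge0 => //; exact: measurable_hpath.
apply: (@le_lt_trans _ _ (\int[leb]_(t in I)
    (k1%:E * kexpe P V (hp t) (absF F1) (g0 + t *: y)%R +
     k2%:E * kexpe P V (hp t) (absF F2) (g0 + t *: y)%R))%E).
  apply: ge0_le_integral_nonmeasurable => t _; first exact: k0.
  have mht : measurable_fun setT (hp t) by exact: measurable_hpath.
  have mkw (G : S * 'cV[R]_d -> R) : measurable_fun setT G -> measurable_fun setT (fun w' =>
      (`|G (V w', g0 + t *: y - hp t (V w'))|%:E * (kwt P V (hp t) (g0 + t *: y) w')%:E)%E).
    move=> mG; apply: emeasurable_funM; last first.
      by apply/measurable_EFinP; exact: (measurable_kwt P mV).
    apply: (measurableT_comp (ma _ mG) (g := fun w' => (V w', g0 + t *: y - hp t (V w')))).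
    by apply: measurable_fun_pair => //; exact: (measurable_arg mV).
  have kw0 w : (0 <= (kwt P V (hp t) (g0 + t *: y) w)%:E)%E.
    by rewrite lee_fin ltW// (kwt_gt0 P mV).
  rewrite /kexpe -ge0_integralZl//; [|exact: mkw|by move=> w _; exact: mule_ge0].
  rewrite -ge0_integralZl//; [|exact: mkw|by move=> w _; exact: mule_ge0].
  rewrite -ge0_integralD//.
  - apply: ge0_le_integral_nonmeasurable => w _; first exact: mule_ge0.
    rewrite !muleA -ge0_muleDl ?mule_ge0// lee_wpmul2r//.
    by rewrite -!EFinM -EFinD lee_fin le.
  - by move=> w _; rewrite !mule_ge0.
  - by apply: measurable_funeM; exact: mkw.
  - by move=> w _; rewrite !mule_ge0.
  - by apply: measurable_funeM; exact: mkw.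
have mI : measurable I by exact: measurable_itv.
rewrite ge0_integralD//.
- rewrite ge0_integralZl//; [|exact: mkt (ma _ m1) _].
  rewrite ge0_integralZl//; [|exact: mkt (ma _ m2) _].
  by apply: lte_add_pinfty; apply: lte_mul_pinfty => //; [exact: h1.2|exact: h2.2].
- by move=> t _; rewrite mule_ge0.
- by apply: measurable_funeM; exact: mkt (ma _ m1) _.
- by move=> t _; rewrite mule_ge0.
- by apply: measurable_funeM; exact: mkt (ma _ m2) _.
Qed.

Lemma pathfinD F1 F2 : pathfin g0 y F1 -> pathfin g0 y F2 -> pathfin g0 y (F1 \+ F2).
Proof.
move=> h1 h2; apply: (pathfin_le ler01 ler01 h1 h2).
  by apply: measurable_funD; [have [] := h1|have [] := h2].
by move=> q; rewrite !mul1r ler_normD.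
Qed.

Lemma pathfinZ k F : pathfin g0 y F -> pathfin g0 y (fun q => k * F q).
Proof.
move=> h; apply: (pathfin_le (normr_ge0 k) (lexx 0) h h).
  by apply: measurable_funM => //; have [] := h.
by move=> q; rewrite mul0r addr0 normrM.
Qed.

Lemma pathfinB F1 F2 : pathfin g0 y F1 -> pathfin g0 y F2 -> pathfin g0 y (F1 \- F2).
Proof.
move=> h1 h2; apply: (pathfin_le ler01 ler01 h1 h2).
  by apply: measurable_funB; [have [] := h1|have [] := h2].
by move=> q; rewrite !mul1r ler_normB.
Qed.

Lemma pathfin_sum (J : Type) (r : seq J) (F : J -> S * 'cV[R]_d -> R) :
  (forall i, pathfin g0 y (F i)) -> pathfin g0 y (fun q => \sum_(i <- r) F i q).
Proof.
move=> hF; elim: r => [|i r IH].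
  have -> : (fun q : S * 'cV[R]_d => \sum_(i <- [::]) F i q) = cst 0.
    by apply/funext => q; rewrite big_nil.
  split; first exact: measurable_cst.
  rewrite integral0_eq ?ltry// => t _; rewrite /kexpe integral0_eq// => w _.
  by rewrite normr0; exact: mul0e.
have -> : (fun q => \sum_(i <- i :: r) F i q) = F i \+ (fun q => \sum_(i <- r) F i q).
  by apply/funext => q; rewrite big_cons.
by apply: pathfinD; [exact: hF|exact: IH].
Qed.

End closure.

End path_integrability.

(** Meant for an almost surely null Y: the shifts at times 0 and 1 then agree almost surely, and so
    do the kernels. *)
Lemma kexp_ae_eq {dT} {T : measurableType dT} {R : realType} (P : probability T R)
    {d} {dS} {S : measurableType dS} (V : T -> S) (h1 h2 : S -> 'cV[R]_d)
    (F : S * 'cV[R]_d -> R) g :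
  measurable_fun setT V -> measurable_fun setT h1 -> measurable_fun setT h2 ->
  measurable_fun setT F -> {ae P, forall w, h1 (V w) = h2 (V w)} ->
  kexp P V h1 F g = kexp P V h2 F g.
Proof.
move=> mV m1 m2 mF h12.
have kd : kden P V h1 g = kden P V h2 g.
  rewrite /kden; apply: (congr1 fine); apply: ae_eq_integral; first exact: measurableT.
  - by apply/measurable_EFinP; exact: measurable_kgker.
  - by apply/measurable_EFinP; exact: measurable_kgker.
  by apply: filterS h12 => w E _; rewrite E.
rewrite /kexp /Rintegral; apply: (congr1 fine); apply: ae_eq_integral; first exact: measurableT.
- by apply/measurable_EFinP; exact: (measurable_kintegrand P mV m1 mF).
- by apply/measurable_EFinP; exact: (measurable_kintegrand P mV m2 mF).
by apply: filterS h12 => w E _; rewrite /kwt kd E.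
Qed.

(** * The integral estimate *)

Section norm_pr_theory.
Context {dT} {T : measurableType dT} {R : realType} (P : probability T R).
Context {d : nat} (p r : \bar R).
Hypotheses (p1 : (1 <= p)%E) (r1 : (1 <= r)%E).

Lemma norm_pr_triangle (W1 W2 : T -> 'cV[R]_d) :
  measurable_fun setT W1 -> measurable_fun setT W2 ->
  (norm_pr P p r (fun w => (W1 w + W2 w)%R) <= norm_pr P p r W1 + norm_pr P p r W2)%E.
Proof.
move=> m1 m2; rewrite /norm_pr.
have n1 := measurable_lrnorm r m1; have n2 := measurable_lrnorm r m2.
apply: le_trans (eminkowski P n1 n2 p1).
apply: (@Lnorm_le_ae _ _ _ P p (fun w => lrnorm r (W1 w + W2 w))
  (fun w => lrnorm r (W1 w) + lrnorm r (W2 w))) => //.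
- by apply: measurable_lrnorm; exact: measurable_mxD.
- exact: measurable_funD.
by apply: aeW => w; rewrite !ger0_norm ?addr_ge0 ?lrnorm_ge0// ler_lrnormD.
Qed.

Lemma norm_pr_triangleB (W1 W2 : T -> 'cV[R]_d) :
  measurable_fun setT W1 -> measurable_fun setT W2 ->
  (norm_pr P p r (fun w => (W1 w - W2 w)%R) <= norm_pr P p r W1 + norm_pr P p r W2)%E.
Proof.
move=> m1 m2.
have -> : norm_pr P p r W2 = norm_pr P p r (fun w => - W2 w).
  by rewrite /norm_pr; under [RHS]eq_Lnorm do rewrite lrnormN//.
apply: norm_pr_triangle => //.
have -> : (fun w => - W2 w) = (fun w => 0 - W2 w) by apply/funext => w; rewrite sub0r.
exact: measurable_mxB.
Qed.

Lemma norm_pr_eq_ae (W1 W2 : T -> 'cV[R]_d) :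
  measurable_fun setT W1 -> measurable_fun setT W2 -> {ae P, forall w, W1 w = W2 w} ->
  norm_pr P p r W1 = norm_pr P p r W2.
Proof.
move=> m1 m2 h; apply: (@Lnorm_eq_ae _ _ _ P p (fun w => lrnorm r (W1 w))
  (fun w => lrnorm r (W2 w))) => //; [exact: measurable_lrnorm..|].
by apply: filterS h => w ->.
Qed.

(** The signs are those of [six_sum]. *)
Lemma norm_pr_six (W1 W2 W3 W4 W5 W6 : T -> 'cV[R]_d) :
  measurable_fun setT W1 -> measurable_fun setT W2 -> measurable_fun setT W3 ->
  measurable_fun setT W4 -> measurable_fun setT W5 -> measurable_fun setT W6 ->
  (norm_pr P p r (fun w => (W1 w - W2 w + W3 w - W4 w - W5 w + W6 w)%R) <=
   norm_pr P p r W1 + norm_pr P p r W2 + norm_pr P p r W3 + norm_pr P p r W4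
   + norm_pr P p r W5 + norm_pr P p r W6)%E.
Proof.
move=> m1 m2 m3 m4 m5 m6.
have m12 := measurable_mxB m1 m2; have m13 := measurable_mxD m12 m3.
have m14 := measurable_mxB m13 m4; have m15 := measurable_mxB m14 m5.
apply: le_trans (norm_pr_triangle m15 m6) _; apply: leeD; last by [].
apply: le_trans (norm_pr_triangleB m14 m5) _; apply: leeD; last by [].
apply: le_trans (norm_pr_triangleB m13 m4) _; apply: leeD; last by [].
apply: le_trans (norm_pr_triangle m12 m3) _; apply: leeD; last by [].
exact: norm_pr_triangleB.
Qed.

End norm_pr_theory.

(** * The derivative as a sum of six kernel averages *)

Section core.
Context {dT} {T : measurableType dT} {R : realType} (P : probability T R).
Context {d : nat} (Z : {RV P >-> 'cV[R]_d}).
Hypothesis hZ : standard_gaussian P Z.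
Context {dS} {S : measurableType dS} (V : T -> S).
Hypothesis mV : measurable_fun setT V.
Hypothesis indep : independent_RV P Z V.
Variables (hX hY : S -> 'cV[R]_d).
Hypotheses (mX : measurable_fun setT hX) (mY : measurable_fun setT hY).
Variable H : S -> 'cV[R]_d -> 'cV[R]_d.
Hypothesis mH : measurable_fun setT (fun q : S * 'cV[R]_d => H q.1 q.2).
Hypothesis cdH : forall s, continuously_differentiable (H s).
Local Notation absF F := (fun q : S * 'cV[R]_d => (`|F q|)%:E).
Local Notation leb := (@lebesgue_measure R).
Local Notation hp := (hpath hX hY).
Local Notation I := (`[0%R, 1%R]%classic : set R).

Let mI : measurable I. Proof. exact: measurable_itv. Qed.

Definition FH (q : S * 'cV[R]_d) : 'cV[R]_d := H q.1 q.2.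
Definition FJ (q : S * 'cV[R]_d) : 'M[R]_d := jac (H q.1) q.2.
Definition FJY (q : S * 'cV[R]_d) : 'cV[R]_d := FJ q *m hY q.1.
Definition FHZY (q : S * 'cV[R]_d) : 'cV[R]_d := dotv q.2 (hY q.1) *: FH q.
Definition FHZ (q : S * 'cV[R]_d) : 'M[R]_d := FH q *m q.2^T.
Definition FZY (q : S * 'cV[R]_d) : R := dotv (hY q.1) q.2.
Definition FZ (q : S * 'cV[R]_d) : 'cV[R]_d := q.2.

Lemma measurable_FH : measurable_fun setT FH. Proof. exact: mH. Qed.

Lemma measurable_FJ : measurable_fun setT FJ.
Proof. by apply: measurable_jac => // s z; have [] := cdH s. Qed.

Let mYq : measurable_fun setT (fun q : S * 'cV[R]_d => hY q.1).
Proof. exact: measurableT_comp. Qed.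

Lemma measurable_FJY : measurable_fun setT FJY.
Proof. by apply: measurable_mulmx => //; exact: measurable_FJ. Qed.

Lemma measurable_FHZY : measurable_fun setT FHZY.
Proof.
by apply: measurable_mxZ; [exact: measurable_dotv|exact: measurable_FH].
Qed.

Lemma measurable_FHZ : measurable_fun setT FHZ.
Proof.
apply: measurable_mulmx; first exact: measurable_FH.
apply: measurable_mx => // i j; under eq_fun do rewrite mxE.
exact: measurable_mx_coord.
Qed.

Lemma measurable_FZY : measurable_fun setT FZY.
Proof. exact: measurable_dotv. Qed.

Lemma measurable_FZ : measurable_fun setT FZ.
Proof. exact: measurable_snd. Qed.

(* The derivative at [t] of [kexpM P V (hp t) FH (g0 + t *: y)]; for [g0 = Z + X]
   and [y = Y] its summands are the integrands of [six_terms]. *)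
Definition six_sum (g0 y : 'cV[R]_d) (t : R) : 'cV[R]_d :=
  let g := g0 + t *: y in let K {m n} := @kexpM _ _ _ P _ _ _ V m n (hp t) in
  K FJ g *m y - K FJY g + K FHZY g - K FHZ g *m y
  - kexp P V (hp t) FZY g *: K FH g + dotv y (K FZ g) *: K FH g.

Definition gapK (g0 y : 'cV[R]_d) : 'cV[R]_d :=
  kexpM P V (hp 1) FH (g0 + 1 *: y) - kexpM P V (hp 0) FH (g0 + 0 *: y).

Section measurability_of_the_derivative.
Context {dO} {O : measurableType dO} (g0 y : O -> 'cV[R]_d) (t : O -> R).
Hypotheses (mg0 : measurable_fun setT g0) (my : measurable_fun setT y).
Hypothesis mt : measurable_fun setT t.

Lemma measurable_kexp_at (F : S * 'cV[R]_d -> R) : measurable_fun setT F ->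
  measurable_fun setT (fun o => kexp P V (hp (t o)) F (g0 o + t o *: y o)).
Proof.
apply: (measurable_kexp_joint P mV (h := fun o => hp (t o))
  (g := fun o => g0 o + t o *: y o)).
  apply: measurable_mxD; first exact: measurableT_comp.
  by apply: measurable_mxZ; exact: measurableT_comp.
by apply: measurable_mxD => //; exact: measurable_mxZ.
Qed.

Lemma measurable_kexpM_at {m n} (F : S * 'cV[R]_d -> 'M[R]_(m, n)) :
  measurable_fun setT F ->
  measurable_fun setT (fun o => kexpM P V (hp (t o)) F (g0 o + t o *: y o)).
Proof.
move=> mF; apply: measurable_mx => // i j; under eq_fun do rewrite mxE.
by apply: measurable_kexp_at; exact: measurable_mx_coord.
Qed.

Lemma measurable_six_sum : measurable_fun setT (fun o => six_sum (g0 o) (y o) (t o)).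
Proof.
have mKH := measurable_kexpM_at measurable_FH.
apply: measurable_mxD; last first.
  by apply: measurable_mxZ => //; apply: measurable_dotv => //;
    exact: (measurable_kexpM_at measurable_FZ).
apply: measurable_mxB; last first.
  by apply: measurable_mxZ => //; exact: (measurable_kexp_at measurable_FZY).
apply: measurable_mxB; last first.
  by apply: measurable_mulmx => //; exact: (measurable_kexpM_at measurable_FHZ).
apply: measurable_mxD; last exact: (measurable_kexpM_at measurable_FHZY).
apply: measurable_mxB; last exact: (measurable_kexpM_at measurable_FJY).
by apply: measurable_mulmx => //; exact: (measurable_kexpM_at measurable_FJ).
Qed.

End measurability_of_the_derivative.

Definition entriesQ (Q : (S * 'cV[R]_d -> R) -> Prop) {m n}
  (F : S * 'cV[R]_d -> 'M[R]_(m, n)) := forall i j, Q (fun q => F q i j).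

(** The list is shared by two finiteness conditions: [kfin] at one time, and [pathfin] along a whole
    path. *)
Definition all_terms (Q : (S * 'cV[R]_d -> R) -> Prop) :=
  [/\ entriesQ Q FJ, entriesQ Q FJY, entriesQ Q FHZ &
      [/\ entriesQ Q FHZY, entriesQ Q FZ & Q FZY]].

Lemma FderivE (y : 'cV[R]_d) i : Fderiv hY H y i =
  (fun q => \sum_j y j 0 * FJ q i j) \- (fun q => FJY q i 0)
  \- (fun q => \sum_j y j 0 * FHZ q i j) \+ (fun q => FHZY q i 0).
Proof.
apply/funext => q; rewrite /Fderiv /= mulmxBr mxE.
have -> : (jac (H q.1) q.2 *m y) i 0 = \sum_j y j 0 * FJ q i j.
  by rewrite mxE; apply: eq_bigr => j _; rewrite mulrC.
have -> : Fcoord H i q * Flin hY y q = \sum_j y j 0 * FHZ q i j - FHZY q i 0.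
  rewrite /Flin dotvBr mulrBr; congr (_ - _); last by rewrite /FHZY mxE mulrC.
  rewrite /dotv mulr_sumr; apply: eq_bigr => j _.
  by rewrite /FHZ mxE big_ord1 mxE [RHS]mulrC -mulrA.
have -> : (- (jac (H q.1) q.2 *m hY q.1)) i 0 = - FJY q i 0 by rewrite mxE.
by ring.
Qed.

Lemma FlinE (y : 'cV[R]_d) :
  Flin hY y = (fun q => \sum_j y j 0 * FZ q j 0) \- FZY.
Proof.
apply/funext => q; rewrite /Flin /= dotvBr [dotv q.2 y]dotvC.
by congr (_ - _); rewrite dotvC.
Qed.

Lemma psi_pathE (g0 y : 'cV[R]_d) t i :
  all_terms (kfin P V (hp t) (g0 + t *: y)) ->
  psi_path P V hX hY H g0 y i t = six_sum g0 y t i 0.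
Proof.
move=> [kJ kJY kHZ [kHZY kZ kZY]]; have mht := measurable_hpath mX mY t.
rewrite /psi_path FderivE FlinE.
have k1 : kfin P V (hp t) (g0 + t *: y) (fun q => \sum_j y j 0 * FJ q i j).
  by apply: kfin_sum => // j; exact: kfinZ.
have k2 : kfin P V (hp t) (g0 + t *: y) (fun q => \sum_j y j 0 * FHZ q i j).
  by apply: kfin_sum => // j; exact: kfinZ.
have k3 : kfin P V (hp t) (g0 + t *: y) (fun q => \sum_j y j 0 * FZ q j 0).
  by apply: kfin_sum => // j; exact: kfinZ.
have k4 : kfin P V (hp t) (g0 + t *: y) (fun q => FJY q i 0) by exact: kJY.
have k5 : kfin P V (hp t) (g0 + t *: y) (fun q => FHZY q i 0) by exact: kHZY.
have k12 := kfinB mV mht k1 k4; have k123 := kfinB mV mht k12 k2.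
rewrite (kexpD mV mht k123 k5) (kexpB mV mht k12 k2) (kexpB mV mht k1 k4).
rewrite (kexpB mV mht k3 kZY).
have sumE (G : 'I_d -> S * 'cV[R]_d -> R) :
    (forall j, kfin P V (hp t) (g0 + t *: y) (G j)) ->
    kexp P V (hp t) (fun q => \sum_j y j 0 * G j q) (g0 + t *: y) =
    \sum_j y j 0 * kexp P V (hp t) (G j) (g0 + t *: y).
  move=> kG; rewrite (kexp_sum mV mht) => [|j]; last exact: kfinZ.
  by apply: eq_bigr => j _; rewrite (kexpZ mV mht).
rewrite (sumE (fun j q => FJ q i j))// (sumE (fun j q => FHZ q i j))//.
rewrite (sumE (fun j q => FZ q j 0))//.
rewrite /six_sum; set g := g0 + t *: y.
have mulE (F : S * 'cV[R]_d -> 'M[R]_d) : (kexpM P V (hp t) F g *m y) i 0 =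
    \sum_j y j 0 * kexp P V (hp t) (fun q => F q i j) g.
  by rewrite mxE; apply: eq_bigr => j _; rewrite mxE mulrC.
have dotE : dotv y (kexpM P V (hp t) FZ g) =
    \sum_j y j 0 * kexp P V (hp t) (fun q => FZ q j 0) g.
  by apply: eq_bigr => j _; rewrite mxE.
rewrite -(mulE FJ) -(mulE FHZ) -dotE.
have -> (A B C D E F : 'cV[R]_d) : (A - B + C - D - E + F) i 0 =
  A i 0 - B i 0 + C i 0 - D i 0 - E i 0 + F i 0 by rewrite !mxE.
rewrite [kexpM P V (hp t) FJY g i 0]mxE [kexpM P V (hp t) FHZY g i 0]mxE.
rewrite ![(_ *: kexpM P V (hp t) FH g) i 0]mxE ![kexpM P V (hp t) FH g i 0]mxE.
set kH := kexp P V (hp t) (fun q => FH q i 0) g.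
by ring.
Qed.

Hypothesis iY : forall j, P.-integrable setT (fun w => (hY (V w) j 0)%:E).

Lemma ae_leb_kfin g0 y : all_terms (pathfin P V hX hY g0 y) ->
  {ae leb, forall t, I t -> all_terms (kfin P V (hp t) (g0 + t *: y))}.
Proof.
move=> [fJ fJY fHZ [fHZY fZ fZY]].
have aeF := ae_filter_ringOfSetsType leb.
have one F : pathfin P V hX hY g0 y F ->
    {ae leb, forall t, I t -> kfin P V (hp t) (g0 + t *: y) F}.
  by move=> [mF fF]; exact: (path_ae_kfin mV mX mY mF fF).
have many m n (F : S * 'cV[R]_d -> 'M[R]_(m, n)) :
    entriesQ (pathfin P V hX hY g0 y) F ->
    {ae leb, forall t, I t -> entriesQ (kfin P V (hp t) (g0 + t *: y)) F}.
  move=> fF; have h i j := one _ (fF i j).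
  have := @filter_forall _ _ _ _ aeF (fun i => @filter_forall _ _ _ _ aeF (h i)).
  by apply: (@filterS _ _ aeF) => t ht It i j; exact: ht.
have h1 := @filterI _ _ aeF _ _ (many _ _ _ fJ) (many _ _ _ fJY).
have h2 := @filterI _ _ aeF _ _ (many _ _ _ fHZ) (many _ _ _ fHZY).
have h3 := @filterI _ _ aeF _ _ (many _ _ _ fZ) (one _ fZY).
have := @filterI _ _ aeF _ _ h1 (@filterI _ _ aeF _ _ h2 h3).
apply: (@filterS _ _ aeF) => t [[k1 k2] [[k3 k4] [k5 k6]]] It.
by split; [exact: k1|exact: k2|exact: k3|split; [exact: k4|exact: k5|exact: k6]].
Qed.

(** The coordinatewise formula for the increment is tested against a norming vector u of the gap:
    the norm becomes the integral of <psi, u>, where <psi, u> <= |psi|_r. No vector-valued integral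
    occurs. *)
Lemma pathwise_gap_le r g0 y : (1 <= r)%E ->
  all_terms (pathfin P V hX hY g0 y) -> entriesQ (pathfin P V hX hY g0 y) FH ->
  (forall t, t = 0 \/ t = 1 -> entriesQ (kfin P V (hp t) (g0 + t *: y)) FH) ->
  ((lrnorm r (gapK g0 y))%:E <=
   \int[leb]_(t in I) (lrnorm r (six_sum g0 y t))%:E)%E.
Proof.
move=> r1 [fJ fJY fHZ [fHZY fZ fZY]] fH kH01.
have mJ := measurable_FJ.
have fD i : pathfin P V hX hY g0 y (Fderiv hY H y i).
  rewrite FderivE; apply: (pathfinD mV mX mY _ (fHZY i 0)).
  apply: (pathfinB mV mX mY).
    apply: (pathfinB mV mX mY _ (fJY i 0)).
    by apply: (pathfin_sum mV mX mY) => j; apply: (pathfinZ mV mX mY); exact: fJ.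
  by apply: (pathfin_sum mV mX mY) => j; apply: (pathfinZ mV mX mY); exact: fHZ.
have fC i : pathfin P V hX hY g0 y (Fcoord H i) by exact: (fH i 0).
have fC01 i t : t = 0 \/ t = 1 -> kfin P V (hp t) (g0 + t *: y) (Fcoord H i).
  by move=> t01; exact: (kH01 t t01 i 0).
have ipsi i := integrable_psi_path mV mX mY iY mH mJ (fD i).2 (fC i).2.
have ftc i := kexp_path_FTC mV mX mY iY mH mJ cdH (fD i).2 (fC i).2 (fC01 i).
pose psiv t : 'cV[R]_d := \col_i psi_path P V hX hY H g0 y i t.
have psivE t i : psiv t i 0 = psi_path P V hX hY H g0 y i t by rewrite mxE.
have gapE i : gapK g0 y i 0 = kexp P V (hp 1) (Fcoord H i) (g0 + 1 *: y) -
    kexp P V (hp 0) (Fcoord H i) (g0 + 0 *: y) by rewrite !mxE.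
have psiv6 : {ae leb, forall t, I t -> psiv t = six_sum g0 y t}.
  have aeF := ae_filter_ringOfSetsType leb.
  have := ae_leb_kfin (And4 fJ fJY fHZ (And3 fHZY fZ fZY)).
  apply: (@filterS _ _ aeF) => t kt It; apply/matrixP => i j.
  by rewrite ord1 mxE psi_pathE//; exact: kt.
have [u <- hu] := lrnorm_dual (gapK g0 y) r1.
have -> : ((dotv (gapK g0 y) u)%:E = \int[leb]_(t in I) (dotv (psiv t) u)%:E)%E.
  rewrite /dotv -sumEFin.
  under [RHS]eq_integral do rewrite -sumEFin.
  rewrite integral_sum//; last first.
    move=> i.
    have -> : (fun t => (psiv t i 0 * u i 0)%:E) =
        (fun t => (psi_path P V hX hY H g0 y i t)%:E * (u i 0)%:E)%E.
      by apply/funext => t; rewrite psivE EFinM.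
    by apply: integrableZr => //; exact: ipsi.
  apply: eq_bigr => i _; rewrite gapE EFinM.
  rewrite [X in (X * _)%E]ftc -integralZr//; last exact: ipsi.
  by apply: eq_integral => t _; rewrite psivE EFinM.
have mpsiv : measurable_fun setT psiv.
  apply: measurable_mx => // i j; under eq_fun do rewrite mxE.
  exact: (measurable_psi_path _ mV mX mY mH mJ).
apply: le_trans (lee_abs _) _; apply: le_trans (le_abse_integral _ _ _) _ => //.
  by apply: measurable_funTS; apply/measurable_EFinP; exact: measurable_dotv.
apply: (@le_trans _ _ (\int[leb]_(t in I) (lrnorm r (psiv t))%:E)%E).
  apply: ge0_le_integral_nonmeasurable => t _; first exact: abse_ge0.
  rewrite abse_EFin lee_fin ler_norml hu andbT lerNl -dotvNl.
  by apply: le_trans (hu _) _; rewrite lrnormN.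
rewrite le_eqVlt; apply/orP; left; apply/eqP; apply: ae_eq_integral => //.
- by apply: measurable_funTS; apply/measurable_EFinP; exact: measurable_lrnorm.
- apply: measurable_funTS; apply/measurable_EFinP; apply: measurable_lrnorm.
  exact: (measurable_six_sum (g0 := fun=> g0) (y := fun=> y) (t := id)).
have aeF := ae_filter_ringOfSetsType leb.
by move: psiv6; apply: (@filterS _ _ aeF) => t h It; rewrite h.
Qed.

Section integral_bound.
Variables (p r : \bar R).
Hypotheses (p1 : (1 <= p)%E) (r1 : (1 <= r)%E).

Definition at_VZ {m n} (F : S * 'cV[R]_d -> 'M[R]_(m, n)) w := F (V w, Z w).

Hypotheses (iH : integrableM P (at_VZ FH)) (iJ : integrableM P (at_VZ FJ))
  (iJY : integrableM P (at_VZ FJY)) (iHZY : integrableM P (at_VZ FHZY))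
  (iHZ : integrableM P (at_VZ FHZ)) (iZ : integrableM P (at_VZ FZ))
  (iZY : P.-integrable setT (fun w => (FZY (V w, Z w))%:E)).

Let mVZ : measurable_fun setT (fun w => (V w, Z w)).
Proof. exact: measurable_fun_pair. Qed.

Lemma ae_entries {m n} (Q : T -> (S * 'cV[R]_d -> R) -> Prop)
    (F : S * 'cV[R]_d -> 'M[R]_(m, n)) :
  (forall i j, {ae P, forall w, Q w (fun q => F q i j)}) ->
  {ae P, forall w, entriesQ (Q w) F}.
Proof.
move=> h; have aeF := ae_filter_ringOfSetsType P.
exact: (@filter_forall _ _ _ _ aeF (fun i => @filter_forall _ _ _ _ aeF (h i))).
Qed.

Lemma ae_kfin t (F : S * 'cV[R]_d -> R) : measurable_fun setT F ->
  P.-integrable setT (fun w => (F (V w, Z w))%:E) ->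
  {ae P, forall w, kfin P V (hp t) (start Z V hX w + t *: hY (V w)) F}.
Proof.
move=> mF iF; have mht := measurable_hpath mX mY t.
have := ae_kintegrable hZ mV indep mht mF iF; apply: filterS => w iw.
by apply: (kfinP mV mht mF); rewrite -kpath_hpath.
Qed.

Lemma ae_cond_expM {m n} t (F : S * 'cV[R]_d -> 'M[R]_(m, n)) :
  measurable_fun setT F -> integrableM P (at_VZ F) ->
  {ae P, forall w, cond_expM P (at_VZ F) (interp (hX \o V) (hY \o V) Z t) w =
    kexpM P V (hp t) F (start Z V hX w + t *: hY (V w))}.
Proof.
move=> mF iF; have mht := measurable_hpath mX mY t.
have aeF := ae_filter_ringOfSetsType P.
have h i j : {ae P, forall w,
    cond_exp P (fun w => at_VZ F w i j) (interp (hX \o V) (hY \o V) Z t) w =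
    kexp P V (hp t) (fun q => F q i j) (start Z V hX w + t *: hY (V w))}.
  rewrite interpE; have := cond_exp_kexp hZ mV indep mht (measurable_mx_coord i j mF) (iF i j).
  by apply: filterS => w E; rewrite -kpath_hpath; exact: E.
have := @filter_forall _ _ _ _ aeF (fun i => @filter_forall _ _ _ _ aeF (h i)).
by apply: (@filterS _ _ aeF) => w hw; apply/matrixP => i j; rewrite !mxE; exact: hw.
Qed.

(** The pathwise bound holds for almost every base point Z + X and direction Y; the end points t = 0
    and t = 1 contribute almost sure events of their own. *)
Lemma ae_gap_le : {ae P, forall w,
  ((lrnorm r (gapK (start Z V hX w) (hY (V w))))%:E <=
   \int[leb]_(t in I) (lrnorm r (six_sum (start Z V hX w) (hY (V w)) t))%:E)%E}.
Proof.
have aeF := ae_filter_ringOfSetsType P.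
pose Q w := pathfin P V hX hY (start Z V hX w) (hY (V w)).
have many m n (F : S * 'cV[R]_d -> 'M[R]_(m, n)) : measurable_fun setT F ->
    integrableM P (at_VZ F) -> {ae P, forall w, entriesQ (Q w) F}.
  move=> mF iF; apply: ae_entries => i j.
  exact: (ae_pathfin hZ mV indep mX mY (measurable_mx_coord i j mF) (iF i j)).
have k01 t : {ae P, forall w,
    entriesQ (kfin P V (hp t) (start Z V hX w + t *: hY (V w))) FH}.
  apply: (ae_entries (Q := fun w => kfin P V (hp t) (start Z V hX w + t *: hY (V w)))) => i j.
  by apply: ae_kfin; [exact: measurable_mx_coord measurable_FH|exact: iH].
have h1 := @filterI _ _ aeF _ _ (many _ _ _ measurable_FJ iJ) (many _ _ _ measurable_FJY iJY).
have h2 := @filterI _ _ aeF _ _ (many _ _ _ measurable_FHZ iHZ) (many _ _ _ measurable_FHZY iHZY).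
have h3 := @filterI _ _ aeF _ _ (many _ _ _ measurable_FZ iZ)
  (ae_pathfin hZ mV indep mX mY measurable_FZY iZY).
have h4 := @filterI _ _ aeF _ _ (k01 0) (k01 1).
have := @filterI _ _ aeF _ _ (@filterI _ _ aeF _ _ h1 h2) (@filterI _ _ aeF _ _ h3
  (@filterI _ _ aeF _ _ h4 (many _ _ _ measurable_FH iH))).
apply: (@filterS _ _ aeF) => w [[[fJ fJY] [fHZ fHZY]] [[fZ fZY] [[k0 k1] fH]]].
apply: (pathwise_gap_le r1 (And4 fJ fJY fHZ (And3 fHZY fZ fZY)) fH).
by move=> t [->|->]; [exact: k0|exact: k1].
Qed.

Let mhX : measurable_fun setT (hX \o V). Proof. exact: measurableT_comp. Qed.
Let mhY : measurable_fun setT (hY \o V). Proof. exact: measurableT_comp. Qed.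
Let mst : measurable_fun setT (start Z V hX). Proof. exact: measurable_mxD. Qed.

Local Notation X := (hX \o V).
Local Notation Y := (hY \o V).
Local Notation KM t F := (fun w => kexpM P V (hp t) F (start Z V hX w + t *: hY (V w))).

Let mKM t {m n} (F : S * 'cV[R]_d -> 'M[R]_(m, n)) : measurable_fun setT F ->
  measurable_fun setT (KM t F).
Proof. exact: (measurable_kexpM_at mst mhY (t := fun=> t)). Qed.

Let mKs t : measurable_fun setT
  (fun w => kexp P V (hp t) FZY (start Z V hX w + t *: hY (V w))).
Proof. exact: (measurable_kexp_at mst mhY (t := fun=> t) _ measurable_FZY). Qed.

Lemma ae_cond_exp_FZY t : {ae P, forall w,
  cond_exp P (fun w' => dotv (Y w') (Z w')) (interp X Y Z t) w =
  kexp P V (hp t) FZY (start Z V hX w + t *: hY (V w))}.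
Proof.
have mht := measurable_hpath mX mY t.
rewrite interpE; have := cond_exp_kexp hZ mV indep mht measurable_FZY iZY.
by apply: filterS => w E; rewrite -kpath_hpath; exact: E.
Qed.

(** At fixed t each conditional expectation agrees almost surely with its kernel version. The
    exceptional set depends on t, which is harmless since an L^p norm is taken at each t
    separately. *)
Lemma norm_six_sum_le t :
  (norm_pr P p r (fun w => six_sum (start Z V hX w) (hY (V w)) t) <=
   six_terms P p r X Y Z (at_VZ FH) (at_VZ FJ) t)%E.
Proof.
have mKH := mKM t measurable_FH; have mKJ := mKM t measurable_FJ.
have mKJY := mKM t measurable_FJY; have mKHZY := mKM t measurable_FHZY.
have mKHZ := mKM t measurable_FHZ; have mKZ := mKM t measurable_FZ.
have m1 : measurable_fun setT (fun w => KM t FJ w *m Y w) by exact: measurable_mulmx.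
have m4 : measurable_fun setT (fun w => KM t FHZ w *m Y w) by exact: measurable_mulmx.
have m5 : measurable_fun setT (fun w => kexp P V (hp t) FZY
    (start Z V hX w + t *: hY (V w)) *: KM t FH w) by exact: measurable_mxZ.
have m6 : measurable_fun setT (fun w => dotv (Y w) (KM t FZ w) *: KM t FH w).
  by apply: measurable_mxZ => //; exact: measurable_dotv.
have aJ := ae_cond_expM t measurable_FJ iJ.
have aJY := ae_cond_expM t measurable_FJY iJY.
have aHZY := ae_cond_expM t measurable_FHZY iHZY.
have aHZ := ae_cond_expM t measurable_FHZ iHZ.
have aH := ae_cond_expM t measurable_FH iH.
have aZ := ae_cond_expM t measurable_FZ iZ.
have mcM m n (F : T -> 'M[R]_(m, n)) :
    measurable_fun setT (cond_expM P F (interp X Y Z t)) by exact: measurable_cond_expM.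
rewrite /six_terms.
have -> : norm_pr P p r (fun w => cond_expM P (at_VZ FJ) (interp X Y Z t) w *m Y w) =
    norm_pr P p r (fun w => KM t FJ w *m Y w).
  apply: (norm_pr_eq_ae r p1) => //; first exact: measurable_mulmx.
  by apply: filterS aJ => w ->.
have -> : norm_pr P p r (cond_expM P (fun w => at_VZ FJ w *m Y w) (interp X Y Z t)) =
    norm_pr P p r (KM t FJY) by exact: (norm_pr_eq_ae r p1).
have -> : norm_pr P p r (cond_expM P (fun w => dotv (Z w) (Y w) *: at_VZ FH w)
      (interp X Y Z t)) = norm_pr P p r (KM t FHZY) by exact: (norm_pr_eq_ae r p1).
have -> : norm_pr P p r (fun w => cond_expM P (fun w' => at_VZ FH w' *m (Z w')^T)
      (interp X Y Z t) w *m Y w) = norm_pr P p r (fun w => KM t FHZ w *m Y w).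
  apply: (norm_pr_eq_ae r p1) => //; first exact: measurable_mulmx.
  by apply: filterS aHZ => w <-.
have -> : norm_pr P p r (fun w => cond_exp P (fun w' => dotv (Y w') (Z w'))
      (interp X Y Z t) w *: cond_expM P (at_VZ FH) (interp X Y Z t) w) =
    norm_pr P p r (fun w => kexp P V (hp t) FZY
      (start Z V hX w + t *: hY (V w)) *: KM t FH w).
  apply: (norm_pr_eq_ae r p1) => //.
    by apply: measurable_mxZ => //; exact: measurable_cond_exp.
  by apply: filterS2 aH (ae_cond_exp_FZY t) => w -> ->.
have -> : norm_pr P p r (fun w => dotv (Y w) (cond_expM P Z (interp X Y Z t) w)
      *: cond_expM P (at_VZ FH) (interp X Y Z t) w) =
    norm_pr P p r (fun w => dotv (Y w) (KM t FZ w) *: KM t FH w).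
  apply: (norm_pr_eq_ae r p1) => //.
    by apply: measurable_mxZ => //; exact: measurable_dotv.
  by apply: filterS2 aH aZ => w -> <-.
exact: (norm_pr_six P p1 r1 m1 mKJY mKHZY m4 m5 m6).
Qed.

Lemma measurable_gapK : measurable_fun setT (fun w => gapK (start Z V hX w) (hY (V w))).
Proof. by apply: measurable_mxB; exact: mKM measurable_FH. Qed.

Lemma cond_exp_gapE : cond_exp_gap P p r X Y Z (at_VZ FH) =
  norm_pr P p r (fun w => gapK (start Z V hX w) (hY (V w))).
Proof.
apply: (norm_pr_eq_ae r p1); first by apply: measurable_mxB; exact: measurable_cond_expM.
  exact: measurable_gapK.
have E1 : (fun w => Z w + X w + Y w) = interp X Y Z 1.
  by apply/funext => w; rewrite /interp scale1r.
have E0 : (fun w => Z w + X w) = interp X Y Z 0.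
  by apply/funext => w; rewrite /interp scale0r addr0.
rewrite E1 E0.
by apply: filterS2 (ae_cond_expM 1 measurable_FH iH) (ae_cond_expM 0 measurable_FH iH)
  => w -> ->.
Qed.

(** The majorant [N] is left free to serve both estimates: it is [six_terms] for the first one and
    an affine function of t for the second. *)
Lemma core_integral_estimate (N : R -> \bar R) :
  (forall t, (0 <= t <= 1)%R ->
    norm_pr P p r (fun w => six_sum (start Z V hX w) (hY (V w)) t) <= N t)%E ->
  (cond_exp_gap P p r X Y Z (at_VZ FH) <= \int[leb]_(t in I) N t)%E.
Proof.
move=> hN; rewrite cond_exp_gapE.
apply: (@minkowski_integral _ _ _ P
  (fun t w => lrnorm r (six_sum (start Z V hX w) (hY (V w)) t)) N
  (fun w => lrnorm r (gapK (start Z V hX w) (hY (V w))))) => //.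
- apply: measurable_lrnorm.
  apply: (measurable_six_sum (g0 := fun q : R * T => start Z V hX q.2)
    (y := fun q => hY (V q.2)) (t := fst)) => //.
  + exact: measurableT_comp.
  + by apply: (measurableT_comp mY); exact: measurableT_comp.
- by move=> t w; exact: lrnorm_ge0.
- by apply: measurable_lrnorm; exact: measurable_gapK.
- by move=> w; exact: lrnorm_ge0.
- exact: ae_gap_le.
Qed.

End integral_bound.

End core.

(** * Moment bounds *)

Section measurable_opnorm.
Context {R : realType} {d : nat} (rho r : \bar R).
Hypotheses (rho1 : (1 <= rho)%E) (r1 : (1 <= r)%E).
Implicit Types A B : 'M[R]_d.

Lemma opnorm_triangle A B : opnorm rho r (A + B) <= opnorm rho r A + opnorm rho r B.
Proof.
apply: opnorm_le => // [u|]; last by rewrite addr_ge0 ?opnorm_ge0.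
rewrite mulmxDl (le_trans (ler_lrnormD _ _ r1))// mulrDl lerD//; exact: opnormP.
Qed.

Lemma opnorm_le_sum A : opnorm rho r A <= \sum_i \sum_j `|A i j|.
Proof.
apply: opnorm_le => // [u|]; last by apply: sumr_ge0 => i _; exact: sumr_ge0.
apply: le_trans (lrnorm_le_sum _ r1) _; rewrite mulr_suml; apply: ler_sum => i _.
rewrite mxE (le_trans (ler_norm_sum _ _ _))// mulr_suml; apply: ler_sum => j _.
by rewrite normrM ler_wpM2l// lrnorm_coord.
Qed.

Lemma ler_opnorm_dist A B :
  `|opnorm rho r A - opnorm rho r B| <= \sum_i \sum_j `|A i j - B i j|.
Proof.
have h A' B' : opnorm rho r A' - opnorm rho r B' <= \sum_i \sum_j `|A' i j - B' i j|.
  rewrite lerBlDl -{1}(subrK B' A') addrC (le_trans (opnorm_triangle _ _))// lerD2l.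
  rewrite (le_trans (opnorm_le_sum _))//; apply: ler_sum => i _; apply: ler_sum => j _.
  by rewrite !mxE.
rewrite ler_norml h andbT lerNl opprB (le_trans (h _ _))//.
by apply: ler_sum => i _; apply: ler_sum => j _; rewrite distrC.
Qed.

(* Rounding the entries makes [A] countably valued, so no topology on matrices
   is needed. *)
Lemma measurable_opnorm {dT} {T : measurableType dT} (A : T -> 'M[R]_d) :
  measurable_fun setT A -> measurable_fun setT (fun w => opnorm rho r (A w)).
Proof.
move=> mA.
pose Ai (n : nat) w : 'M[int]_d := \matrix_(i, j) Num.floor (n.+1%:R * A w i j).
pose An n (B : 'M[int]_d) : 'M[R]_d := \matrix_(i, j) ((B i j)%:~R / n.+1%:R).
apply: (@measurable_fun_cvg _ _ _ _ (fun n w => opnorm rho r (An n (Ai n w)))).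
  move=> n _ Y mY; rewrite setTI.
  have mB (B : 'M[int]_d) : measurable [set w | Ai n w = B].
    have -> : [set w | Ai n w = B] =
        \bigcap_(ij in [set: 'I_d * 'I_d]) [set w | Num.floor
          (n.+1%:R * A w ij.1 ij.2) = B ij.1 ij.2].
      apply/seteqP; split => [w /= <- [i j] _ /=|w /= h]; first by rewrite mxE.
      by apply/matrixP => i j; rewrite mxE; exact: (h (i, j) I).
    apply: fin_bigcap_measurable => // -[i j] _ /=.
    have mAij : measurable_fun setT (fun w => n.+1%:R * A w i j).
      by apply: measurable_funM => //; exact: measurable_mx_coord.
    have -> : [set w | Num.floor (n.+1%:R * A w i j) = B i j] =
        (fun w => n.+1%:R * A w i j) @^-1` `[(B i j)%:~R, (B i j + 1)%:~R[%classic.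
      apply/seteqP; split => w /=; rewrite in_itv/=.
        by move=> <-; rewrite floor_le_tmp floorD1_gt.
      by move=> h; apply: floor_def.
    by rewrite -[X in measurable X]setTI; exact: mAij.
  have -> : (fun w => opnorm rho r (An n (Ai n w))) @^-1` Y =
      \bigcup_B [set w | Ai n w = B /\ Y (opnorm rho r (An n B))].
    apply/seteqP; split => w /=; first by move=> Yw; exists (Ai n w).
    by move=> [B _ [/= -> YB]].
  apply: countable_bigcupT_measurable => [|B]; first exact: countableP.
  have [YB|nYB] := pselect (Y (opnorm rho r (An n B))).
    rewrite [X in measurable X](_ : _ = [set w | Ai n w = B]); first exact: mB.
    by apply/seteqP; split => w /=; [case|].
  rewrite [X in measurable X](_ : _ = set0); first exact: measurable0.
  by apply/seteqP; split => // w [].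
move=> w _; apply/cvgrPdist_le => e e0.
(* Each of the d * d entries is rounded down by at most 1/(n+1), and [opnorm] is Lipschitz for the
   sum of the absolute values of the entries. *)
have c0 : (fun n => (d * d)%:R * n.+1%:R^-1 : R) @ \oo --> (0 : R).
  by rewrite -(mulr0 (d * d)%:R); apply: cvgMl_tmp; exact: cvg_harmonic.
move/cvgr0Pnorm_le : c0 => /(_ e e0); apply: filterS => n hn.
apply: le_trans (le_trans (ler_norm _) hn).
apply: le_trans (ler_opnorm_dist _ _) _.
apply: (@le_trans _ _ (\sum_(i < d) \sum_(j < d) n.+1%:R^-1)); last first.
  by rewrite !sumr_const !card_ord -mulrnA mulr_natl.
apply: ler_sum => i _; apply: ler_sum => j _; rewrite !mxE.
rewrite -[X in X - _](mulKf (lt0r_neq0 (ltr0Sn R n))) [X in `|X - _|]mulrC -mulrBl.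
rewrite normrM [X in _ * X]ger0_norm ?invr_ge0// ler_piMl ?invr_ge0//.
rewrite ger0_norm ?subr_ge0 ?floor_le_tmp//.
by rewrite lerBlDl -intrD1 ltW// floorD1_gt.
Qed.

End measurable_opnorm.

(** * Inequalities for kernel averages at a fixed point *)

Section kernel_norm_bounds.
Context {dT} {T : measurableType dT} {R : realType} (P : probability T R).
Context {d : nat} {dS} {S : measurableType dS} (V : T -> S).
Hypothesis mV : measurable_fun setT V.
Variables (h : S -> 'cV[R]_d) (g : 'cV[R]_d).
Hypothesis mh : measurable_fun setT h.
Local Notation K := (kexp P V h).

(** The comparison is made only where the kernel evaluates its functions, at z = g - h(s). There <z,
    y> can be expressed by g, X' and Y'. *)
Lemma kexp_le_at (F1 F2 : S * 'cV[R]_d -> R) : kfin P V h g F1 -> kfin P V h g F2 ->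
  (forall s, F1 (s, g - h s) <= F2 (s, g - h s)) -> K F1 g <= K F2 g.
Proof.
move=> h1 h2 le; apply: le_Rintegral => //; [exact: kfin_integrable..|].
by move=> w _; rewrite ler_wpM2r ?le// ltW// (kwt_gt0 P mV).
Qed.

Lemma kfin_cst (k : R) : kfin P V h g (cst k).
Proof.
apply: (kfinP mV mh); first exact: measurable_cst.
under eq_fun do rewrite EFinM.
apply: integrableZl => //; apply/integrableP; split.
  by apply/measurable_EFinP; exact: (measurable_kwt P mV).
under eq_integral do rewrite gee0_abs ?lee_fin ?(ltW (kwt_gt0 P mV _ _ mh))//.
by rewrite (integral_kwt P mV)// ltry.
Qed.

Lemma kexp_cst (k : R) : K (cst k) g = k.
Proof.
have h1 := kfin_integrable mV mh (kfin_cst 1).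
rewrite (_ : cst k = fun q => k * cst 1 q); last by apply/funext => q; rewrite /= mulr1.
rewrite (kexpZ mV mh _ (kfin_cst 1)) /kexp.
have -> : (\int[P]_w' (cst 1 (V w', g - h (V w')) * kwt P V h g w') = 1)%R.
  rewrite /Rintegral; under eq_integral do rewrite /= mul1r.
  by rewrite (integral_kwt P mV).
by rewrite mulr1.
Qed.

Lemma kexp_ge0 (F : S * 'cV[R]_d -> R) : (forall q, 0 <= F q) -> 0 <= K F g.
Proof.
by move=> F0; apply: Rintegral_ge0 => w _; rewrite mulr_ge0// ltW// (kwt_gt0 P mV).
Qed.

Lemma kfin_dotv (W : S * 'cV[R]_d -> 'cV[R]_d) u :
  entriesQ (kfin P V h g) W -> kfin P V h g (fun q => dotv (W q) u).
Proof.
move=> kW; have -> : (fun q => dotv (W q) u) = (fun q => \sum_i u i 0 * W q i 0).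
  by apply/funext => q; apply: eq_bigr => i _; rewrite mulrC.
by apply: kfin_sum => // i; apply: kfinZ => //; exact: kW.
Qed.

Lemma kexp_dotv (W : S * 'cV[R]_d -> 'cV[R]_d) u : entriesQ (kfin P V h g) W ->
  K (fun q => dotv (W q) u) g = dotv (kexpM P V h W g) u.
Proof.
move=> kW; have -> : (fun q => dotv (W q) u) = (fun q => \sum_i u i 0 * W q i 0).
  by apply/funext => q; apply: eq_bigr => i _; rewrite mulrC.
rewrite (kexp_sum mV mh) => [|i]; last by apply: kfinZ => //; exact: kW.
apply: eq_bigr => i _; rewrite (kexpZ mV mh); last exact: kW.
by rewrite mulrC mxE.
Qed.

(** Jensen's inequality for the norm, through a norming vector of the average. *)
Lemma lrnorm_kexpM_le r (W : S * 'cV[R]_d -> 'cV[R]_d) F : (1 <= r)%E ->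
  entriesQ (kfin P V h g) W -> kfin P V h g F ->
  (forall s, lrnorm r (W (s, g - h s)) <= F (s, g - h s)) ->
  lrnorm r (kexpM P V h W g) <= K F g.
Proof.
move=> r1 kW kF le; have [u <- hu] := lrnorm_dual (kexpM P V h W g) r1.
rewrite -kexp_dotv//; apply: kexp_le_at => // [|s]; first exact: kfin_dotv.
exact: le_trans (hu _) (le s).
Qed.

Lemma kexpM_mulmx (W : S * 'cV[R]_d -> 'M[R]_d) (y : 'cV[R]_d) : entriesQ (kfin P V h g) W ->
  entriesQ (kfin P V h g) (fun q => W q *m y) /\
  kexpM P V h W g *m y = kexpM P V h (fun q => W q *m y) g.
Proof.
move=> kW.
have E i j : (fun q => (W q *m y) i j) = (fun q => \sum_k y k j * W q i k).
  by apply/funext => q; rewrite mxE; apply: eq_bigr => k _; rewrite mulrC.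
split=> [i j|]; first by rewrite E; apply: kfin_sum => // k; apply: kfinZ => //; exact: kW.
apply/matrixP => i j; rewrite !mxE E (kexp_sum mV mh) => [|k]; last first.
  by apply: kfinZ => //; exact: kW.
apply: eq_bigr => k _; rewrite (kexpZ mV mh); last exact: kW.
by rewrite mxE mulrC.
Qed.

End kernel_norm_bounds.

(** * Hoelder's inequality for two and three factors *)

Section hoelder_bounds.
Context {dT} {T : measurableType dT} {R : realType} (P : probability T R).
Local Notation "'N_ p [ f ]" := (Lnorm P p (EFin \o f)).
Local Open Scope ereal_scope.
Implicit Types f g k : T -> R.

Lemma Lnorm_hoelder_le p a b f g A B : 1 <= p -> 1 <= a -> 1 <= b ->
  p^-1 = a^-1 + b^-1 -> measurable_fun setT f -> measurable_fun setT g ->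
  'N_a[f] <= A -> 'N_b[g] <= B -> 'N_p[(fun w => f w * g w)%R] <= A * B.
Proof.
move=> p1 a1 b1 pab mf mg fA gB.
apply: le_trans (Lnorm_hoelder P p1 a1 b1 pab mf mg) _.
by apply: lee_pmul => //; exact: Lnorm_ge0.
Qed.

Lemma Lnorm_hoelder3_le p a b c f g k A B C :
  1 <= p -> 1 <= a -> 1 <= b -> 1 <= c -> p^-1 = a^-1 + b^-1 + c^-1 ->
  measurable_fun setT f -> measurable_fun setT g -> measurable_fun setT k ->
  'N_a[f] <= A -> 'N_b[g] <= B -> 'N_c[k] <= C ->
  'N_p[(fun w => f w * g w * k w)%R] <= A * B * C.
Proof.
move=> p1 a1 b1 c1 pabc mf mg mk fA gB kC.
have [s [s1 sab psc]] := hoelder_split p1 a1 b1 c1 pabc.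
apply: (Lnorm_hoelder_le p1 s1 c1 psc) => //; first exact: measurable_funM.
exact: (Lnorm_hoelder_le s1 a1 b1 sab).
Qed.

Lemma ler_LnormD_le p f g A B : 1 <= p -> measurable_fun setT f ->
  measurable_fun setT g -> 'N_p[f] <= A -> 'N_p[g] <= B ->
  'N_p[(fun w => f w + g w)%R] <= A + B.
Proof.
by move=> p1 mf mg fA gB; apply: le_trans (eminkowski P mf mg p1) _; exact: leeD.
Qed.

End hoelder_bounds.

(* Otherwise unification unfolds these constants and does not terminate in practice. *)
Local Arguments lrnorm : simpl never.
Local Opaque lrnorm.

(** * Pointwise bounds for the six terms *)

Section moments.
Context {dT} {T : measurableType dT} {R : realType} (P : probability T R).
Context {d : nat} (Z : {RV P >-> 'cV[R]_d}).
Hypothesis hZ : standard_gaussian P Z.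
Context {dS} {S : measurableType dS} (V : T -> S).
Hypothesis mV : measurable_fun setT V.
Hypothesis indep : independent_RV P Z V.
Variables (hX hY : S -> 'cV[R]_d).
Hypotheses (mX : measurable_fun setT hX) (mY : measurable_fun setT hY).
Variable H : S -> 'cV[R]_d -> 'cV[R]_d.
Hypothesis mH : measurable_fun setT (fun q : S * 'cV[R]_d => H q.1 q.2).
Hypothesis cdH : forall s, continuously_differentiable (H s).
Local Notation leb := (@lebesgue_measure R).
Local Notation hp := (hpath hX hY).
Local Notation "'N_ p [ f ]" := (Lnorm P p (EFin \o f)).
Variables (p r rho : \bar R).
Hypotheses (p1 : (1 <= p)%E) (r1 : (1 <= r)%E) (rho1 : (1 <= rho)%E).

Let h2 : (1 <= 2%:E :> \bar R)%E. Proof. by rewrite lee_fin ler1n. Qed.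

Definition nH (q : S * 'cV[R]_d) : R := lrnorm r (FH H q).
Definition nJ (q : S * 'cV[R]_d) : R := opnorm rho r (FJ H q).
Definition nJY (q : S * 'cV[R]_d) : R := lrnorm r (FJY hY H q).
Definition nX (q : S * 'cV[R]_d) : R := lrnorm 2%:E (hX q.1).
Definition nY (q : S * 'cV[R]_d) : R := lrnorm 2%:E (hY q.1).
Definition nZY (q : S * 'cV[R]_d) : R := `|FZY hY q|.

(** The scalar functions that bound the six terms; [Q] will be measurability, integrability at (V,
    Z), and finiteness under the kernel. *)
Definition scalar_terms (Q : (S * 'cV[R]_d -> R) -> Prop) :=
  [/\ Q nH, Q nJ, Q nJY & [/\ Q nX, Q nY, Q nZY &
    [/\ Q (nX \* nH), Q (nY \* nH) & Q (nZY \* nH)]]].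

Local Notation K t F g := (kexp P V (hp t) F g).

Section pointwise.
Variables (z x y : 'cV[R]_d) (t : R).
Hypothesis t01 : 0 <= t <= 1.
Let g := z + x + t *: y.
Hypothesis kall : all_terms hY H (kfin P V (hp t) g).
Hypothesis kH : entriesQ (kfin P V (hp t) g) (FH H).
Hypothesis ks : scalar_terms (kfin P V (hp t) g).

Let mht := measurable_hpath mX mY t.
Local Notation KM F := (kexpM P V (hp t) F g).

Let t0 : 0 <= t. Proof. by case/andP: t01. Qed.

Let slotE s : dotv (g - hp t s) y = dotv g y - dotv (hX s) y - t * dotv (hY s) y.
Proof. by rewrite /hpath opprD addrA !dotvBl dotvZl. Qed.

Let slot_le s : `|dotv (g - hp t s) y| <=
  `|dotv g y| + lrnorm 2%:E (hX s) * lrnorm 2%:E y +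
  t * (lrnorm 2%:E (hY s) * lrnorm 2%:E y).
Proof.
rewrite slotE (le_trans (ler_normB _ _))// lerD//; last first.
  by rewrite normrM (ger0_norm t0) ler_wpM2l// cauchy_schwarz.
by rewrite (le_trans (ler_normB _ _))// lerD2l cauchy_schwarz.
Qed.

(** Composed with [slot_le]: the point g is itself z + x + t y, so <Z', y> is controlled by <z, y>,
    by |x| and |X'| times |y|, and by t times |y| and |Y'| times |y|. Each of X and tY is thus
    counted twice. *)
Let g_le : `|dotv g y| <= `|dotv z y| + lrnorm 2%:E x * lrnorm 2%:E y +
  t * (lrnorm 2%:E y * lrnorm 2%:E y).
Proof.
rewrite /g !dotvDl dotvZl (le_trans (ler_normD _ _))// lerD//; last first.
  by rewrite normrM (ger0_norm t0) ler_wpM2l// cauchy_schwarz.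
by rewrite (le_trans (ler_normD _ _))// lerD2l cauchy_schwarz.
Qed.

Let K0 F : (forall q, 0 <= F q) -> 0 <= K t F g.
Proof. by move=> F0; exact: (kexp_ge0 P mV _ mht). Qed.

Let KH_le : lrnorm r (KM (FH H)) <= K t nH g.
Proof. by case: ks => knH _ _ _; exact: (lrnorm_kexpM_le mV mht r1 kH knH). Qed.

Lemma term_JY_le : lrnorm r (KM (FJ H) *m y) <= K t nJ g * lrnorm rho y.
Proof.
have [kJ _ _ _] := kall; have [_ knJ _ _] := ks.
have [kJy ->] := kexpM_mulmx mV mht y kJ.
rewrite mulrC -(kexpZ mV mht _ knJ).
apply: (lrnorm_kexpM_le mV mht r1 kJy (kfinZ mV mht _ knJ)) => s.
by rewrite mulrC; exact: opnormP.
Qed.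

Lemma term_JY'_le : lrnorm r (KM (FJY hY H)) <= K t nJY g.
Proof.
have [_ kJY _ _] := kall; have [_ _ knJY _] := ks.
exact: (lrnorm_kexpM_le mV mht r1 kJY knJY).
Qed.

Lemma term_HZY_le : lrnorm r (KM (FHZY hY H)) <= K t (nZY \* nH) g.
Proof.
have [_ _ _ [kHZY _ _]] := kall; have [_ _ _ [_ _ _ [_ _ k]]] := ks.
apply: (lrnorm_kexpM_le mV mht r1 kHZY k) => s.
by rewrite lrnormZ//= /nZY /FZY dotvC.
Qed.

(** The matrix H Z^T applied to y is <Z, y> H. The two bounds on <Z', y> yield one Gaussian
    contribution, two in X and two in tY. *)
Lemma term_HZ_le : lrnorm r (KM (FHZ H) *m y) <=
  `|dotv z y| * K t nH g + lrnorm 2%:E x * lrnorm 2%:E y * K t nH g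
  + t * (lrnorm 2%:E y * lrnorm 2%:E y * K t nH g)
  + lrnorm 2%:E y * K t (nX \* nH) g + t * (lrnorm 2%:E y * K t (nY \* nH) g).
Proof.
have [_ _ kHZ _] := kall; have [knH _ _ [_ _ _ [kX kY _]]] := ks.
have [kHZy ->] := kexpM_mulmx mV mht y kHZ.
pose F := (fun q => `|dotv g y| * nH q) \+ (fun q => lrnorm 2%:E y * (nX \* nH) q)
  \+ (fun q => (t * lrnorm 2%:E y) * (nY \* nH) q).
have k1 := kfinZ mV mht `|dotv g y| knH.
have k2 := kfinZ mV mht (lrnorm 2%:E y) kX.
have k3 := kfinZ mV mht (t * lrnorm 2%:E y) kY.
have k12 := kfinD mV mht k1 k2; have kF : kfin P V (hp t) g F := kfinD mV mht k12 k3.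
apply: le_trans (lrnorm_kexpM_le mV mht r1 kHZy kF _) _.
  move=> s; have -> : FHZ H (s, g - hp t s) *m y =
      dotv (g - hp t s) y *: FH H (s, g - hp t s).
    apply/matrixP => i j; rewrite ord1 !mxE /dotv mulr_suml; apply: eq_bigr => k _.
    have -> : FHZ H (s, g - hp t s) i k = FH H (s, g - hp t s) i 0 * (g - hp t s) k 0.
      by rewrite mxE big_ord1 mxE.
    by rewrite -mulrA mulrC.
  rewrite lrnormZ// -/(nH (s, g - hp t s)).
  have nH0 : 0 <= nH (s, g - hp t s) by exact: lrnorm_ge0.
  apply: le_trans (ler_wpM2r nH0 (slot_le s)) _.
  rewrite /F /= /nX /nY /=; move: `|_| (lrnorm _ _) (lrnorm _ _) (lrnorm _ _) (nH _).
  by move=> u1 u2 u3 u4 u5; rewrite le_eqVlt; apply/orP; left; apply/eqP; ring.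
have e1 := kexpZ mV mht `|dotv g y| knH.
have e2 := kexpZ mV mht (lrnorm 2%:E y) kX.
have e3 := kexpZ mV mht (t * lrnorm 2%:E y) kY.
have KF : K t F g = `|dotv g y| * K t nH g + lrnorm 2%:E y * K t (nX \* nH) g +
    t * lrnorm 2%:E y * K t (nY \* nH) g.
  exact: etrans (kexpD mV mht k12 k3)
    (congr2 +%R (etrans (kexpD mV mht k1 k2) (congr2 +%R e1 e2)) e3).
rewrite {e1 e2 e3}KF -[t * _ * _]mulrA; apply: lerD; last by [].
apply: lerD; last by [].
apply: le_trans (ler_wpM2r (K0 _) g_le) _; first by move=> q; exact: lrnorm_ge0.
rewrite le_eqVlt; apply/orP; left; apply/eqP.
move: (kexp P V _ nH g) `|dotv z y| (lrnorm _ x) (lrnorm _ y) => k u1 u2 u3; ring.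
Qed.

Lemma term_ZYH_le : lrnorm r (K t (FZY hY) g *: KM (FH H)) <= K t nZY g * K t nH g.
Proof.
have [_ _ _ [_ _ kZY]] := kall; have [_ _ _ [_ _ knZY _]] := ks.
rewrite lrnormZ// ler_pM ?lrnorm_ge0//.
rewrite ler_norml; apply/andP; split; last first.
  by apply: (kexp_le_at mV mht) => // s; exact: ler_norm.
rewrite lerNl -(kexpN mV mht)//; apply: (kexp_le_at mV mht) => //; first exact: kfinN.
by move=> s; rewrite /nZY -normrN; exact: ler_norm.
Qed.

(** The same five contributions as in [term_HZ_le], except that products of the averages of |X| or
    |Y| with that of |H| replace averages of products. *)
Lemma term_ZH_le : lrnorm r (dotv y (KM (@FZ _ _ _ S)) *: KM (FH H)) <=
  `|dotv z y| * K t nH g + lrnorm 2%:E x * lrnorm 2%:E y * K t nH g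
  + t * (lrnorm 2%:E y * lrnorm 2%:E y * K t nH g)
  + lrnorm 2%:E y * K t nX g * K t nH g + t * (lrnorm 2%:E y * K t nY g * K t nH g).
Proof.
have alg (u v a b k kx ky : R) : 0 <= k -> u <= v + a * b + t * (b * b) ->
    (u + b * kx + t * b * ky) * k <=
    v * k + a * b * k + t * (b * b * k) + b * kx * k + t * (b * ky * k).
  move=> k0 le; rewrite -subr_ge0.
  rewrite [X in 0 <= X](_ : _ = (v + a * b + t * (b * b) - u) * k); last by ring.
  by rewrite mulr_ge0// subr_ge0.
have [_ _ _ [_ kZ _]] := kall; have [_ _ _ [knX knY _ _]] := ks.
rewrite lrnormZ// dotvC -(kexp_dotv mV mht)//.
pose F := cst `|dotv g y| \+ (fun q => lrnorm 2%:E y * nX q)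
  \+ (fun q => (t * lrnorm 2%:E y) * nY q).
have k1 := kfin_cst P mV g mht `|dotv g y|.
have k2 := kfinZ mV mht (lrnorm 2%:E y) knX.
have k3 := kfinZ mV mht (t * lrnorm 2%:E y) knY.
have k12 := kfinD mV mht k1 k2; have kF : kfin P V (hp t) g F := kfinD mV mht k12 k3.
have kZy := kfin_dotv mV mht y kZ.
have slot_leF s : `|dotv (g - hp t s) y| <= F (s, g - hp t s).
  apply: le_trans (slot_le s) _.
  rewrite /F /= /nX /nY /=; move: `|_| (lrnorm _ _) (lrnorm _ _) (lrnorm _ _).
  by move=> u1 u2 u3 u4; rewrite le_eqVlt; apply/orP; left; apply/eqP; ring.
have le1 : `|K t (fun q => dotv (FZ q) y) g| <= K t F g.
  rewrite ler_norml; apply/andP; split; last first.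
    apply: (kexp_le_at mV mht kZy kF) => s.
    exact: le_trans (ler_norm _) (slot_leF s).
  rewrite lerNl -(kexpN mV mht kZy).
  apply: (kexp_le_at mV mht (kfinN mV mht kZy) kF) => s.
  by apply: le_trans (ler_norm _) _; rewrite normrN; exact: slot_leF.
apply: le_trans (ler_pM (normr_ge0 _) (lrnorm_ge0 _ _) le1 KH_le) _.
have e1 := kexp_cst P mV g mht `|dotv g y|.
have e2 := kexpZ mV mht (lrnorm 2%:E y) knX.
have e3 := kexpZ mV mht (t * lrnorm 2%:E y) knY.
have KF : K t F g = `|dotv g y| + lrnorm 2%:E y * K t nX g +
    t * lrnorm 2%:E y * K t nY g.
  exact: etrans (kexpD mV mht k12 k3)
    (congr2 +%R (etrans (kexpD mV mht k1 k2) (congr2 +%R e1 e2)) e3).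
rewrite {e1 e2 e3}KF.
have KH0 : 0 <= K t nH g by apply: K0 => q; exact: lrnorm_ge0.
exact: (alg _ _ _ _ (K t nH g) (K t nX g) (K t nY g) KH0 g_le).
Qed.

End pointwise.

End moments.

Local Opaque measurable_fun kexp.

(** * L^p bounds for the six terms *)

Section moment_bounds.
Context {dT} {T : measurableType dT} {R : realType} (P : probability T R).
Context {d : nat} (Z : {RV P >-> 'cV[R]_d}).
Hypothesis hZ : standard_gaussian P Z.
Context {dS} {S : measurableType dS} (V : T -> S).
Hypothesis mV : measurable_fun setT V.
Hypothesis indep : independent_RV P Z V.
Variables (hX hY : S -> 'cV[R]_d).
Hypotheses (mX : measurable_fun setT hX) (mY : measurable_fun setT hY).
Variable H : S -> 'cV[R]_d -> 'cV[R]_d.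
Hypothesis mH : measurable_fun setT (fun q : S * 'cV[R]_d => H q.1 q.2).
Hypothesis cdH : forall s, continuously_differentiable (H s).
Local Notation leb := (@lebesgue_measure R).
Local Notation hp := (hpath hX hY).
Local Notation "'N_ p [ f ]" := (Lnorm P p (EFin \o f)).
Variables (p r rho : \bar R).
Hypotheses (p1 : (1 <= p)%E) (r1 : (1 <= r)%E) (rho1 : (1 <= rho)%E).
Local Open Scope ereal_scope.

Local Notation nH := (nH H r).
Local Notation nJ := (nJ H r rho).
Local Notation nJY := (nJY hY H r).
Local Notation nX := (@nX _ d _ S hX).
Local Notation nY := (@nY _ d _ S hY).
Local Notation nZY := (@nZY _ d _ S hY).
Local Notation X := (hX \o V).
Local Notation Y := (hY \o V).
Local Notation HZ := (at_VZ Z V (FH H)).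
Local Notation JZ := (at_VZ Z V (FJ H)).

Lemma measurable_scalar_terms : scalar_terms hX hY H r rho (fun F => measurable_fun setT F).
Proof.
have mfst (h : S -> 'cV[R]_d) : measurable_fun setT h ->
    measurable_fun setT (fun q : S * 'cV[R]_d => h q.1).
  by move=> mh; exact: measurableT_comp.
have m1 : measurable_fun setT nH by exact: (measurable_lrnorm r (measurable_FH mH)).
have m2 : measurable_fun setT nX by exact: (measurable_lrnorm _ (mfst _ mX)).
have m3 : measurable_fun setT nY by exact: (measurable_lrnorm _ (mfst _ mY)).
have m4 : measurable_fun setT nZY.
  by apply: (measurableT_comp (@normr_measurable R setT)); exact: measurable_FZY.
split; first exact: m1.
- exact: (measurable_opnorm rho1 r1 (measurable_FJ mH cdH)).
- exact: (measurable_lrnorm _ (measurable_FJY mY mH cdH)).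
by split; [exact: m2|exact: m3|exact: m4|split;
  [exact: measurable_funM m2 m1|exact: measurable_funM m3 m1|exact: measurable_funM m4 m1]].
Qed.

Let mVZ : measurable_fun setT (fun w => (V w, Z w)).
Proof. exact: measurable_fun_pair. Qed.

Lemma measurable_at_VZ (F : S * 'cV[R]_d -> R) : measurable_fun setT F ->
  measurable_fun setT (fun w => F (V w, Z w)).
Proof. by move=> mF; exact: (measurableT_comp mF mVZ). Qed.

Let mst : measurable_fun setT (start Z V hX).
Proof. by apply: measurable_mxD => //; exact: measurableT_comp. Qed.

Let mhY : measurable_fun setT (hY \o V). Proof. exact: measurableT_comp. Qed.
Let mhX : measurable_fun setT (hX \o V). Proof. exact: measurableT_comp. Qed.

Local Notation KF t F := (fun w => kexp P V (hp t) F (start Z V hX w + t *: hY (V w))%R).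

Lemma measurable_KF t (F : S * 'cV[R]_d -> R) : measurable_fun setT F -> measurable_fun setT
  (KF t F).
Proof. exact: (measurable_kexp_at P mV mX mY mst mhY (t := fun=> t)). Qed.

Lemma Lnorm_KF t (F : S * 'cV[R]_d -> R) q : 1 <= q -> measurable_fun setT F ->
  'N_q[KF t F] <= 'N_q[(fun w => F (V w, Z w))].
Proof.
move=> q1 mF; have := Lnorm_kexp_le hZ mV indep (measurable_hpath mX mY t) mF q1.
by under [X in X <= _ -> _]eq_Lnorm do rewrite /= kpath_hpath.
Qed.

Variables (a c alpha0 beta0 alpha1 beta1 gamma1 alpha2 beta2 gamma2 : \bar R).
Hypotheses (a1 : 1 <= a) (c1 : 1 <= c) (al0 : 1 <= alpha0) (be0 : 1 <= beta0)
  (al1 : 1 <= alpha1) (be1 : 1 <= beta1) (ga1 : 1 <= gamma1)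
  (al2 : 1 <= alpha2) (be2 : 1 <= beta2) (ga2 : 1 <= gamma2).
Hypotheses (hac : p^-1 = a^-1 + c^-1) (h0 : p^-1 = alpha0^-1 + beta0^-1)
  (h1 : p^-1 = alpha1^-1 + beta1^-1 + gamma1^-1)
  (h2 : p^-1 = alpha2^-1 + beta2^-1 + gamma2^-1).
(** Real bounds for the four products of norms, so that the final summation takes place in the field
    R. *)
Variables (tJ tg tX tY : R).
Hypotheses
  (hJ : norm_op P a rho r JZ * norm_pr P c rho Y <= tJ%:E)
  (hg : norm_pr P alpha0 r HZ * norm_pr P beta0 2%:E Y * gauss_norm beta0 <= tg%:E)
  (hTX : norm_pr P alpha1 r HZ * norm_pr P beta1 2%:E X * norm_pr P gamma1 2%:E Y <= tX%:E)
  (hTY : norm_pr P alpha2 r HZ * norm_pr P beta2 2%:E Y * norm_pr P gamma2 2%:E Y <= tY%:E).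

Let z w := dotv (Z w) (hY (V w)).
Let x w := lrnorm 2%:E (hX (V w)).
Let y w := lrnorm 2%:E (hY (V w)).
Let yr w := lrnorm rho (hY (V w)).

Lemma measurable_abs_dotvZY : measurable_fun setT (fun w => `|z w|%R).
Proof.
apply: (measurableT_comp (@normr_measurable R setT)).
by apply: measurable_dotv; [exact: measurable_funPT|exact: mhY].
Qed.
Lemma measurable_norm2X : measurable_fun setT x. Proof. exact: (measurable_lrnorm _ mhX). Qed.
Lemma measurable_norm2Y : measurable_fun setT y. Proof. exact: (measurable_lrnorm _ mhY). Qed.
Lemma measurable_normrY : measurable_fun setT yr. Proof. exact: (measurable_lrnorm _ mhY). Qed.

Lemma Lnorm_abs_dotvZY : 'N_beta0[(fun w => `|z w|%R)] <= norm_pr P beta0 2%:E Y * gauss_norm beta0.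
Proof.
apply: le_trans (Lnorm_dotv_le hZ mV indep mY be0).
apply: (Lnorm_le_ae be0 measurable_abs_dotvZY).
  by apply: measurable_dotv; [exact: measurable_funPT|exact: mhY].
by apply: aeW => w; rewrite normr_id.
Qed.

Lemma measurable_nH : measurable_fun setT nH. Proof. by have [] := measurable_scalar_terms. Qed.
Lemma measurable_nJ : measurable_fun setT nJ. Proof. by have [] := measurable_scalar_terms. Qed.
Lemma measurable_nJY : measurable_fun setT nJY. Proof. by have [] := measurable_scalar_terms. Qed.
Lemma measurable_nX : measurable_fun setT nX. Proof.
by have [_ _ _ []] := measurable_scalar_terms. Qed.
Lemma measurable_nY : measurable_fun setT nY. Proof.
by have [_ _ _ []] := measurable_scalar_terms. Qed.
Lemma measurable_nZY : measurable_fun setT nZY. Proof.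
by have [_ _ _ []] := measurable_scalar_terms. Qed.

Lemma hoelder_JY f : measurable_fun setT f -> 'N_a[f] <= norm_op P a rho r JZ ->
  'N_p[(fun w => f w * yr w)%R] <= tJ%:E.
Proof.
move=> mf hf; apply: le_trans hJ.
exact: (Lnorm_hoelder_le p1 a1 c1 hac mf measurable_normrY hf (lexx _)).
Qed.

Lemma hoelder_HZY f g : measurable_fun setT f -> measurable_fun setT g ->
  'N_alpha0[f] <= norm_pr P alpha0 r HZ ->
  'N_beta0[g] <= 'N_beta0[(fun w => `|z w|%R)] ->
  'N_p[(fun w => f w * g w)%R] <= tg%:E.
Proof.
move=> mf mg hf gz; apply: le_trans hg; rewrite -muleA.
exact: (Lnorm_hoelder_le p1 al0 be0 h0 mf mg hf (le_trans gz Lnorm_abs_dotvZY)).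
Qed.

Lemma norm_JY_le t : 'N_p[(fun w => KF t nJ w * yr w)%R] <= tJ%:E.
Proof.
exact: (hoelder_JY (measurable_KF t measurable_nJ) (Lnorm_KF t a1 measurable_nJ)).
Qed.

Lemma norm_nJY_le : 'N_p[(fun w => nJY (V w, Z w))] <= tJ%:E.
Proof.
have mJ := measurable_at_VZ measurable_nJ.
apply: (le_trans _ (hoelder_JY mJ (lexx _))).
apply: (Lnorm_le_ae p1 (measurable_at_VZ measurable_nJY) (measurable_funM mJ measurable_normrY)).
apply: aeW => w; rewrite ger0_norm; last exact: lrnorm_ge0.
rewrite ger0_norm; last by apply: mulr_ge0; [exact: opnorm_ge0|exact: lrnorm_ge0].
exact: opnormP.
Qed.

Lemma norm_JY'_le t : 'N_p[KF t nJY] <= tJ%:E.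
Proof.
exact: le_trans (Lnorm_KF t p1 measurable_nJY) norm_nJY_le.
Qed.

Lemma norm_nZYH_le : 'N_p[(fun w => (nZY \* nH)%R (V w, Z w))] <= tg%:E.
Proof.
have -> : (fun w => (nZY \* nH)%R (V w, Z w)) = (fun w => nH (V w, Z w) * `|z w|)%R.
  by apply/funext => w; rewrite /= mulrC /nZY /FZY dotvC.
exact: (hoelder_HZY (measurable_at_VZ measurable_nH) measurable_abs_dotvZY (lexx _) (lexx _)).
Qed.

Lemma norm_ZYH_le t : 'N_p[KF t (nZY \* nH)%R] <= tg%:E.
Proof.
exact: le_trans (Lnorm_KF t p1 (measurable_funM measurable_nZY measurable_nH)) norm_nZYH_le.
Qed.

Lemma norm_HzY_le t : 'N_p[(fun w => KF t nH w * `|z w|)%R] <= tg%:E.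
Proof.
exact: (hoelder_HZY (measurable_KF t measurable_nH) measurable_abs_dotvZY
  (Lnorm_KF t al0 measurable_nH) (lexx _)).
Qed.

Lemma norm_HKZY_le t : 'N_p[(fun w => KF t nH w * KF t nZY w)%R] <= tg%:E.
Proof.
apply: (hoelder_HZY (measurable_KF t measurable_nH) (measurable_KF t measurable_nZY)
  (Lnorm_KF t al0 measurable_nH)).
apply: le_trans (Lnorm_KF t be0 measurable_nZY) _.
apply: (Lnorm_le_ae be0 (measurable_at_VZ measurable_nZY) measurable_abs_dotvZY).
by apply: aeW => w; rewrite /nZY /FZY dotvC.
Qed.

Lemma norm_nXH_le s : 1 <= s -> s^-1 = alpha1^-1 + beta1^-1 ->
  'N_s[(fun w => (nX \* nH)%R (V w, Z w))] <=
  norm_pr P alpha1 r HZ * norm_pr P beta1 2%:E X.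
Proof.
move=> s1 hs; have -> : (fun w => (nX \* nH)%R (V w, Z w)) =
    (fun w => nH (V w, Z w) * x w)%R by apply/funext => w; rewrite /= mulrC.
exact: (Lnorm_hoelder_le s1 al1 be1 hs (measurable_at_VZ measurable_nH) measurable_norm2X
  (lexx _) (lexx _)).
Qed.

Lemma norm_nYH_le s : 1 <= s -> s^-1 = alpha2^-1 + beta2^-1 ->
  'N_s[(fun w => (nY \* nH)%R (V w, Z w))] <=
  norm_pr P alpha2 r HZ * norm_pr P beta2 2%:E Y.
Proof.
move=> s1 hs; have -> : (fun w => (nY \* nH)%R (V w, Z w)) =
    (fun w => nH (V w, Z w) * y w)%R by apply/funext => w; rewrite /= mulrC.
exact: (Lnorm_hoelder_le s1 al2 be2 hs (measurable_at_VZ measurable_nH) measurable_norm2Y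
  (lexx _) (lexx _)).
Qed.

Lemma norm_HxY_le t f : measurable_fun setT f ->
  'N_beta1[f] <= norm_pr P beta1 2%:E X ->
  'N_p[(fun w => KF t nH w * f w * y w)%R] <= tX%:E.
Proof.
move=> mf fx; apply: le_trans hTX.
exact: (Lnorm_hoelder3_le p1 al1 be1 ga1 h1 (measurable_KF t measurable_nH) mf measurable_norm2Y
  (Lnorm_KF t al1 measurable_nH) fx (lexx _)).
Qed.

Lemma norm_HyY_le t f : measurable_fun setT f ->
  'N_beta2[f] <= norm_pr P beta2 2%:E Y ->
  'N_p[(fun w => KF t nH w * f w * y w)%R] <= tY%:E.
Proof.
move=> mf fx; apply: le_trans hTY.
exact: (Lnorm_hoelder3_le p1 al2 be2 ga2 h2 (measurable_KF t measurable_nH) mf measurable_norm2Y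
  (Lnorm_KF t al2 measurable_nH) fx (lexx _)).
Qed.

(** Here |X| and |H| stand under the same average: Hoelder's inequality puts their product in L^s
    with 1/s = 1/alpha1 + 1/beta1, the kernel contracts L^s, and Y is paired outside. *)
Lemma norm_XHY_le t : 'N_p[(fun w => KF t (nX \* nH)%R w * y w)%R] <= tX%:E.
Proof.
have [s [s1 hs ps]] := hoelder_split p1 al1 be1 ga1 h1.
apply: le_trans hTX; have mXH := measurable_funM measurable_nX measurable_nH.
exact: (Lnorm_hoelder_le p1 s1 ga1 ps (measurable_KF t mXH) measurable_norm2Y
  (le_trans (Lnorm_KF t s1 mXH) (norm_nXH_le s1 hs)) (lexx _)).
Qed.

Lemma norm_YHY_le t : 'N_p[(fun w => KF t (nY \* nH)%R w * y w)%R] <= tY%:E.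
Proof.
have [s [s1 hs ps]] := hoelder_split p1 al2 be2 ga2 h2.
apply: le_trans hTY; have mYH := measurable_funM measurable_nY measurable_nH.
exact: (Lnorm_hoelder_le p1 s1 ga2 ps (measurable_KF t mYH) measurable_norm2Y
  (le_trans (Lnorm_KF t s1 mYH) (norm_nYH_le s1 hs)) (lexx _)).
Qed.

(** Summation of the five contributions of [term_HZ_le] or of [term_ZH_le]. *)
Lemma norm_five_le t f1 f2 f3 f4 f5 : (0 <= t)%R ->
  measurable_fun setT f1 -> measurable_fun setT f2 -> measurable_fun setT f3 ->
  measurable_fun setT f4 -> measurable_fun setT f5 ->
  'N_p[f1] <= tg%:E -> 'N_p[f2] <= tX%:E -> 'N_p[f3] <= tY%:E ->
  'N_p[f4] <= tX%:E -> 'N_p[f5] <= tY%:E ->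
  'N_p[(fun w => f1 w + f2 w + t * f3 w + f4 w + t * f5 w)%R] <=
  (tg + tX + t * tY + tX + t * tY)%:E.
Proof.
move=> t0 m1 m2 m3 m4 m5 b1 b2 b3 b4 b5.
have mt (f : T -> R) : measurable_fun setT f -> measurable_fun setT (fun w => t * f w)%R.
  by move=> mf; exact: (measurable_funM (measurable_cst t) mf).
have bt (f : T -> R) : measurable_fun setT f -> 'N_p[f] <= tY%:E ->
    'N_p[(fun w => t * f w)%R] <= (t * tY)%:E.
  by move=> mf bf; rewrite (Lnorm_scale P t p1 mf) ger0_norm// EFinM lee_wpmul2l.
have m12 := measurable_funD m1 m2; have m123 := measurable_funD m12 (mt _ m3).
have m1234 := measurable_funD m123 m4.
rewrite !EFinD; apply: (ler_LnormD_le p1 m1234 (mt _ m5) _ (bt _ m5 b5)).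
apply: (ler_LnormD_le p1 m123 m4 _ b4).
apply: (ler_LnormD_le p1 m12 (mt _ m3) _ (bt _ m3 b3)).
exact: (ler_LnormD_le p1 m1 m2 b1 b2).
Qed.

Hypotheses (iH : integrableM P HZ) (iJ : integrableM P JZ)
  (iJY : integrableM P (at_VZ Z V (FJY hY H))) (iHZY : integrableM P (at_VZ Z V (FHZY hY H)))
  (iHZ : integrableM P (at_VZ Z V (FHZ H))) (iZ : integrableM P (at_VZ Z V (@FZ R d dS S)))
  (iZY : P.-integrable setT (fun w => (FZY hY (V w, Z w))%:E)).
Hypothesis iscal : scalar_terms hX hY H r rho
  (fun F => P.-integrable setT (fun w => (F (V w, Z w))%:E)).

Lemma ae_terms_kfin t : {ae P, forall w,
  [/\ all_terms hY H (kfin P V (hp t) (start Z V hX w + t *: hY (V w))%R),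
     entriesQ (kfin P V (hp t) (start Z V hX w + t *: hY (V w))%R) (FH H) &
     scalar_terms hX hY H r rho (kfin P V (hp t) (start Z V hX w + t *: hY (V w))%R)]}.
Proof.
have aeF := ae_filter_ringOfSetsType P.
pose Q w := kfin P V (hp t) (start Z V hX w + t *: hY (V w))%R.
have one (F : S * 'cV[R]_d -> R) : measurable_fun setT F ->
    P.-integrable setT (fun w => (F (V w, Z w))%:E) -> {ae P, forall w, Q w F}.
  by move=> mF iF; exact: (ae_kfin hZ mV indep mX mY t mF iF).
have many m n (F : S * 'cV[R]_d -> 'M[R]_(m, n)) : measurable_fun setT F ->
    integrableM P (at_VZ Z V F) -> {ae P, forall w, entriesQ (Q w) F}.
  move=> mF iF; apply: (@ae_entries _ _ _ P _ _ _ _ _ Q) => i j.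
  exact: one (measurable_mx_coord i j mF) (iF i j).
have [i1 i2 i3 [i4 i5 i6 [i7 i8 i9]]] := iscal.
have AI := fun A B => @filterI _ _ aeF A B.
have h12 := AI _ _ (many _ _ _ (measurable_FJ mH cdH) iJ)
  (many _ _ _ (measurable_FJY mY mH cdH) iJY).
have h34 := AI _ _ (many _ _ _ (measurable_FHZ mH) iHZ) (many _ _ _ (measurable_FHZY mY mH) iHZY).
have h56 := AI _ _ (many _ _ _ (@measurable_FZ R d dS S) iZ) (one _ (measurable_FZY mY) iZY).
have s12 := AI _ _ (one _ measurable_nH i1) (one _ measurable_nJ i2).
have s34 := AI _ _ (one _ measurable_nJY i3) (one _ measurable_nX i4).
have s56 := AI _ _ (one _ measurable_nY i5) (one _ measurable_nZY i6).
have s78 := AI _ _ (one _ (measurable_funM measurable_nX measurable_nH) i7)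
  (one _ (measurable_funM measurable_nY measurable_nH) i8).
have s9 := one _ (measurable_funM measurable_nZY measurable_nH) i9.
have := AI _ _ (AI _ _ (AI _ _ h12 h34) (AI _ _ h56 (many _ _ _ (measurable_FH mH) iH)))
  (AI _ _ (AI _ _ s12 s34) (AI _ _ s56 (AI _ _ s78 s9))).
apply: (@filterS _ _ aeF) => w [[[[k1 k2] [k3 k4]] [[k5 k6] kH]]
  [[[l1 l2] [l3 l4]] [[l5 l6] [[l7 l8] l9]]]].
by split; [exact: And4 k1 k2 k3 (And3 k4 k5 k6)|exact: kH|
  exact: And4 l1 l2 l3 (And4 l4 l5 l6 (And3 l7 l8 l9))].
Qed.

Lemma norm_pr_le_ae (W : T -> 'cV[R]_d) (f : T -> R) (b : \bar R) :
  measurable_fun setT W -> measurable_fun setT f ->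
  {ae P, forall w, (lrnorm r (W w) <= f w)%R} -> 'N_p[f] <= b -> norm_pr P p r W <= b.
Proof.
move=> mW mf Wf fb; apply: le_trans fb.
apply: (Lnorm_le_ae p1 (measurable_lrnorm r mW) mf).
apply: filterS Wf => w h; rewrite ger0_norm; last exact: lrnorm_ge0.
by apply: le_trans h _; exact: ler_norm.
Qed.

(** The two Jacobian terms give 2 tJ. The four terms with Z give tg each, and [term_HZ_le] and
    [term_ZH_le] add 2 tX + 2 t tY each. *)
Lemma norm_six_sum_moment t : (0 <= t <= 1)%R ->
  norm_pr P p r (fun w => six_sum P V hX hY H (start Z V hX w) (hY (V w)) t) <=
  (2 * tJ + 4 * tg + 4 * tX + 4 * t * tY)%:E.
Proof.
move=> t01; have t0 : (0 <= t)%R by case/andP: t01.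
have aeF := ae_filter_ringOfSetsType P; have good := ae_terms_kfin t.
have mKM m n (F : S * 'cV[R]_d -> 'M[R]_(m, n)) : measurable_fun setT F ->
    measurable_fun setT (fun w => kexpM P V (hp t) F (start Z V hX w + t *: hY (V w))%R).
  exact: (measurable_kexpM_at P mV mX mY mst mhY (t := fun=> t)).
have mKH := mKM _ _ _ (measurable_FH mH).
have m1 := measurable_mulmx (mKM _ _ _ (measurable_FJ mH cdH)) mhY.
have m2 := mKM _ _ _ (measurable_FJY mY mH cdH).
have m3 := mKM _ _ _ (measurable_FHZY mY mH).
have m4 := measurable_mulmx (mKM _ _ _ (measurable_FHZ mH)) mhY.
have m5 := measurable_mxZ (measurable_KF t (measurable_FZY mY)) mKH.
have m6 := measurable_mxZ (measurable_dotv mhY (mKM _ _ _ (@measurable_FZ R d dS S))) mKH.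
apply: le_trans (norm_pr_six P p1 r1 m1 m2 m3 m4 m5 m6) _.
have kH := measurable_KF t measurable_nH.
have b1 : norm_pr P p r (fun w => kexpM P V (hp t) (FJ H)
    (start Z V hX w + t *: hY (V w)) *m (hY \o V) w)%R <= tJ%:E.
  apply: (norm_pr_le_ae m1 _ _ (norm_JY_le t)).
    exact: measurable_funM (measurable_KF t measurable_nJ) measurable_normrY.
  by apply: (@filterS _ _ aeF _ _ _ good) => w [k1 k2 k3];
    exact: (term_JY_le mV mX mY r1 rho1 k1 k3).
have b2 : norm_pr P p r (fun w => kexpM P V (hp t) (FJY hY H)
    (start Z V hX w + t *: hY (V w)))%R <= tJ%:E.
  apply: (norm_pr_le_ae m2 _ _ (norm_JY'_le t)).
    exact: (measurable_KF t measurable_nJY).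
  by apply: (@filterS _ _ aeF _ _ _ good) => w [k1 k2 k3]; exact: (term_JY'_le mV mX mY r1 k1 k3).
have b3 : norm_pr P p r (fun w => kexpM P V (hp t) (FHZY hY H)
    (start Z V hX w + t *: hY (V w)))%R <= tg%:E.
  apply: (norm_pr_le_ae m3 _ _ (norm_ZYH_le t)).
    exact: (measurable_KF t (measurable_funM measurable_nZY measurable_nH)).
  by apply: (@filterS _ _ aeF _ _ _ good) => w [k1 k2 k3]; exact: (term_HZY_le mV mX mY r1 k1 k3).
have kxh := measurable_KF t (measurable_funM measurable_nX measurable_nH).
have kyh := measurable_KF t (measurable_funM measurable_nY measurable_nH).
have n1 := measurable_funM kH measurable_abs_dotvZY.
have n2 := measurable_funM (measurable_funM kH measurable_norm2X) measurable_norm2Y.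
have n3 := measurable_funM (measurable_funM kH measurable_norm2Y) measurable_norm2Y.
have n4 := measurable_funM kxh measurable_norm2Y.
have n5 := measurable_funM kyh measurable_norm2Y.
have c1' := norm_HzY_le t.
have c2 := norm_HxY_le t measurable_norm2X (lexx _).
have c3 := norm_HyY_le t measurable_norm2Y (lexx _).
have mfive (f1 f2 f3 f4 f5 : T -> R) : measurable_fun setT f1 -> measurable_fun setT f2 ->
    measurable_fun setT f3 -> measurable_fun setT f4 -> measurable_fun setT f5 ->
    measurable_fun setT (fun w => f1 w + f2 w + t * f3 w + f4 w + t * f5 w)%R.
  move=> q1 q2 q3 q4 q5; have q12 := measurable_funD q1 q2.
  have q123 := measurable_funD q12 (measurable_funM (measurable_cst t) q3).
  exact: measurable_funD (measurable_funD q123 q4) (measurable_funM (measurable_cst t) q5).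
have b4 : norm_pr P p r (fun w => kexpM P V (hp t) (FHZ H)
    (start Z V hX w + t *: hY (V w)) *m (hY \o V) w)%R <=
    (tg + tX + t * tY + tX + t * tY)%:E.
  apply: (norm_pr_le_ae m4 (mfive _ _ _ _ _ n1 n2 n3 n4 n5) _
    (norm_five_le t0 n1 n2 n3 n4 n5 c1' c2 c3 (norm_XHY_le t) (norm_YHY_le t))).
  apply: (@filterS _ _ aeF _ _ _ good) => w [k1 k2 k3].
  apply: le_trans (term_HZ_le mV mX mY r1 t01 k1 k3) _.
  have alg (a1' a2' a3' k4 k5 k6 : R) : (a1' * k4 + a2' * a3' * k4 + t * (a3' * a3' * k4) +
      a3' * k5 + t * (a3' * k6) <= k4 * a1' + k4 * a2' * a3' + t * (k4 * a3' * a3') +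
      k5 * a3' + t * (k6 * a3'))%R by rewrite le_eqVlt; apply/orP; left; apply/eqP; ring.
  exact: alg.
have b5 : norm_pr P p r (fun w => kexp P V (hp t) (FZY hY)
    (start Z V hX w + t *: hY (V w)) *: kexpM P V (hp t) (FH H)
    (start Z V hX w + t *: hY (V w)))%R <= tg%:E.
  apply: (norm_pr_le_ae m5 _ _ (norm_HKZY_le t)).
    exact: measurable_funM kH (measurable_KF t measurable_nZY).
  apply: (@filterS _ _ aeF _ _ _ good) => w [k1 k2 k3].
  by rewrite [leRHS]mulrC; exact: (term_ZYH_le mV mX mY r1 k1 k2 k3).
have KX := measurable_KF t measurable_nX; have KY := measurable_KF t measurable_nY.
have n6 := measurable_funM (measurable_funM kH KX) measurable_norm2Y.
have n7 := measurable_funM (measurable_funM kH KY) measurable_norm2Y.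
have c6 := norm_HxY_le t KX (Lnorm_KF t be1 measurable_nX).
have c7 := norm_HyY_le t KY (Lnorm_KF t be2 measurable_nY).
have b6 : norm_pr P p r (fun w => dotv ((hY \o V) w) (kexpM P V (hp t) (@FZ R d dS S)
    (start Z V hX w + t *: hY (V w))) *: kexpM P V (hp t) (FH H)
    (start Z V hX w + t *: hY (V w)))%R <= (tg + tX + t * tY + tX + t * tY)%:E.
  apply: (norm_pr_le_ae m6 (mfive _ _ _ _ _ n1 n2 n3 n6 n7) _
    (norm_five_le t0 n1 n2 n3 n6 n7 c1' c2 c3 c6 c7)).
  apply: (@filterS _ _ aeF _ _ _ good) => w [k1 k2 k3].
  apply: le_trans (term_ZH_le mV mX mY r1 t01 k1 k2 k3) _.
  have alg (a1' a2' a3' k4 k5 k6 : R) : (a1' * k4 + a2' * a3' * k4 + t * (a3' * a3' * k4) +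
      a3' * k5 * k4 + t * (a3' * k6 * k4) <= k4 * a1' + k4 * a2' * a3' + t * (k4 * a3' * a3') +
      k4 * k5 * a3' + t * (k4 * k6 * a3'))%R by rewrite le_eqVlt; apply/orP; left; apply/eqP; ring.
  exact: alg.
apply: le_trans (leeD (leeD (leeD (leeD (leeD b1 b2) b3) b4) b5) b6) _.
by rewrite -!EFinD lee_fin le_eqVlt; apply/orP; left; apply/eqP; ring.
Qed.

End moment_bounds.

Lemma integrable_dominated {dT} {T : measurableType dT} {R : realType}
    (P : probability T R) (f g : T -> R) : measurable_fun setT f ->
  P.-integrable setT (EFin \o g) -> (forall w, `|f w| <= g w) ->
  P.-integrable setT (EFin \o f).
Proof.
move=> mf ig fg; apply: (le_integrable measurableT _ _ ig); first exact/measurable_EFinP.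
by move=> w _; rewrite lee_fin (le_trans (fg w))// ler_norm.
Qed.

Lemma lty_mulr_gt0 {R : realDomainType} (a b : \bar R) :
  (0 <= a -> 0 < b -> a * b < +oo -> a < +oo)%E.
Proof.
case: a => [a| |] //; first by rewrite ltry.
by move=> _ b0; rewrite gt0_mulye.
Qed.

Lemma integral_affine {R : realType} (A B : R) :
  (\int[@lebesgue_measure R]_(t in `[0%R, 1%R]) (A + 4 * t * B)%:E = (A + 2 * B)%:E)%E.
Proof.
pose F (t : R) : R := A * t + (2 * B) * (t * t).
have dF (t : R) : is_derive t (1 : R) F (A + 4 * t * B).
  have i1 := is_derive_id t (1 : R).
  have h := is_deriveD (is_deriveZ A i1) (is_deriveZ (2 * B) (is_deriveM i1 i1)).
  by apply: (is_derive_eq h); rewrite /GRing.scale/=; ring.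
have cF : continuous F.
  by move=> t; apply: differentiable_continuous; apply/derivable1_diffP; have [] := dF t.
rewrite (continuous_FTC2 (F := F) ltr01).
- by rewrite -EFinB /F; congr EFin; ring.
- apply: continuous_subspaceT => t; apply: (@cvgD _ R^o); first exact: cvg_cst.
  by apply: (@cvgM _ R^o); [apply: (@cvgM _ R^o); [exact: cvg_cst|exact: cvg_id]|exact: cvg_cst].
- split; first by move=> t _; have [] := dF t.
    by apply: cvg_at_right_filter; exact: cF.
  by apply: cvg_at_left_filter; exact: cF.
- by move=> t _; rewrite derive1E; have [_] := dF t.
Qed.

(** On a probability space the L^b norm dominates the L^1 norm, here E|g| > 0. *)
Lemma gauss_norm_gt0 {R : realType} (b : \bar R) : (1 <= b)%E -> (0 < gauss_norm b)%E.
Proof.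
move=> b1; apply: lt_le_trans (@normal_abs_gt0 R) _.
have := @Lnorm_ge_mon _ _ R (normal_prob 0 1) b (fun x => x) b1 (@measurable_id _ _ _).
apply: le_trans; rewrite LnormE invr1 poweRe1; last first.
  by apply: integral_ge0 => w _; rewrite lee_fin powR_ge0.
by under [X in (_ <= X)%E]eq_integral do rewrite powRr1//.
Qed.

(** * The integral estimate, and the degenerate cases *)

Section core_estimates.
Context {dT} {T : measurableType dT} {R : realType} (P : probability T R).
Context {d : nat} (Z : {RV P >-> 'cV[R]_d}).
Hypothesis hZ : standard_gaussian P Z.
Context {dS} {S : measurableType dS} (V : T -> S).
Hypothesis mV : measurable_fun setT V.
Hypothesis indep : independent_RV P Z V.
Variables (hX hY : S -> 'cV[R]_d).
Hypotheses (mX : measurable_fun setT hX) (mY : measurable_fun setT hY).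
Variable H : S -> 'cV[R]_d -> 'cV[R]_d.
Hypothesis mH : measurable_fun setT (fun q : S * 'cV[R]_d => H q.1 q.2).
Hypothesis cdH : forall s, continuously_differentiable (H s).
Variables (p r : \bar R).
Hypotheses (p1 : (1 <= p)%E) (r1 : (1 <= r)%E).
Local Notation hp := (hpath hX hY).
Local Notation "'N_ p [ f ]" := (Lnorm P p (EFin \o f)).
Local Notation X := (hX \o V).
Local Notation Y := (hY \o V).
Local Notation HZ := (at_VZ Z V (FH H)).
Local Notation JZ := (at_VZ Z V (FJ H)).

Let h2 : (1 <= 2%:E :> \bar R)%E. Proof. by rewrite lee_fin ler1n. Qed.

Lemma dotv_delta (v : 'cV[R]_d) j : dotv v (delta_mx j 0) = v j 0.
Proof.
rewrite /dotv (bigD1 j)//= big1 ?addr0 => [|k kj]; rewrite !mxE ?eqxx ?mulr1//.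
by rewrite (negPf kj) mulr0.
Qed.

(** A coordinate of [Z] is its scalar product with a constant basis vector. *)
Lemma integrable_Z : integrableM P (at_VZ Z V (@FZ R d dS S)).
Proof.
move=> i j; rewrite ord1 /at_VZ /FZ /=; apply/integrableP; split.
  by apply/measurable_EFinP; apply: measurable_mx_coord; exact: measurable_funPT.
have := integral_dotv_abs hZ mV indep (hY := fun=> delta_mx i 0) (measurable_cst _).
under eq_integral do rewrite dotv_delta; under eq_integral do rewrite -abse_EFin.
move=> ->; rewrite integral_cst// [X in (_ * X * _)%E](@probability_setT _ _ _ P) mule1.
apply: lte_mul_pinfty; [by rewrite lee_fin lrnorm_ge0|by []|exact: normal_abs_lty].
Qed.

Lemma integrable_Y_norm : P.-integrable setT (fun w => (lrnorm 2%:E (hY (V w)))%:E) ->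
  forall j, P.-integrable setT (fun w => (hY (V w) j 0)%:E).
Proof.
move=> i j; apply: (integrable_dominated _ i) => [|w]; last exact: lrnorm_coord.
by apply: measurable_mx_coord; exact: measurableT_comp.
Qed.

(** E|<Z, Y>| is the product of E|Y|_2 and of the positive number E|g|. Integrability of Y is what
    the differentiation of the denominator requires. *)
Lemma integrable_Y : P.-integrable setT (fun w => (dotv (hY (V w)) (Z w))%:E) ->
  forall j, P.-integrable setT (fun w => (hY (V w) j 0)%:E).
Proof.
move=> /integrableP[_ i]; apply: integrable_Y_norm.
have mYV : measurable_fun setT (fun w => lrnorm 2%:E (hY (V w))).
  by apply: measurable_lrnorm; exact: measurableT_comp.
apply/integrableP; split; first exact/measurable_EFinP.
under eq_integral do rewrite gee0_abs ?lee_fin ?lrnorm_ge0//.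
apply: lty_mulr_gt0 (@normal_abs_gt0 R) _; first by apply: integral_ge0 => w _;
  rewrite lee_fin lrnorm_ge0.
rewrite -(integral_dotv_abs hZ mV indep mY).
by under eq_integral do rewrite dotvC -abse_EFin.
Qed.

Lemma core_integral : integral_estimate P p r X Y Z HZ JZ.
Proof.
move=> iH iJ iJY iHZY iHZ iYZ _.
have iZ := integrable_Z.
apply: (core_integral_estimate hZ mV indep mX mY mH cdH (integrable_Y iYZ) p1 r1
  iH iJ iJY iHZY iHZ iZ iYZ) => t _.
exact: (norm_six_sum_le hZ mV indep mX mY mH cdH p1 r1 iH iJ iJY iHZY iHZ iZ iYZ).
Qed.

(* When [H] or [Y] vanishes almost surely, a finite product of norms can hide an
   infinite factor ([0 * +oo = 0]), hence a separate treatment. *)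
Section degenerate.
Hypothesis iH : integrableM P HZ.

Lemma gap_null : {ae P, forall w, gapK P V hX hY H (start Z V hX w) (hY (V w)) = 0} ->
  cond_exp_gap P p r X Y Z HZ = 0%E.
Proof.
move=> h; rewrite (cond_exp_gapE hZ mV indep mX mY mH r p1 iH).
rewrite (@norm_pr_eq_ae _ _ _ _ _ _ r p1 _ (fun=> 0) (measurable_gapK Z mV mX mY mH)
  (measurable_cst _) h).
by rewrite /norm_pr; apply: (Lnorm_ae0 p1 (measurable_cst _)); apply: aeW => w; exact: lrnorm0.
Qed.

(** The kernel average of |H| has mean E|H| = 0, so both averages in [gapK] vanish almost surely. *)
Lemma gap_H0 : {ae P, forall w, HZ w = 0} -> cond_exp_gap P p r X Y Z HZ = 0%E.
Proof.
move=> H0; apply: gap_null; have aeF := ae_filter_ringOfSetsType P.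
have K0 t : {ae P, forall w, kexpM P V (hp t) (FH H) (start Z V hX w + t *: hY (V w)) = 0}.
  have mht := measurable_hpath mX mY t.
  have e i j : {ae P, forall w,
      kexp P V (hp t) (fun q => FH H q i j) (start Z V hX w + t *: hY (V w)) = 0}.
    have mF := measurable_mx_coord i j (measurable_FH mH).
    have maF : measurable_fun setT (fun q : S * 'cV[R]_d => (`|FH H q i j|)%:E).
      by apply/measurable_EFinP; exact: measurableT_comp.
    have := ae_kexpe0 hZ mV indep mht maF (fun q => _) _ => k0.
    have {}k0 := k0 (fun q => ltac:(by rewrite lee_fin)).
    have {}k0 : {ae P, forall w, kexpe P V (hp t) (fun q => (`|FH H q i j|)%:E)
        (kpath Z V (hp t) w) = 0%E}.
      by apply: k0; apply: filterS H0 => w; rewrite /at_VZ => ->; rewrite mxE normr0.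
    apply: filterS k0 => w k0; have := kexp_le P mV mht mF (kpath Z V (hp t) w).
    by rewrite k0 lee_fin normr_le0 kpath_hpath => /eqP.
  have := @filter_forall _ _ _ _ aeF (fun i => @filter_forall _ _ _ _ aeF (e i)).
  by apply: (@filterS _ _ aeF) => w hw; apply/matrixP => i j; rewrite !mxE hw.
by apply: (@filterS2 _ _ aeF _ _ _ _ (K0 1) (K0 0)) => w e1 e0; rewrite /gapK e1 e0 subrr.
Qed.

(** The points and the shifts at times 0 and 1 coincide, hence so do the two kernel averages. *)
Lemma gap_Y0 : {ae P, forall w, hY (V w) = 0} -> cond_exp_gap P p r X Y Z HZ = 0%E.
Proof.
move=> Y0; apply: gap_null; apply: filterS (Y0) => w E.
rewrite /gapK E !scaler0; apply/eqP; rewrite subr_eq0; apply/eqP.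
apply/matrixP => i j; rewrite [LHS]mxE [RHS]mxE.
have mF := measurable_mx_coord i j (measurable_FH mH).
apply: (@kexp_ae_eq _ _ _ P _ _ _ V _ _ _ _ mV (measurable_hpath mX mY 1)
  (measurable_hpath mX mY 0) mF).
by apply: filterS Y0 => w' E'; rewrite /hpath E' !scaler0.
Qed.

End degenerate.

End core_estimates.

(** * The moment estimate *)

Section moment.
Context {dT} {T : measurableType dT} {R : realType} (P : probability T R).
Context {d : nat} (Z : {RV P >-> 'cV[R]_d}).
Hypothesis hZ : standard_gaussian P Z.
Context {dS} {S : measurableType dS} (V : T -> S).
Hypothesis mV : measurable_fun setT V.
Hypothesis indep : independent_RV P Z V.
Variables (hX hY : S -> 'cV[R]_d).
Hypotheses (mX : measurable_fun setT hX) (mY : measurable_fun setT hY).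
Variable H : S -> 'cV[R]_d -> 'cV[R]_d.
Hypothesis mH : measurable_fun setT (fun q : S * 'cV[R]_d => H q.1 q.2).
Hypothesis cdH : forall s, continuously_differentiable (H s).
Local Notation "'N_ p [ f ]" := (Lnorm P p (EFin \o f)).
Local Notation X := (hX \o V).
Local Notation Y := (hY \o V).
Local Notation HZ := (at_VZ Z V (FH H)).
Local Notation JZ := (at_VZ Z V (FJ H)).

Lemma norm_pr_gt0 q s (W : T -> 'cV[R]_d) : (1 <= q)%E -> (1 <= s)%E ->
  measurable_fun setT W -> ~ {ae P, forall w, W w = 0} -> (0 < norm_pr P q s W)%E.
Proof.
move=> q1 s1 mW W0; rewrite lt0e Lnorm_ge0 andbT; apply/eqP => h; apply: W0.
have := Lnorm_eq0_ae q1 (measurable_lrnorm s mW) h.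
by apply: filterS => w; exact: lrnorm_eq0.
Qed.

Lemma lty_mul_gt0l (x y : \bar R) : (0 < x -> 0 <= y -> x * y < +oo -> y < +oo)%E.
Proof. by move=> x0 y0; rewrite muleC; exact: lty_mulr_gt0. Qed.

Variables (p r rho : \bar R).
Hypotheses (p1 : (1 <= p)%E) (r1 : (1 <= r)%E) (rho1 : (1 <= rho)%E).
Local Open Scope ereal_scope.
Variables (a c alpha0 beta0 alpha1 beta1 gamma1 alpha2 beta2 gamma2 : \bar R).
Hypotheses (a1 : 1 <= a) (c1 : 1 <= c) (al0 : 1 <= alpha0) (be0 : 1 <= beta0)
  (al1 : 1 <= alpha1) (be1 : 1 <= beta1) (ga1 : 1 <= gamma1)
  (al2 : 1 <= alpha2) (be2 : 1 <= beta2) (ga2 : 1 <= gamma2).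
Hypotheses (hac : p^-1 = a^-1 + c^-1) (h0 : p^-1 = alpha0^-1 + beta0^-1)
  (h1 : p^-1 = alpha1^-1 + beta1^-1 + gamma1^-1)
  (h2 : p^-1 = alpha2^-1 + beta2^-1 + gamma2^-1).
Local Notation TJ := (norm_op P a rho r JZ * norm_pr P c rho Y).
Local Notation Tg := (norm_pr P alpha0 r HZ * norm_pr P beta0 2%:E Y * gauss_norm beta0).
Local Notation TX := (norm_pr P alpha1 r HZ * norm_pr P beta1 2%:E X * norm_pr P gamma1 2%:E Y).
Local Notation TY := (norm_pr P alpha2 r HZ * norm_pr P beta2 2%:E Y * norm_pr P gamma2 2%:E Y).
Hypotheses (hJ : TJ < +oo) (hg : Tg < +oo) (hTX : TX < +oo) (hTY : TY < +oo).
Hypothesis iH : integrableM P HZ.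

Lemma TJ_ge0 : 0 <= TJ. Proof. by apply: mule_ge0; exact: Lnorm_ge0. Qed.
Lemma Tg_ge0 : 0 <= Tg.
Proof. by apply: mule_ge0; [apply: mule_ge0; exact: Lnorm_ge0|exact: Lnorm_ge0]. Qed.
Lemma TX_ge0 : 0 <= TX.
Proof. by apply: mule_ge0; [apply: mule_ge0; exact: Lnorm_ge0|exact: Lnorm_ge0]. Qed.
Lemma TY_ge0 : 0 <= TY.
Proof. by apply: mule_ge0; [apply: mule_ge0; exact: Lnorm_ge0|exact: Lnorm_ge0]. Qed.

Section nondegenerate.
Hypothesis H0 : ~ {ae P, forall w, HZ w = 0%R}.
Hypothesis Y0 : ~ {ae P, forall w, hY (V w) = 0%R}.

Let two1 : (1 <= 2%:E :> \bar R). Proof. by rewrite lee_fin ler1n. Qed.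

Lemma measurable_HZ : measurable_fun setT HZ.
Proof. exact: (measurableT_comp (measurable_FH mH) (measurable_VZ Z mV)). Qed.

Lemma measurable_YV : measurable_fun setT Y. Proof. exact: (measurableT_comp mY mV). Qed.

Lemma norm_H_gt0 q : 1 <= q -> 0 < norm_pr P q r HZ.
Proof. by move=> q1; exact: (norm_pr_gt0 q1 r1 measurable_HZ H0). Qed.

Lemma norm_Y_gt0 q s : 1 <= q -> 1 <= s -> 0 < norm_pr P q s Y.
Proof. by move=> q1 s1; exact: (norm_pr_gt0 q1 s1 measurable_YV Y0). Qed.

(** The norms of H and Y are positive here, and a finite product with a positive factor has a finite
    cofactor. The integrability of every term is drawn in this way from the finiteness of the four
    products. *)
Lemma norm_HY_lty : norm_pr P alpha0 r HZ * norm_pr P beta0 2%:E Y < +oo.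
Proof.
apply: (lty_mulr_gt0 _ (gauss_norm_gt0 be0) hg).
by apply: mule_ge0; exact: Lnorm_ge0.
Qed.

Lemma norm_H_lty : norm_pr P alpha0 r HZ < +oo.
Proof. exact: (lty_mulr_gt0 (Lnorm_ge0 _ _ _) (norm_Y_gt0 be0 two1) norm_HY_lty). Qed.

Lemma norm_Y_lty : norm_pr P beta0 2%:E Y < +oo.
Proof. exact: (lty_mul_gt0l (norm_H_gt0 al0) (Lnorm_ge0 _ _ _) norm_HY_lty). Qed.

Lemma gauss_norm_lty : gauss_norm beta0 < +oo.
Proof.
apply: (lty_mul_gt0l _ (Lnorm_ge0 _ _ _) hg).
by apply: mule_gt0; [exact: norm_H_gt0|exact: norm_Y_gt0].
Qed.

Lemma norm_Yg_lty : norm_pr P beta0 2%:E Y * gauss_norm beta0 < +oo.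
Proof.
apply: (lty_mul_gt0l (norm_H_gt0 al0)); last by rewrite muleA.
by apply: mule_ge0; exact: Lnorm_ge0.
Qed.

Lemma norm_J_lty : norm_op P a rho r JZ < +oo.
Proof. exact: (lty_mulr_gt0 (Lnorm_ge0 _ _ _) (norm_Y_gt0 c1 rho1) hJ). Qed.

Lemma norm_HX_lty : norm_pr P alpha1 r HZ * norm_pr P beta1 2%:E X < +oo.
Proof.
apply: (lty_mulr_gt0 _ (norm_Y_gt0 ga1 two1) hTX).
by apply: mule_ge0; exact: Lnorm_ge0.
Qed.

Lemma norm_X_lty : norm_pr P beta1 2%:E X < +oo.
Proof. exact: (lty_mul_gt0l (norm_H_gt0 al1) (Lnorm_ge0 _ _ _) norm_HX_lty). Qed.

Lemma norm_HY2_lty : norm_pr P alpha2 r HZ * norm_pr P beta2 2%:E Y < +oo.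
Proof.
apply: (lty_mulr_gt0 _ (norm_Y_gt0 ga2 two1) hTY).
by apply: mule_ge0; exact: Lnorm_ge0.
Qed.

Let fK (x : \bar R) : 0 <= x -> x < +oo -> x <= (fine x)%:E.
Proof. by move=> x0 xoo; rewrite fineK// ge0_fin_numE. Qed.

Let bJ := fK TJ_ge0 hJ.
Let bg := fK Tg_ge0 hg.
Let mS := measurable_scalar_terms mX mY mH cdH r1 rho1.

Let mat (F : S * 'cV[R]_d -> R) : measurable_fun setT F ->
  measurable_fun setT (fun w => F (V w, Z w)).
Proof. by move=> mF; exact: (measurableT_comp mF (measurable_VZ Z mV)). Qed.

(** Each function lies in an L^q space with q >= 1, found by Hoelder's inequality where it is a
    product. *)
Lemma integrable_scalar_terms : scalar_terms hX hY H r rho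
  (fun F => P.-integrable setT (fun w => (F (V w, Z w))%:E)).
Proof.
have [mnH mnJ mnJY [mnX mnY mnZY [mnXH mnYH mnZYH]]] := mS.
split.
- exact: (Lnorm_lty_integrable al0 (mat mnH) norm_H_lty).
- exact: (Lnorm_lty_integrable a1 (mat mnJ) norm_J_lty).
- apply: (Lnorm_lty_integrable p1 (mat mnJY)).
  exact: le_lt_trans (norm_nJY_le mV mX mY mH cdH p1 r1 rho1 a1 c1 hac bJ) (ltry _).
split.
- exact: (Lnorm_lty_integrable be1 (mat mnX) norm_X_lty).
- exact: (Lnorm_lty_integrable be0 (mat mnY) norm_Y_lty).
- apply: (Lnorm_lty_integrable be0 (mat mnZY)).
  apply: le_lt_trans norm_Yg_lty;
    rewrite (_ : (fun w => _) = (fun w => `|dotv (Z w) (hY (V w))|%R)).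
    exact: (Lnorm_abs_dotvZY hZ mV indep mY be0).
  by apply/funext => w; rewrite /nZY /FZY dotvC.
split.
- have [s [s1 hs _]] := hoelder_split p1 al1 be1 ga1 h1.
  apply: (Lnorm_lty_integrable s1 (mat mnXH)).
  exact: le_lt_trans (norm_nXH_le Z mV mX mY mH cdH r1 rho1 al1 be1 s1 hs) norm_HX_lty.
- have [s [s1 hs _]] := hoelder_split p1 al2 be2 ga2 h2.
  apply: (Lnorm_lty_integrable s1 (mat mnYH)).
  exact: le_lt_trans (norm_nYH_le Z mV mX mY mH cdH r1 rho1 al2 be2 s1 hs) norm_HY2_lty.
- apply: (Lnorm_lty_integrable p1 (mat mnZYH)).
  exact: le_lt_trans (norm_nZYH_le hZ mV indep mX mY mH cdH p1 r1 rho1 al0 be0 h0 bg) (ltry _).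
Qed.

(** Again Z_j = <Z, e_j>, and the Gaussian norm for [beta0] is finite as a factor of a finite
    product. The integrability of H Z^T rests on this bound. *)
Lemma Lnorm_Z_lty j : 'N_beta0[(fun w => `|Z w j 0%R|%R)] < +oo.
Proof.
have mj : measurable_fun setT (fun w => Z w j 0%R).
  by apply: measurable_mx_coord; exact: measurable_funPT.
have mc : measurable_fun setT (fun=> delta_mx j 0%R : 'cV[R]_d) := measurable_cst _.
have := @Lnorm_dotv_le _ _ _ _ _ _ hZ _ _ _ mV indep (fun=> delta_mx j 0%R)
  (measurable_cst _) beta0 be0.
have -> : (fun w => dotv (Z w) (delta_mx j 0%R)) = (fun w => Z w j 0%R).
  by apply/funext => w; rewrite dotv_delta.
move=> h; apply: le_lt_trans (le_lt_trans h _).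
  apply: (Lnorm_le_ae be0 _ mj); first exact: (measurableT_comp (@normr_measurable R setT)).
  by apply: aeW => w; rewrite normr_id.
have -> : (fun w : T => lrnorm 2%:E (delta_mx j 0%R : 'cV[R]_d)) =
   (fun w => lrnorm 2%:E (delta_mx j 0%R : 'cV[R]_d) * 1)%R by apply/funext => w; rewrite mulr1.
rewrite (Lnorm_scale P _ be0 (measurable_cst _)).
apply: lte_mul_pinfty; last exact: gauss_norm_lty.
  by apply: mule_ge0; [rewrite lee_fin|exact: Lnorm_ge0].
rewrite fin_numM// ge0_fin_numE; last exact: Lnorm_ge0.
exact: le_lt_trans (Lnorm_cst1_le P be0) (ltry _).
Qed.

Lemma integrable_dominated_VZ (F G : S * 'cV[R]_d -> R) : measurable_fun setT F ->
  P.-integrable setT (fun w => (G (V w, Z w))%:E) -> (forall q, `|F q| <= G q)%R ->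
  P.-integrable setT (fun w => (F (V w, Z w))%:E).
Proof. by move=> mF iG FG; apply: (integrable_dominated (mat mF) iG) => w; exact: FG. Qed.

(** An entry of column j is at most the norm of J e_j, hence at most the operator norm of J times
    the constant |e_j|_rho. *)
Lemma integrable_JZ : integrableM P JZ.
Proof.
have [_ inJ _ _] := integrable_scalar_terms.
move=> i j; have mF := measurable_mx_coord i j (measurable_FJ mH cdH).
pose k := lrnorm rho (delta_mx j 0%R : 'cV[R]_d).
apply: (integrable_dominated_VZ (F := fun q => FJ H q i j) (G := fun q => k * nJ H r rho q)%R mF).
  by under eq_fun do rewrite EFinM; exact: (integrableZl measurableT _ inJ).
move=> q; have := opnormP (FJ H q) (delta_mx j 0%R) rho1 r1; rewrite mulrC => h.
apply: (le_trans _ h); rewrite -colE; apply: le_trans (lrnorm_coord _ i r1).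
by rewrite [X in (_ <= `|X|)%R]mxE.
Qed.

Lemma integrable_JY : integrableM P (at_VZ Z V (FJY hY H)).
Proof.
have [_ _ inJY _] := integrable_scalar_terms.
move=> i j; rewrite ord1; have mF := measurable_mx_coord i 0%R (measurable_FJY mY mH cdH).
by apply: (integrable_dominated_VZ mF inJY) => q; exact: lrnorm_coord.
Qed.

Lemma integrable_HZY : integrableM P (at_VZ Z V (FHZY hY H)).
Proof.
have [_ _ _ [_ _ _ [_ _ iZYH]]] := integrable_scalar_terms.
move=> i j; rewrite ord1; have mF := measurable_mx_coord i 0%R (measurable_FHZY mY mH).
apply: (integrable_dominated_VZ mF iZYH) => q.
rewrite /FHZY mxE normrM /= /nZY /FZY dotvC.
by apply: ler_wpM2l; [exact: normr_ge0|exact: lrnorm_coord].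
Qed.

Lemma integrable_ZY : P.-integrable setT (fun w => (FZY hY (V w, Z w))%:E).
Proof.
have [_ _ _ [_ _ iZY _]] := integrable_scalar_terms.
by apply: (integrable_dominated_VZ (measurable_FZY mY) iZY) => q; exact: lexx.
Qed.

Lemma integrable_HZ : integrableM P (at_VZ Z V (FHZ H)).
Proof.
move=> i j; have mF := measurable_mx_coord i j (measurable_FHZ mH).
have mZj : measurable_fun setT (fun w => `|Z w j 0%R|%R).
  apply: (measurableT_comp (@normr_measurable R setT)).
  by apply: measurable_mx_coord; exact: measurable_funPT.
have [mnH _ _ _] := mS.
have mHZ := measurable_funM (mat mnH) mZj.
have iHZ : P.-integrable setT (EFin \o (fun w => nH H r (V w, Z w) * `|Z w j 0%R|)%R).
  apply: (Lnorm_lty_integrable p1 mHZ).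
  apply: le_lt_trans (Lnorm_hoelder_le p1 al0 be0 h0 (mat mnH) mZj (lexx _) (lexx _)) _.
  apply: lte_mul_pinfty; [exact: Lnorm_ge0| |exact: Lnorm_Z_lty].
  by rewrite ge0_fin_numE; [exact: norm_H_lty|exact: Lnorm_ge0].
apply: (integrable_dominated (mat mF) iHZ) => w.
rewrite /FHZ mxE big_ord1 normrM mxE.
by apply: ler_wpM2r; [exact: normr_ge0|exact: lrnorm_coord].
Qed.

Lemma integrable_YV : forall j, P.-integrable setT (fun w => (hY (V w) j 0%R)%:E).
Proof.
have [_ _ _ [_ iY _ _]] := integrable_scalar_terms.
exact: (integrable_Y_norm mV mY iY).
Qed.

Lemma moment_nondegenerate : cond_exp_gap P p r X Y Z HZ <=
  2%:E * TJ + 4%:E * Tg + 4%:E * TX + 2%:E * TY.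
Proof.
have bX := fK TX_ge0 hTX; have bY := fK TY_ge0 hTY.
have iZ := integrable_Z hZ mV indep.
have := core_integral_estimate hZ mV indep mX mY mH cdH integrable_YV p1 r1 iH
  integrable_JZ integrable_JY integrable_HZY integrable_HZ iZ integrable_ZY.
(* The bound of [norm_six_sum_moment]; the products are finite, so [fine] loses nothing. *)
pose N t : \bar R := (2 * fine TJ + 4 * fine Tg + 4 * fine TX + 4 * t * fine TY)%:E.
move=> /(_ N) hN; apply: le_trans (hN _) _.
  move=> t t01.
  exact: (norm_six_sum_moment hZ mV indep mX mY mH cdH p1 r1 rho1 a1 c1 al0 be0 al1 be1 ga1
    al2 be2 ga2 hac h0 h1 h2 bJ bg bX bY iH integrable_JZ integrable_JY integrable_HZY
    integrable_HZ iZ integrable_ZY integrable_scalar_terms t01).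
rewrite /N integral_affine !EFinD !EFinM !fineK ?ge0_fin_numE//.
- exact: TY_ge0.
- exact: TX_ge0.
- exact: Tg_ge0.
- exact: TJ_ge0.
Qed.

End nondegenerate.

Lemma moment_bound : cond_exp_gap P p r X Y Z HZ <=
  2%:E * TJ + 4%:E * Tg + 4%:E * TX + 2%:E * TY.
Proof.
have RHS0 : 0 <= 2%:E * TJ + 4%:E * Tg + 4%:E * TX + 2%:E * TY.
  have m0 k (x : \bar R) : 0 <= x -> 0 <= k%:R%:E * x.
    by move=> x0; apply: mule_ge0 => //; rewrite lee_fin ler0n.
  apply: adde_ge0; last exact: (m0 _ _ TY_ge0).
  apply: adde_ge0; last exact: (m0 _ _ TX_ge0).
  by apply: adde_ge0; [exact: (m0 _ _ TJ_ge0)|exact: (m0 _ _ Tg_ge0)].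
have [H0|H0] := pselect {ae P, forall w, HZ w = 0%R}.
  by rewrite (gap_H0 hZ mV indep mX mY mH p1 r1 iH H0).
have [Y0|Y0] := pselect {ae P, forall w, hY (V w) = 0%R}.
  by rewrite (gap_Y0 hZ mV indep mX mY mH p1 r1 iH Y0).
exact: moment_nondegenerate.
Qed.

End moment.

Section core_moment.
Context {dT} {T : measurableType dT} {R : realType} (P : probability T R).
Context {d : nat} (Z : {RV P >-> 'cV[R]_d}).
Hypothesis hZ : standard_gaussian P Z.
Context {dS} {S : measurableType dS} (V : T -> S).
Hypothesis mV : measurable_fun setT V.
Hypothesis indep : independent_RV P Z V.
Variables (hX hY : S -> 'cV[R]_d).
Hypotheses (mX : measurable_fun setT hX) (mY : measurable_fun setT hY).
Variable H : S -> 'cV[R]_d -> 'cV[R]_d.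
Hypothesis mH : measurable_fun setT (fun q : S * 'cV[R]_d => H q.1 q.2).
Hypothesis cdH : forall s, continuously_differentiable (H s).
Variables (p r : \bar R).
Hypotheses (p1 : (1 <= p)%E) (r1 : (1 <= r)%E).

Lemma core_moment : moment_estimate P p r (hX \o V) (hY \o V) Z
  (at_VZ Z V (FH H)) (at_VZ Z V (FJ H)).
Proof.
move=> rho a c alpha0 beta0 alpha1 beta1 gamma1 alpha2 beta2 gamma2.
move=> rho1 a1 c1 al0 be0 al1 be1 ga1 al2 be2 ga2 hac h0 h1 h2 tJ tg tX tY iH hJ hg hTX hTY.
exact: (moment_bound hZ mV indep mX mY mH cdH p1 r1 rho1 a1 c1 al0 be0 al1 be1 ga1
  al2 be2 ga2 hac h0 h1 h2 hJ hg hTX hTY iH).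
Qed.

End core_moment.

Theorem lemma5p3 (R : realType) (dT : measure_display) (T : measurableType dT)
    (P : probability T R) (d : nat) (p r : \bar R)
    (hp : (1 <= p)%E) (hr : (1 <= r)%E)
    (X Y Z : {RV P >-> 'cV[R]_d}) (hZ : standard_gaussian P Z) :
  (forall H : 'cV[R]_d -> 'cV[R]_d -> 'cV[R]_d -> 'cV[R]_d,
     measurable_fun [set: 'cV[R]_d * 'cV[R]_d * 'cV[R]_d]
       (fun q => H q.1.1 q.1.2 q.2) ->
     (forall x y, continuously_differentiable (H x y)) ->
     independent_RV P Z (fun w => (X w, Y w)) ->
     let HXYZ w := H (X w) (Y w) (Z w) in
     let JXYZ w := jac (H (X w) (Y w)) (Z w) in
     integral_estimate P p r X Y Z HXYZ JXYZ /\
     moment_estimate P p r X Y Z HXYZ JXYZ) /\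
  (forall (dU : measure_display) (TU : measurableType dU) (U : {RV P >-> TU})
     (H : 'cV[R]_d -> 'cV[R]_d -> 'cV[R]_d -> TU -> 'cV[R]_d),
     measurable_fun [set: 'cV[R]_d * 'cV[R]_d * 'cV[R]_d * TU]
       (fun q => H q.1.1.1 q.1.1.2 q.1.2 q.2) ->
     (forall x y u, continuously_differentiable (fun z => H x y z u)) ->
     independent_RV P Z (fun w => (X w, Y w, U w)) ->
     let HXYZ w := H (X w) (Y w) (Z w) (U w) in
     let JXYZ w := jac (fun z => H (X w) (Y w) z (U w)) (Z w) in
     integral_estimate P p r X Y Z HXYZ JXYZ /\
     moment_estimate P p r X Y Z HXYZ JXYZ).
Proof.
have mXY : measurable_fun setT (fun w => (X w, Y w)).
  by apply: measurable_fun_pair; exact: measurable_funPT.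
split=> [H mH cdH indep HXYZ JXYZ|dU TU U H mH cdH indep HXYZ JXYZ].
  have cd (s : 'cV[R]_d * 'cV[R]_d) : continuously_differentiable (H s.1 s.2).
    exact: cdH.
  split.
    exact: (core_integral hZ mXY indep measurable_fst measurable_snd
      (H := fun s z => H s.1 s.2 z) mH cd hp hr).
  exact: (core_moment hZ mXY indep measurable_fst measurable_snd
    (H := fun s z => H s.1 s.2 z) mH cd hp hr).
have mV : measurable_fun setT (fun w => (X w, Y w, U w)).
  by apply: measurable_fun_pair; [exact: mXY|exact: measurable_funPT].
have m1 : measurable_fun [set: 'cV[R]_d * 'cV[R]_d * TU] (fun s => s.1.1).
  exact: (measurableT_comp measurable_fst measurable_fst).
have m2 : measurable_fun [set: 'cV[R]_d * 'cV[R]_d * TU] (fun s => s.1.2).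
  exact: (measurableT_comp measurable_snd measurable_fst).
have cd (s : 'cV[R]_d * 'cV[R]_d * TU) :
  continuously_differentiable (fun z => H s.1.1 s.1.2 z s.2) by exact: cdH.
have mH' : measurable_fun [set: 'cV[R]_d * 'cV[R]_d * TU * 'cV[R]_d]
    (fun q => H q.1.1.1 q.1.1.2 q.2 q.1.2).
  apply: (measurableT_comp (f := fun q : 'cV[R]_d * 'cV[R]_d * 'cV[R]_d * TU =>
    H q.1.1.1 q.1.1.2 q.1.2 q.2)
    (g := fun q : 'cV[R]_d * 'cV[R]_d * TU * 'cV[R]_d => (q.1.1, q.2, q.1.2)) mH).
  apply: measurable_fun_pair; last exact: (measurableT_comp measurable_snd measurable_fst).
  apply: measurable_fun_pair; last exact: measurable_snd.
  exact: (measurableT_comp measurable_fst measurable_fst).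
split.
  exact: (core_integral hZ mV indep m1 m2
    (H := fun s z => H s.1.1 s.1.2 z s.2) mH' cd hp hr).
exact: (core_moment hZ mV indep m1 m2
  (H := fun s z => H s.1.1 s.1.2 z s.2) mH' cd hp hr).
Qed.
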